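(* Let $\varphi$ be the map defined by the recurrence $x_{n+2}x_n=x_{n+1}^2+1$, i.e. $\varphi:(x_n,x_{n+1})\mapsto(x_{n+1},x_{n+2})$, which generates Laurent polynomials $x_n\in\mathbb{Z}[x_1^{\pm1},x_2^{\pm1}]$ from the initial variables $x_1,x_2$, and let $\mathcal{A}$ be the coefficient-free cluster algebra of rank $2$ defined by the exchange matrix $B=\begin{pmatrix}0&2\\-2&0\end{pmatrix}$. Then the Mahler entropy of $\varphi$ is zero, $\mathcal{E}_M(\varphi)=0$, hence also $\mathcal{E}_M(\mathcal{A})=0$ for the cluster algebra. More precisely, the Mahler measure of the Laurent polynomials grows linearly with $n$, that is, as $n\to\infty$, $$m(x_n)=C^*n+O(1),\qquad\text{with}\qquad C^*=\int_{\mathbb{T}^2}\left|\log\left|\frac{K+\sqrt{K^2-4}}{2}\right|\right|\,\mathrm{d}\Omega\approx0.483997\ldots,$$ where $$K=K(x_1,x_2)=\frac{x_1}{x_2}+\frac{x_2}{x_1}+\frac{1}{x_1x_2}.$$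
   Context: $\mathbb{T}^2=\{(x_1,x_2)=(e^{\mathrm{i}t_1},e^{\mathrm{i}t_2}):t_j\in(-\pi,\pi]\}$ with normalized Haar measure $\mathrm{d}\Omega=\frac{\mathrm{d}t_1\,\mathrm{d}t_2}{(2\pi)^2}$. For a non-zero Laurent polynomial $P\in\mathbb{C}[x_1^{\pm1},x_2^{\pm1}]$ the (logarithmic) Mahler measure is $m(P)=\int_{\mathbb{T}^2}\log|P(x_1,x_2)|\,\mathrm{d}\Omega$. The integrand defining $C^*$ does not depend on the choice of square root. The Mahler entropy of the map is $\mathcal{E}_M(\varphi)=\lim_{n\to\infty}\frac{\log m(\varphi^n(\mathbf{x}))}{n}$, where $\mathbf{x}=(x_1,x_2)$ and $m(\varphi^n(\mathbf{x}))$ is the maximum of the Mahler measures of the components of $\varphi^n(\mathbf{x})$ (for recurrences such as this one it suffices to take $\lim_{n\to\infty}\frac{\log m(x_n)}{n}$). For the cluster algebra: a seed $(\mathbf{x},B)$ of rank $N$ consists of a cluster $\mathbf{x}=(x_1,\ldots,x_N)$ and a skew-symmetrizable integer matrix $B=(b_{ij})$. With $[a]_+=\max(a,0)$, the mutation $\mu_k$ ($1\le k\le N$) produces the seed $(\mathbf{x}',B')$ with $b'_{ij}=-b_{ij}$ if $i=k$ or $j=k$, $b'_{ij}=b_{ij}+\mathrm{sgn}(b_{ik})[b_{ik}b_{kj}]_+$ otherwise, and $x_j'=x_j$ for $j\ne k$, $x_k'=x_k^{-1}\big(\prod_jx_j^{[b_{kj}]_+}+\prod_jx_j^{[-b_{kj}]_+}\big)$.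 The cluster algebra $\mathcal{A}=\mathcal{A}(\mathbf{x},B)$ is the $\mathbb{Z}$-algebra generated by all elements (cluster variables) of all clusters $\boldsymbol\mu(\mathbf{x})$ obtained from the initial seed by compositions $\boldsymbol\mu=\mu_{k_n}\circ\cdots\circ\mu_{k_1}$ of mutations; $|\boldsymbol\mu|=n$ denotes the length of the composition. Here $N=2$. The Mahler entropy of $\mathcal{A}$ is $$\mathcal{E}_M(\mathcal{A})=\lim_{n\to\infty}\sup_{|\boldsymbol\mu|=n}\frac{\log m(\boldsymbol\mu(\mathbf{x}))}{n},$$ where $m(\boldsymbol\mu(\mathbf{x}))$ is the maximum of the Mahler measures of the elements of the cluster $\boldsymbol\mu(\mathbf{x})$. *)

(* Defs.v *)
From HB Require Import structures.
From mathcomp Require Import all_boot all_order all_algebra finmap complex.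
From mathcomp Require Import all_classical all_reals all_analysis.
Import Order.TTheory GRing.Theory Num.Theory.
Import numFieldNormedType.Exports.

Set Implicit Arguments.
Unset Strict Implicit.
Unset Printing Implicit Defensive.

Local Open Scope classical_set_scope.
Local Open Scope ring_scope.
Local Open Scope complex_scope.

(* Laurent polynomials in two variables with coefficients in A: the finitely
   supported families of coefficients indexed by the exponents in Z^2. *)
Definition laurent (A : zmodType) := {fsfun (int * int) -> A with 0}.

Definition laurent_eval (A : zmodType) (K : fieldType) (h : A -> K)
    (P : laurent A) (u v : K) : K :=
  \sum_(k <- finsupp P) h (P k) * u ^ k.1 * v ^ k.2.

Definition laurent_map (A A' : zmodType) (h : A -> A') (P : laurent A)
    : laurent A' :=
  [fsfun k in finsupp P => h (P k) | 0].

(* The ambient field Q(x1, x2), as the fraction field of Z[x1][x2]. *)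
Definition Qx : fieldType := {fraction {poly {poly int}}}.
Definition X1 : Qx := tofrac ('X%:P : {poly {poly int}}).
Definition X2 : Qx := tofrac ('X : {poly {poly int}}).

Definition laurent_frac (P : laurent int) : Qx :=
  laurent_eval (fun a : int => a%:~R) P X1 X2.

Definition is_laurent (f : Qx) : Prop :=
  exists P : laurent int, laurent_frac P = f.

Definition cis (R : realType) (t : R) : R[i] := cos t +i* sin t.

Definition torus (R : realType) : set (R * R) :=
  `]- pi, pi]%classic `*` `]- pi, pi]%classic.

Definition torus_integral (R : realType) (f : R[i] -> R[i] -> R) : R :=
  ((2 * pi) ^+ 2)^-1 *
  \int[(@lebesgue_measure R \x @lebesgue_measure R)%E]_(t in @torus R)
    f (cis t.1) (cis t.2).

(* ln 0 = 0 instead of -oo here, which only matters on the null set of zeros of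
   P in the torus. *)
Definition mahler (R : realType) (P : laurent R[i]) : R :=
  torus_integral (fun u v => ln (Normc.normc (laurent_eval id P u v))).

(* The Mahler measure of an element of Q(x1, x2) that is an integer Laurent
   polynomial P; the (unique) P is recovered by choice, and elements that are
   not Laurent polynomials get the irrelevant value mahler 0. *)
Definition mahlerQ (R : realType) (f : Qx) : R :=
  mahler (laurent_map (fun a : int => a%:~R)
    (xget [fsfun] [set P : laurent int | laurent_frac P = f])).

(* The map (x_n, x_{n+1}) |-> (x_{n+1}, x_{n+2}). *)
Definition phi (p : Qx * Qx) : Qx * Qx := (p.2, (p.2 ^+ 2 + 1) / p.1).

(* Indexed from n = 1: xseq 1 = x1, xseq 2 = x2. *)
Definition xseq (n : nat) : Qx := (iter n.-1 phi (X1, X2)).1.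

(* Terms log m / n of the sequences defining the entropies; lne sends 0 to -oo. *)
Definition map_entropy_seq (R : realType) (psi : Qx * Qx -> Qx * Qx)
    (n : nat) : \bar R :=
  let p := iter n psi (X1, X2) in
  (lne (Num.max (mahlerQ R p.1) (mahlerQ R p.2))%:E * (n%:R^-1)%:E)%E.

Section Seeds.
Variables (F : fieldType) (N : nat).

Definition skew_symmetrizable (B : 'M[int]_N) : Prop :=
  exists d : 'I_N -> int, (forall i, 0 < d i) /\
    forall i j, d i * B i j = - (d j * B j i).

Record seed := Seed {
  seed_cluster : 'I_N -> F;
  seed_matrix : 'M[int]_N;
  seed_skew : skew_symmetrizable seed_matrix }.

Definition pos_part (a : int) : int := Num.max a 0.

Definition mutate_exchange (k : 'I_N) (B : 'M[int]_N) : 'M[int]_N :=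
  \matrix_(i, j) if (i == k) || (j == k) then - B i j
                 else B i j + Num.sg (B i k) * pos_part (B i k * B k j).

Definition mutate_cluster (k : 'I_N) (B : 'M[int]_N) (x : 'I_N -> F) :
    'I_N -> F :=
  fun j => if j == k then
    (x k)^-1 * (\prod_i x i ^ pos_part (B k i) +
                \prod_i x i ^ pos_part (- B k i))
  else x j.

Lemma mutate_exchange_skew k B :
  skew_symmetrizable B -> skew_symmetrizable (mutate_exchange k B).
Proof.
case=> d [d0 dB]; exists d; split=> // i j; rewrite !mxE orbC.
case: ifP => _; first by rewrite !mulrN dB.
rewrite !mulrDr opprD dB; congr (_ + _).
have sgE i' : Num.sg (B i' k) = - Num.sg (B k i').
  by rewrite -[LHS]mul1r -(gtr0_sg (d0 i')) -sgrM dB sgrN sgrM gtr0_sg ?mul1r.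
have posM (c a : int) : 0 < c -> c * pos_part a = pos_part (c * a).
  by move=> c0; rewrite /pos_part maxr_pMr ?mulr0 // ltW.
have posE : d i * pos_part (B i k * B k j) = d j * pos_part (B j k * B k i).
  rewrite !posM // !mulrA dB (dB j k); congr pos_part.
  by rewrite !mulNr -!mulrA [B k i * _]mulrC.
have pos0 : pos_part 0 = 0 by exact: maxxx.
rewrite mulrCA posE [X in - X]mulrCA (sgE i) (sgE j).
rewrite mulNr mulNr opprK.
have [->|Bki0] := eqVneq (B k i) 0; first by rewrite mulr0 pos0 !mulr0 oppr0.
have [Bjk0|Bjk0] := eqVneq (B j k) 0; first by rewrite Bjk0 mul0r pos0 !mulr0 oppr0.
have [le0|gt0] := lerP (B j k * B k i) 0.
  by rewrite /pos_part (max_idPr le0) !mulr0 oppr0.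
have : Num.sg (B j k) * Num.sg (B k i) = 1 by rewrite -sgrM gtr0_sg.
rewrite sgE -mulNr => sg1; congr (_ * _); move: sg1.
by case: (sgrP (B k j)); case: (sgrP (B k i)).
Qed.

Definition mutate (s : seed) (k : 'I_N) : seed :=
  {| seed_cluster := mutate_cluster k (seed_matrix s) (seed_cluster s);
     seed_matrix := mutate_exchange k (seed_matrix s);
     seed_skew := mutate_exchange_skew k (seed_skew s) |}.

(* The composition of mutations whose first factor is the head of w. *)
Definition mutate_seq (s : seed) (w : seq 'I_N) : seed := foldl mutate s w.

End Seeds.

Definition cluster_mahler (R : realType) (N : nat) (s : seed Qx N) : \bar R :=
  \big[Order.max/-oo%E]_(i < N) (mahlerQ R (seed_cluster s i))%:E.

Definition cluster_entropy_seq (R : realType) (N : nat) (s : seed Qx N)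
    (n : nat) : \bar R :=
  ereal_sup [set (lne (cluster_mahler R (mutate_seq s w)) * (n%:R^-1)%:E)%E
            | w in [set: n.-tuple 'I_N]].

Definition exchange2 : 'M[int]_2 :=
  \matrix_(i, j) if (i < j)%N then 2 else if (j < i)%N then -2 else 0.

Lemma exchange2_skew : skew_symmetrizable exchange2.
Proof.
exists (fun=> 1); split=> // i j; rewrite !mxE !mul1r.
by case: (ltngtP i j).
Qed.

Definition seed2 : seed Qx 2 :=
  {| seed_cluster := fun i : 'I_2 => if i == ord0 then X1 else X2;
     seed_matrix := exchange2;
     seed_skew := exchange2_skew |}.

Definition Kfun (R : realType) (u v : R[i]) : R[i] :=
  u / v + v / u + 1 / (u * v).

(* The choice of square root is irrelevant: the two values of
   (K +- sqrt (K ^+ 2 - 4)) / 2 have product 1. *)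
Definition Cstar (R : realType) : R :=
  torus_integral (fun u v : R[i] =>
    `| ln (Normc.normc ((Kfun u v + sqrtC (Kfun u v ^+ 2 - 4)) / 2)) |).

(* Main.v *)
Require Import Defs.
From HB Require Import structures.
From mathcomp Require Import all_boot all_order all_algebra finmap complex.
From mathcomp Require Import all_classical all_reals all_analysis.
From mathcomp Require Import measurable_realfun zify ring lra.
Import Order.TTheory GRing.Theory Num.Theory.
Import numFieldNormedType.Exports.

Set Implicit Arguments.
Unset Strict Implicit.
Unset Printing Implicit Defensive.

Local Open Scope classical_set_scope.
Local Open Scope ring_scope.

(** On the torus the x_n satisfy the linear recurrence x_(n+1) + x_(n-1) = K x_n, because
  (x_n^2 + x_(n+1)^2 + 1) / (x_n x_(n+1)) = K is a conserved quantity.  Writing K = l + 1/l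
  with |l| >= 1, this gives (l - 1/l) x_(n+2) = A l^n - B l^(-n) with A B = -1, where A, B and
  1/A are bounded; hence log|x_(n+2)| = n log|l| + O(1) as soon as |l|^(2n) is large.  Since
  Im K = - sin (t1 + t2), the exceptional set has measure O(1/n) and lies in finitely many
  strips |sin (t1 + t2)| = O(1/n), on which log|x_n| is at most n log|l| plus a log-sine
  term, while on each line t1 + t2 = const Jensen's formula bounds the integral of log|x_n|
  below by 0.  So m(x_n) = n C* + O(1).

  For the constant, two applications of Jensen's formula and the rotation
  (s, t) -> (s + t, s - t) of the torus give
  C* = (2/pi)^2 \int_0^(pi/2) \int_0^(pi/2) log^+ (1 / (4 sin s sin t)) ds dt.
  The inner integral is S(1 / (4 sin t)) with S(k) = \sum_j c_j k^(2j+1) / (2j+1)^2, where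
  c_j = binom(2j, j) / 4^j, as long as sin t >= 1/2; the other values of t are reduced to these
  by symmetry.  What remains are integrals of powers of the cosecant.

  The clusters are pairs of consecutive solutions of the same linear recurrence, so they are
  bounded by 4^n on the torus after n mutations; the alternating word reaches x_(n+2), whose
  Mahler measure is at least 1 for large n. *)

(** * Integration over the circle and the torus *)

(** The linear recurrence is Vieta's rule: x_(n-1) and x_(n+1) are the two roots of X^2 - K x_n X +
    x_n^2 + 1. The main obstacle is that log|x_n| tends to -oo at the zeros of x_n, so the strips
    admit no pointwise lower bound. But they are unions of whole lines t1 + t2 = const, and in the
    coordinates of [shear] x_n restricted to such a line is, up to a power of e^{is}, a polynomial
    with unimodular leading coefficient; so the lower estimate is made line by line. As |K| <= 3 and
    |l| <= 4, replacing n log|l| by 0 on a set of measure O(1/n) costs a bounded amount. The quarter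
    square is cut at pi/6 because sin (pi/6) = 1/2: the integrand vanishes when both variables
    exceed pi/6, and the series S is evaluated only at k <= 1/2, where its terms decay at least like
    4^(-j). Elements of Q(x1, x2) are never expanded: their values on the torus are determined
    through [evaluates], and the Laurent property follows from the linear recurrence. *)

Section lebesgue_affine.
Variable R : realType.
Local Notation mu := (@lebesgue_measure R).
Local Open Scope ereal_scope.

Let measurable_shift (c : R) :
  measurable_fun setT ((fun x => x + c)%R : _ -> measurableTypeR R).
Proof. exact: measurable_funD. Qed.

Let measurable_double :
  measurable_fun setT ((fun x => 2 * x)%R : _ -> measurableTypeR R).
Proof. exact: mulrl_measurable. Qed.

(** The image of Lebesgue measure under a translation agrees with it on half-open intervals, hence
    everywhere. The dilation below is treated in the same way. *)
Lemma ge0_integral_shift (f : R -> \bar R) (c : R) :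
  measurable_fun setT f -> (forall x, 0 <= f x) ->
  \int[mu]_x f (x + c)%R = \int[mu]_x f x.
Proof.
move=> mf f0.
transitivity (\int[pushforward mu
    ((fun x => x + c)%R : _ -> measurableTypeR R)]_x f x).
  by rewrite ge0_integral_pushforward//; exact: measurable_shift.
apply: eq_measure_integral; first exact: measurable_shift.
move=> mf' A mA _; apply/esym.
apply: lebesgue_measure_unique => //= _ [[a b]] _ <-.
rewrite /= /pushforward.
rewrite (_ : _ @^-1` _ = `](a - c)%R, (b - c)%R]%classic); last first.
  by apply/seteqP; split => x /=; rewrite !in_itv/= ltrBlDr lerBrDr.
rewrite !lebesgue_measure_itv/= !lte_fin ltrD2r; case: ifPn => // _.
by rewrite -!EFinD; congr EFin; ring.
Qed.

Lemma ge0_integral_double (f : R -> \bar R) :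
  measurable_fun setT f -> (forall x, 0 <= f x) ->
  \int[mu]_x f (2 * x)%R = 2^-1%:E * \int[mu]_x f x.
Proof.
move=> mf f0.
transitivity (\int[pushforward mu
    ((fun x => 2 * x)%R : _ -> measurableTypeR R)]_x f x).
  by rewrite ge0_integral_pushforward//; exact: measurable_double.
have nn2 : (0 <= (2%:R : R))%R by [].
pose m2 := mscale (NngNum nn2) (pushforward mu
   ((fun x => 2 * x)%R : _ -> measurableTypeR R)).
have -> : \int[mu]_x f x = \int[m2 measurable_double]_x f x.
  apply: eq_measure_integral => A mA _.
  apply: lebesgue_measure_unique => //= _ [[a b]] _ <-.
  rewrite /m2 /= /mscale/= /pushforward.
  rewrite (_ : _ @^-1` _ = `](a / 2)%R, (b / 2)%R]%classic); last first.
    apply/seteqP; split => x /=; rewrite !in_itv/= ltr_pdivrMr// ler_pdivlMr//;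
    by rewrite mulrC.
  rewrite !lebesgue_measure_itv/= !lte_fin ltr_pM2r//; case: ifPn => //.
    by move=> _; rewrite -!EFinD -EFinM; congr EFin; field.
  by rewrite mule0.
rewrite ge0_integral_mscale// muleA -EFinM mulVf// mul1e//.
Qed.

Lemma ge0_integral_opp (f : R -> \bar R) :
  measurable_fun setT f -> (forall x, 0 <= f x) ->
  \int[mu]_x f (- x)%R = \int[mu]_x f x.
Proof.
move=> mf f0.
transitivity (\int[pushforward mu (-%R : _ -> measurableTypeR R)]_x f x).
  by rewrite ge0_integral_pushforward//; exact: oppr_measurable.
by apply: eq_measure_integral => //= A mA _; exact: lebesgue_measureN.
Qed.

End lebesgue_affine.

Lemma Npi_lt_pi (R : realType) : - pi < pi :> R.
Proof. by rewrite gtrN// pi_gt0. Qed.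

(** Normalized Haar measure of the circle, in the angular coordinate. *)
Notation circle R := (uniform_prob (Npi_lt_pi R)).

Definition periodic2pi (R : realType) (T : Type) (f : R -> T) :=
  forall x, f (x + pi *+ 2) = f x.

Lemma periodic2pi_int (R : realType) (T : Type) (f : R -> T) (k : int) x :
  periodic2pi f -> f (x + pi *+ 2 *~ k) = f x.
Proof.
move=> pf; have pfn (n : nat) y : f (y + pi *+ 2 *+ n) = f y.
  by elim: n y => [y|n IH y]; rewrite ?mulr0n ?addr0// mulrSr addrA pf IH.
case: k => k; first by rewrite -pmulrn pfn.
by rewrite NegzE mulrNz -pmulrn -[LHS](pfn k.+1) addrNK.
Qed.

Section circle_invariance.
Variable R : realType.
Local Notation mu := (@lebesgue_measure R).
Local Notation U := (circle R).
Implicit Types f : R -> \bar R.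
Local Open Scope ereal_scope.

Lemma ge0_circleE f : measurable_fun setT f -> (forall x, 0 <= f x) ->
  \int[U]_x f x = ((2 * pi)^-1)%:E * \int[mu]_(x in `](- pi)%R, pi]) f x.
Proof.
move=> mf f0; rewrite integral_uniform// integral_itv_obnd_cbnd.
  by congr (_%:E * _); congr (_^-1)%R; ring.
exact: measurable_funTS.
Qed.

Lemma ge0_integral_shift_itv f (c a b : R) :
  measurable_fun setT f -> (forall x, 0 <= f x) ->
  \int[mu]_(x in `]a, b]) f (x + c)%R = \int[mu]_(x in `](a + c)%R, (b + c)%R]) f x.
Proof.
move=> mf f0; rewrite integral_mkcond [RHS]integral_mkcond.
rewrite -[RHS](ge0_integral_shift c); last 2 first.
- by apply/(measurable_restrictT _ _).1 => //; exact: measurable_funTS.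
- by move=> x; rewrite patchE; case: ifPn.
apply: eq_integral => x _; rewrite !patchE.
by congr (if _ then _ else _); apply/idP/idP; rewrite !inE/= !in_itv/= ltrD2r lerD2r.
Qed.

Lemma ge0_integral_opp_itv f (a b : R) :
  measurable_fun setT f -> (forall x, 0 <= f x) ->
  \int[mu]_(x in `]a, b]) f (- x)%R = \int[mu]_(x in `](- b)%R, (- a)%R]) f x.
Proof.
move=> mf f0; rewrite -[RHS]integral_itv_bndo_bndc; last exact: measurable_funTS.
rewrite [RHS]integral_itv_obnd_cbnd; last exact: measurable_funTS.
rewrite integral_mkcond [RHS]integral_mkcond -[RHS]ge0_integral_opp.
- apply: eq_integral => x _; rewrite !patchE.
  congr (if _ then _ else _).
  by apply/idP/idP; rewrite !inE/= !in_itv/= lerN2 ltrN2 andbC.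
- by apply/(measurable_restrictT _ _).1 => //; exact: measurable_funTS.
- by move=> x; rewrite patchE; case: ifPn.
Qed.

Lemma ge0_integral_itv_split f (x y z : R) : measurable_fun setT f ->
  (forall t, 0 <= f t) -> (x <= y)%R -> (y <= z)%R ->
  \int[mu]_(t in `]x, z]) f t =
  \int[mu]_(t in `]x, y]) f t + \int[mu]_(t in `]y, z]) f t.
Proof.
move=> mf f0 xy yz; rewrite -ge0_integral_setU//.
- by rewrite -itv_bndbnd_setU// bnd_simp.
- exact: measurable_funTS.
- rewrite disj_set2E; apply/eqP; rewrite -subset0 => t /= [].
  by rewrite !in_itv/= => /andP[_ ty] /andP[/lt_le_trans/(_ ty)]; rewrite ltxx.
Qed.

Let period f (a : R) := \int[mu]_(x in `]a, (a + pi *+ 2)%R]) f x.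

(** The piece []a, b]] reappears, moved by a full period, at the other end of the interval. *)
Let period_le f (a b : R) : measurable_fun setT f -> (forall x, 0 <= f x) ->
  periodic2pi f -> (a <= b <= a + pi *+ 2)%R -> period f a = period f b.
Proof.
move=> mf f0 pf /andP[ab ba].
rewrite /period (@ge0_integral_itv_split _ a b)//.
rewrite (@ge0_integral_itv_split _ b (a + pi *+ 2)%R (b + pi *+ 2)%R)//.
  rewrite addeC; congr (_ + _).
  rewrite -[RHS]ge0_integral_shift_itv//.
  by apply: eq_integral => x _; rewrite pf.
by rewrite lerD2r.
Qed.

Lemma ge0_circle_shift f (c : R) : measurable_fun setT f ->
  (forall x, 0 <= f x) -> periodic2pi f ->
  \int[U]_x f (x + c)%R = \int[U]_x f x.
Proof.
move=> mf f0 pf.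
have pi2 : (0 < pi *+ 2 :> R)%R by rewrite pmulrn_rgt0// pi_gt0.
pose k := Num.floor (c / (pi *+ 2))%R.
pose d := (c - (pi *+ 2) *~ k)%R.
have dE x : f (x + c)%R = f (x + d)%R.
  by rewrite /d addrA -mulrNz periodic2pi_int.
have /andP[d0 d2] : (0 <= d <= pi *+ 2)%R.
  have /andP[h1 h2] := floor_itv (c / (pi *+ 2))%R.
  move: h1 h2; rewrite -/k ler_pdivlMr// ltr_pdivrMr// intrD mulrDl mul1r => h1 h2.
  by rewrite /d -mulrzl subr_ge0 h1 lerBlDl ltW.
under eq_integral do rewrite dE.
rewrite !ge0_circleE//; last first.
  by apply: (measurableT_comp mf); exact: measurable_funD.
congr (_ * _); rewrite ge0_integral_shift_itv//.
have := @period_le f (- pi)%R (- pi + d)%R mf f0 pf.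
rewrite /period lerDl lerD2l d0 d2 => /(_ isT).
have -> : (- pi + pi *+ 2 = pi :> R)%R by ring.
have -> : (- pi + d + pi *+ 2 = pi + d :> R)%R by ring.
by move=> ->.
Qed.

Lemma ge0_circle_double f : measurable_fun setT f ->
  (forall x, 0 <= f x) -> periodic2pi f ->
  \int[U]_x f (2 * x)%R = \int[U]_x f x.
Proof.
move=> mf f0 pf.
have pi0 := pi_gt0 R.
rewrite !ge0_circleE//; last first.
  by apply: (measurableT_comp mf); exact: measurable_funM.
congr (_ * _).
transitivity (2^-1%:E * \int[mu]_(x in `](- (2 * pi))%R, (2 * pi)%R]) f x).
  rewrite integral_mkcond [in RHS]integral_mkcond -ge0_integral_double.
  - apply: eq_integral => x _; rewrite !patchE.
    congr (if _ then _ else _).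
    by apply/idP/idP; rewrite !inE/= !in_itv/= => /andP[? ?]; apply/andP; split; lra.
  - by apply/(measurable_restrictT _ _).1 => //; exact: measurable_funTS.
  - by move=> x; rewrite patchE; case: ifPn.
rewrite (@ge0_integral_itv_split _ _ 0%R)//; [|lra..].
have := @period_le f (- (2 * pi))%R (- pi)%R mf f0 pf.
have := @period_le f (- pi)%R 0%R mf f0 pf.
rewrite /period.
have -> : (- pi + pi *+ 2 = pi :> R)%R by ring.
have -> : (- (2 * pi) + pi *+ 2 = 0 :> R)%R by ring.
have -> : (0 + pi *+ 2 = 2 * pi :> R)%R by ring.
move=> <-; last by apply/andP; split; lra.
move=> <-; last by apply/andP; split; lra.
by rewrite -mule2n -mule_natl muleA -EFinM mulVf// mul1e.
Qed.

(** [|sin x|] is invariant under x -> x + pi and x -> pi - x, so the circle consists of four copies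
    of a quarter period, on which sin is nonnegative. *)
Lemma ge0_circle_abs_sin f : measurable_fun setT f -> (forall x, 0 <= f x) ->
  \int[U]_x f `|sin x|%R = (2 / pi)%:E * \int[mu]_(x in `]0%R, (pi / 2)%R]) f (sin x).
Proof.
move=> mf f0; pose g x := f `|sin x|%R.
have pi0 := pi_gt0 R.
have mg : measurable_fun setT g.
  apply: (measurableT_comp mf); apply: measurableT_comp => //.
  by apply: continuous_measurable_fun; exact: continuous_sin.
have g0 x : 0 <= g x by exact: f0.
rewrite -/g ge0_circleE// (@ge0_integral_itv_split _ _ 0%R pi)//; [|lra..].
have -> : \int[mu]_(x in `](- pi)%R, 0%R]) g x = \int[mu]_(x in `]0%R, pi]) g x.
  have /= := @ge0_integral_shift_itv g pi (- pi)%R 0%R mg (fun=> f0 _).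
  rewrite addNr add0r => <-; apply: eq_integral => x _.
  by rewrite /g sinDpi normrN.
have -> : \int[mu]_(x in `]0%R, pi]) g x =
    2%:E * \int[mu]_(x in `]0%R, (pi / 2)%R]) g x.
  rewrite (@ge0_integral_itv_split _ _ (pi / 2)%R pi)//; [|lra..].
  rewrite -[X in _ + X](_ : \int[mu]_(x in `]0%R, (pi / 2)%R]) g x = _).
    by rewrite -mule2n -mule_natl.
  have mgN : measurable_fun setT (fun x : R => g (- x)%R).
    by apply: (measurableT_comp mg); exact: oppr_measurable.
  have /= := @ge0_integral_shift_itv g pi (- (pi / 2))%R 0%R mg (fun=> f0 _).
  have -> : (- (pi / 2) + pi = pi / 2 :> R)%R by field.
  rewrite add0r => <-.
  have /= := @ge0_integral_opp_itv _ 0%R (pi / 2)%R mgN (fun=> f0 _).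
  rewrite oppr0 => h.
  transitivity (\int[mu]_(x in `](- (pi / 2))%R, 0%R]) g (- x)%R).
    by rewrite -h; apply: eq_integral => x _; rewrite opprK.
  by apply: eq_integral => x _; rewrite /g sinDpi sinN.
rewrite -mule2n -mule_natl muleA muleA -!EFinM; congr (_%:E * _).
  by move: (pi) pi0 => p p0; field; rewrite gt_eqF.
apply: eq_integral => x; rewrite inE/= in_itv/= => /andP[x0 x2].
by rewrite /g ger0_norm// sin_ge0_pi// (ltW x0)/=; lra.
Qed.

Lemma ge0_circle_opp f : measurable_fun setT f -> (forall x, 0 <= f x) ->
  \int[U]_x f (- x)%R = \int[U]_x f x.
Proof.
move=> mf f0; rewrite !integral_uniform//; last first.
  by apply: (measurableT_comp mf); exact: oppr_measurable.
congr (_ * _); rewrite integral_mkcond [RHS]integral_mkcond.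
rewrite -[RHS]ge0_integral_opp.
- apply: eq_integral => x _; rewrite !patchE.
  congr (if _ then _ else _).
  by apply/idP/idP; rewrite !inE/= !in_itv/= => /andP[? ?]; apply/andP; split; lra.
- by apply/(measurable_restrictT _ _).1 => //; exact: measurable_funTS.
- by move=> x; rewrite patchE; case: ifPn.
Qed.

End circle_invariance.

Section circle_signed.
Variable R : realType.
Local Notation U := (circle R).
Implicit Types f : R -> R.

Let signed_transfer (h : R -> R) f :
  (forall g : R -> \bar R, measurable_fun setT g -> (forall x, 0 <= g x)%E ->
    periodic2pi g -> (\int[U]_x g (h x) = \int[U]_x g x)%E) ->
  measurable_fun setT f -> periodic2pi f ->
  (\int[U]_x (f (h x))%:E = \int[U]_x (f x)%:E)%E.
Proof.
move=> H mf pf; have mf' : measurable_fun setT (EFin \o f) by exact/measurable_EFinP.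
rewrite integralE [RHS]integralE; congr (_ - _)%E.
- rewrite -[RHS]H; first by apply: eq_integral => x _; rewrite !funeposE.
  + exact: measurable_funepos.
  + by [].
  + by move=> x; rewrite !funeposE/= pf.
- rewrite -[RHS]H; first by apply: eq_integral => x _; rewrite !funenegE.
  + exact: measurable_funeneg.
  + by [].
  + by move=> x; rewrite !funenegE/= pf.
Qed.

Lemma circle_shift f (c : R) : measurable_fun setT f -> periodic2pi f ->
  (\int[U]_x (f (x + c))%:E = \int[U]_x (f x)%:E)%E.
Proof.
by apply: (@signed_transfer (fun x => x + c)) => g *; exact: ge0_circle_shift.
Qed.

Lemma circle_double f : measurable_fun setT f -> periodic2pi f ->
  (\int[U]_x (f (2 * x))%:E = \int[U]_x (f x)%:E)%E.
Proof. by apply: (@signed_transfer (fun x => 2 * x)) => g *; exact: ge0_circle_double. Qed.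

End circle_signed.

Section torus_invariance.
Variable R : realType.
Local Notation U := (circle R).
Local Open Scope ereal_scope.

Definition periodic2pi2 T (F : R * R -> T) :=
  (forall s t, F (s + pi *+ 2, t)%R = F (s, t)) /\
  (forall s t, F (s, t + pi *+ 2)%R = F (s, t)).

Variable F : R * R -> \bar R.
Hypotheses (mF : measurable_fun setT F) (F0 : forall x, 0 <= F x)
  (pF : periodic2pi2 F).

Let measurable_aff (a b c d : R) :
  measurable_fun setT (fun x : R * R => (a * x.1 + b * x.2, c * x.1 + d * x.2))%R.
Proof.
by apply: measurable_fun_pair => /=; apply: measurable_funD;
  apply: measurable_funM => //.
Qed.

Let p1 t : periodic2pi (fun s => F (s, t)). Proof. by move=> s; exact: pF.1. Qed.
Let p2 s : periodic2pi (fun t => F (s, t)). Proof. by move=> t; exact: pF.2. Qed.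

(* Shearing one coordinate at a time: the torus endomorphism (s, t) |-> (s + t, s - t). *)
Lemma ge0_torus_rotate :
  \int[U \x U]_x F (x.1 + x.2, x.1 - x.2)%R = \int[U \x U]_x F x.
Proof.
have m1 t : measurable_fun setT (fun s => F (s, t)) by exact: measurableT_comp.
have m2 s : measurable_fun setT (fun t => F (s, t)) by exact: measurableT_comp.
have mG : measurable_fun setT (fun x : R * R => F (x.1 + x.2, x.1 - x.2))%R.
  apply: (measurableT_comp mF).
  have := measurable_aff 1 1 1 (-1).
  by under eq_fun do rewrite !mul1r mulN1r.
have mH : measurable_fun setT (fun x : R * R => F (x.1, x.1 - 2 * x.2))%R.
  apply: (measurableT_comp mF).
  have := measurable_aff 1 0 1 (-2).
  by under eq_fun do rewrite !mul1r mul0r addr0 mulNr.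
rewrite fubini_tonelli2//= [RHS]fubini_tonelli1//= /fubini_F /fubini_G/=.
(* Shifting s by t absorbs the first coordinate. In the second one, s - 2t is then reduced to t by
   the shift, doubling and reflection invariance of the circle. *)
transitivity (\int[U]_t \int[U]_s F (s, s - 2 * t)%R).
  apply: eq_integral => t _.
  rewrite -[RHS](ge0_circle_shift t)//.
  - by apply: eq_integral => s _; congr (F (_, _)); ring.
  - exact: (measurableT_comp mH (pair2_measurable t)).
  - move=> s; rewrite pF.1.
    have -> : (s + pi *+ 2 - 2 * t = (s - 2 * t) + pi *+ 2)%R by ring.
    by rewrite pF.2.
transitivity (\int[U]_s \int[U]_t F (s, s - 2 * t)%R).
  have E := @fubini_tonelli _ _ _ _ R (circle R) (circle R) _ mH (fun x => F0 _).
  exact: (esym E).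
apply: eq_integral => s _.
rewrite -[RHS](ge0_circle_shift s)//.
rewrite -[RHS]ge0_circle_double//; last 2 first.
- by apply: (measurableT_comp (m2 s)); exact: measurable_funD.
- by move=> t; rewrite addrAC pF.2.
rewrite -[RHS]ge0_circle_opp//; last first.
  apply: (measurableT_comp (m2 s)); apply: measurable_funD => //.
by apply: eq_integral => t _; congr (F (_, _)); ring.
Qed.

End torus_invariance.

(** * Calculus on the real line *)

Section calculus.
Variable R : realType.
Local Notation mu := (@lebesgue_measure R).
Implicit Types F f g : R -> R.

Lemma is_derive_continuous F (x df : R) : is_derive x 1 F df -> {for x, continuous F}.
Proof. by move=> [dF _]; apply: differentiable_continuous; exact/derivable1_diffP. Qed.

Lemma der_eq f (x a b : R) : is_derive x 1 f a -> a = b -> is_derive x 1 f b.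
Proof. by move=> ? <-. Qed.

Lemma der_id (x : R) : is_derive x 1 (fun y : R => y) 1.
Proof. exact: is_derive_id. Qed.

Lemma der_cst (c x : R) : is_derive x 1 (fun _ : R => c) 0.
Proof. exact: is_derive_cst. Qed.

Lemma derD f g (x a b : R) : is_derive x 1 f a -> is_derive x 1 g b ->
  is_derive x 1 (fun y => f y + g y) (a + b).
Proof. exact: is_deriveD. Qed.

Lemma derB f g (x a b : R) : is_derive x 1 f a -> is_derive x 1 g b ->
  is_derive x 1 (fun y => f y - g y) (a - b).
Proof. exact: is_deriveB. Qed.

Lemma derM f g (x a b : R) : is_derive x 1 f a -> is_derive x 1 g b ->
  is_derive x 1 (fun y => f y * g y) (a * g x + f x * b).
Proof.
move=> df dg; apply: (is_derive_eq (is_deriveM df dg)).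
by rewrite /GRing.scale/= addrC mulrC.
Qed.

Lemma derZ (c : R) f (x a : R) : is_derive x 1 f a ->
  is_derive x 1 (fun y => c * f y) (c * a).
Proof. exact: is_deriveZ. Qed.

Lemma derX n f (x a : R) : is_derive x 1 f a ->
  is_derive x 1 (fun y => f y ^+ n) (n%:R * f x ^+ n.-1 * a).
Proof.
move=> df; rewrite (_ : (fun y => _) = f ^+ n); first exact: is_deriveX.
by apply/funext => y; rewrite exprfctE.
Qed.

Lemma der_comp f g (x a b : R) : is_derive x 1 f a -> is_derive (f x) 1 g b ->
  is_derive x 1 (fun y => g (f y)) (b * a).
Proof.
move=> df dg; have [df1 df2] := df; have [dg1 dg2] := dg.
split; first by apply/derivable1_diffP; apply: differentiable_comp; exact/derivable1_diffP.
have := @derive1_comp R f g x df1 dg1.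
by rewrite !derive1E df2 dg2.
Qed.

Lemma derV f (x a : R) : f x != 0 -> is_derive x 1 f a ->
  is_derive x 1 (fun y => (f y)^-1) (- a / f x ^+ 2).
Proof.
move=> fx0 [df1 df2]; split; first exact: derivableV.
by rewrite deriveV// df2 /GRing.scale/= mulNr mulrC mulNr.
Qed.

Lemma FTC_is_derive F f (a b : R) : a < b ->
  (forall x, a <= x <= b -> is_derive x 1 F (f x)) ->
  (forall x, a <= x <= b -> {for x, continuous f}) ->
  (\int[mu]_(x in `[a, b]) (f x)%:E = (F b - F a)%:E)%E.
Proof.
move=> ab dF cf; rewrite (@continuous_FTC2 _ f F)//.
- apply: continuous_in_subspaceT => x; rewrite inE/= in_itv/=; exact: cf.
- split.
  + move=> x; rewrite in_itv/= => /andP[ax xb].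
    by have [] := dF x; rewrite ?ltW.
  + apply: cvg_at_right_filter; apply: is_derive_continuous (dF a _).
    by rewrite lexx ltW.
  + apply: cvg_at_left_filter; apply: is_derive_continuous (dF b _).
    by rewrite lexx ltW.
- move=> x; rewrite in_itv/= => /andP[ax xb]; rewrite derive1E.
  by have [] := dF x; rewrite ?ltW.
Qed.

Lemma is_derive_ge0_le F f (a b : R) : a <= b ->
  (forall x, a < x < b -> is_derive x 1 F (f x)) ->
  (forall x, a <= x <= b -> {for x, continuous F}) ->
  (forall x, a < x < b -> 0 <= f x) -> F a <= F b.
Proof.
rewrite le_eqVlt => /predU1P[->//|ab] dF cF f0.
have dF' x : x \in `]a, b[ -> is_derive x 1 F (f x) by rewrite in_itv/=; exact: dF.
have cF' : {within `[a, b], continuous F}.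
  by apply: continuous_in_subspaceT => x; rewrite inE/= in_itv/=; exact: cF.
have [x xab FE] := MVT ab dF' cF'.
rewrite -subr_ge0 FE mulr_ge0 ?subr_ge0 ?(ltW ab)//.
by apply: f0; move: xab; rewrite in_itv.
Qed.

(* The integrand may be unbounded at 0: only the primitive has a limit there. *)
Lemma ge0_FTC_right0 F f (b l : R) : 0 < b ->
  (forall x, 0 < x <= b -> is_derive x 1 F (f x)) ->
  (forall x, 0 < x <= b -> {for x, continuous f}) ->
  (forall x, 0 < x <= b -> 0 <= f x) ->
  F x @[x --> 0^'+] --> l ->
  (\int[mu]_(x in `]0%R, b]) (f x)%:E = (F b - l)%:E)%E.
Proof.
move=> b0 dF cf f0 Fl.
(* The intervals [[e n, b]] increase to []0, b]]. The shift by 2 keeps [e n < b] already for n = 0,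
   as the fundamental theorem on [[e n, b]] requires. *)
pose e n : R := b / (n.+2)%:R.
have e0 n : 0 < e n by rewrite divr_gt0.
have eb n : e n < b by rewrite ltr_pdivrMr// ltr_pMr// ltr1n.
have cvge : e n @[n --> \oo] --> (0:R).
  rewrite -[X in _ --> X](mulr0 b); apply: cvgMr.
  have := @cvg_harmonic R; rewrite -cvg_shiftS; exact.
have bigE : `]0, b]%classic = \bigcup_n `[e n, b]%classic.
  apply/seteqP; split => x /=.
    rewrite in_itv/= => /andP[x0 xb].
    have /cvgrPdist_lt/(_ _ x0)[n _ /(_ n (leqnn n))] := cvge.
    rewrite /= sub0r normrN ger0_norm ?ltW// => enx.
    by exists n => //=; rewrite in_itv/= xb ltW.
  by move=> [n _] /=; rewrite !in_itv/= => /andP[ex ->]; rewrite (lt_le_trans (e0 n)).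
have cvI : (\int[mu]_(x in `[e n, b]) (f x)%:E)%E @[n --> \oo] -->
    (\int[mu]_(x in `]0%R, b]) (f x)%:E)%E.
  rewrite bigE; apply: ge0_nondecreasing_set_cvg_integral.
  - move=> n m nm; apply/subsetPset => x /=; rewrite !in_itv/= => /andP[+ ->].
    rewrite andbT; apply: le_trans; rewrite ler_pM2l// lef_pV2 ?posrE//.
    by rewrite ler_nat ltnS ltnS.
  - by [].
  - move=> n; apply/measurable_EFinP; apply: subspace_continuous_measurable_fun => //.
    apply: continuous_in_subspaceT => x; rewrite inE/= in_itv/= => /andP[ex xb].
    by apply: cf; rewrite xb (lt_le_trans (e0 n)).
  - move=> n x /=; rewrite in_itv/= => /andP[ex xb]; rewrite lee_fin.
    by apply: f0; rewrite xb (lt_le_trans (e0 n)).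
have cvF : (\int[mu]_(x in `[e n, b]) (f x)%:E)%E @[n --> \oo] --> (F b - l)%:E.
  have cvFe : F b - F (e n) @[n --> \oo] --> F b - l.
    apply: cvgB; first exact: cvg_cst.
    by move/cvg_at_rightP : Fl => /(_ e); apply.
  have eqI n : (\int[mu]_(x in `[e n, b]) (f x)%:E)%E = (F b - F (e n))%:E.
    by apply: FTC_is_derive => // x /andP[ex xb]; [apply: dF|apply: cf];
      rewrite xb (lt_le_trans (e0 n)).
  rewrite (funext eqI).
  apply: (@cvg_comp _ _ _ _ EFin _ _ _ cvFe) => //.
exact: (cvg_unique _ cvI cvF).
Qed.

(** Writing - ln x = 2 ln (1 / sqrt x) and using ln y <= y gives |x ln x| <= 2 sqrt x for x <= 1. *)
Lemma xlnx_cvg0 : x * ln x @[x --> 0^'+] --> (0 : R).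
Proof.
have bnd (x : R) : 0 < x <= 1 -> `|x * ln x| <= 2 * Num.sqrt x.
  move=> /andP[x0 x1]; rewrite normrM gtr0_norm// ler0_norm; last exact: ln_le0.
  have s0 : 0 < Num.sqrt x by rewrite sqrtr_gt0.
  have -> : - ln x = ln (Num.sqrt x)^-1 *+ 2.
    by rewrite lnV ?posrE// mulNrn -lnXn// sqr_sqrtr// ltW.
  rewrite -[leLHS]/(x * _) mulrnAr -mulr_natl ler_pM2l//.
  have h : ln (Num.sqrt x)^-1 <= (Num.sqrt x)^-1 by rewrite ltW// ln_sublinear ?invr_gt0.
  apply: (@le_trans _ _ (x * (Num.sqrt x)^-1)); first by rewrite ler_wpM2l// ltW.
  by rewrite -{1}(sqr_sqrtr (ltW x0)) expr2 mulfK ?gt_eqF.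
apply/cvgrPdist_le => e e0; near=> x; rewrite sub0r normrN.
have x0 : 0 < x by near: x; exact: nbhs_right_gt.
apply: (le_trans (bnd x _)).
  by rewrite x0/=; near: x; apply: nbhs_right_le.
have /ler_wsqrtr : x <= (e / 2) ^+ 2.
  by near: x; apply: nbhs_right_le; rewrite exprn_gt0// divr_gt0.
by rewrite sqrtr_sqr ger0_norm ?divr_ge0 ?(ltW e0)// ler_pdivlMr// mulrC.
Unshelve. all: by end_near. Qed.

End calculus.

(** * Integrability of log|sin| *)

Section log_sine.
Variable R : realType.
Local Notation mu := (@lebesgue_measure R).
Local Notation U := (circle R).

(** A weak form of Jordan's inequality. If cos t >= 1/4, then sin x - x/4 increases on [0, t];
    otherwise sin^2 t > 15/16, while t/4 < 1/2 since pi/2 < 2. *)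
Lemma sin_ge_quarter (t : R) : 0 <= t <= pi / 2 -> t / 4 <= sin t.
Proof.
move=> /andP[t0 t2]; have p2 := pihalf_lt2 R.
have [c4|c4] := leP (4^-1) (cos t).
  rewrite -subr_ge0.
  have -> : 0 = sin 0 - 0 / 4 :> R by rewrite sin0 mul0r subr0.
  have dF (x : R) : is_derive x 1 (fun x => sin x - x / 4) (cos x - 4^-1).
    apply: der_eq (derB (is_derive_sin x) (derM (der_id x) (der_cst _ x))) _.
    by rewrite mulr0 addr0 mul1r.
  apply: (is_derive_ge0_le t0 (fun x _ => dF x)) => [x _|x /andP[x0 xt]].
  - exact: is_derive_continuous (dF x).
  - rewrite subr_ge0 (le_trans c4)// ltW// ltr_cos ?in_itv/= ?(ltW x0)//=; lra.
have s0 : 0 <= sin t by apply: sin_ge0_pi; rewrite t0/=; lra.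
have c0 : 0 <= cos t by apply: cos_ge0_pihalf; rewrite t2 andbT; lra.
have := cos2Dsin2 t.
have [//|s4] := leP (t / 4) (sin t); nra.
Qed.

(** The value +oo at 0, in place of |ln 0| = 0, makes the domination bounds below hold at every
    point, and lets integrability alone show that sin is almost nowhere 0. *)
Definition abs_ln (x : R) : \bar R := if x == 0 then +oo%E else `|ln `|x| |%:E.

Lemma abs_ln_ge0 x : (0 <= abs_ln x)%E.
Proof. by rewrite /abs_ln; case: ifP => // _; rewrite lee_fin. Qed.

Lemma measurable_abs_ln : measurable_fun setT abs_ln.
Proof.
apply: measurable_fun_ifT => //=.
  by apply: measurable_fun_eqr => //.
apply/measurable_EFinP; apply: measurableT_comp => //.
by apply: measurableT_comp; [exact: measurable_ln|exact: normr_measurable].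
Qed.

Lemma abs_ln_sinE (x : R) : sin x != 0 -> abs_ln (sin x) = (- ln `|sin x|)%:E.
Proof.
move=> s0; rewrite /abs_ln (negbTE s0) ler0_norm// ln_le0//.
exact: sin_max.
Qed.

Lemma measurable_sin : measurable_fun setT (@sin R).
Proof. by apply: continuous_measurable_fun; exact: continuous_sin. Qed.

Lemma measurable_cos : measurable_fun setT (@cos R).
Proof. by apply: continuous_measurable_fun; exact: continuous_cos. Qed.

Lemma measurable_abs_ln_sin : measurable_fun setT (fun x => abs_ln (sin x)).
Proof. exact: (measurableT_comp measurable_abs_ln measurable_sin). Qed.

Lemma abs_ln_sin_lty : (\int[U]_x abs_ln (sin x) < +oo)%E.
Proof.
have abs_lnN x : abs_ln `|x| = abs_ln x.
  by rewrite /abs_ln normr_eq0 normr_id.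
under eq_integral do rewrite -abs_lnN.
rewrite ge0_circle_abs_sin//; [|exact: measurable_abs_ln|exact: abs_ln_ge0].
have p0 := pi_gt0 R; have p4 := pihalf_lt2 R.
apply: lte_mul_pinfty => //; first by rewrite lee_fin divr_ge0// ltW.
(* A primitive of - ln (x / 4), which dominates - ln (sin x) because sin x >= x / 4. *)
have dF (x : R) : 0 < x -> is_derive x 1
    (fun x => x * (ln 4 + 1) - x * ln x) (ln 4 - ln x).
  move=> x0.
  apply: der_eq (derB (derM (der_id x) (der_cst _ x))
    (derM (der_id x) (is_derive1_ln x0))) _.
  by rewrite mulr0 mulfV ?gt_eqF//; ring.
apply: (@le_lt_trans _ _ (\int[mu]_(x in `]0%R, (pi / 2)%R]) (ln 4 - ln x)%:E)%E).
  apply: ge0_le_integral => //.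
  - by move=> x _; exact: abs_ln_ge0.
  - exact: measurable_funTS measurable_abs_ln_sin.
  - apply/measurable_EFinP; apply: measurable_funB => //.
    exact: measurable_funTS (@measurable_ln R).
  - move=> x /=; rewrite in_itv/= => /andP[x0 x2].
    have h : x / 4 <= sin x by apply: sin_ge_quarter; rewrite (ltW x0).
    have s0 : 0 < sin x by rewrite (lt_le_trans _ h)// divr_gt0.
    rewrite abs_ln_sinE ?gt_eqF// gtr0_norm// lee_fin.
    rewrite -ln_div ?posrE// -lnV ?posrE// ler_ln ?posrE ?invr_gt0 ?divr_gt0//.
    by rewrite -[leRHS]invf_div lef_pV2 ?posrE// divr_gt0.
suff -> : (\int[mu]_(x in `]0%R, (pi / 2)%R]) (ln 4 - ln x)%:E =
    (pi / 2 * (ln 4 + 1) - pi / 2 * ln (pi / 2) - 0)%:E)%E by rewrite ltry.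
apply: (@ge0_FTC_right0 R (fun x => x * (ln 4 + 1) - x * ln x) (fun x => ln 4 - ln x)
  (pi / 2) 0) => [||||].
- by rewrite divr_gt0.
- by move=> x /andP[x0 _]; exact: dF.
- move=> x /andP[x0 _]; apply: cvgB; first exact: cvg_cst.
  exact: continuous_ln.
- move=> x /andP[x0 x2]; rewrite subr_ge0 ler_ln ?posrE//; lra.
- rewrite -[X in _ --> X](subr0 0); apply: cvgB; last exact: xlnx_cvg0.
  rewrite -[X in _ --> X](mul0r (ln 4 + 1)).
  apply: cvgMl; apply: cvg_at_right_filter; exact: cvg_id.
Qed.

Lemma integrable_abs_ln_sin (c : R) :
  U.-integrable setT (fun x => abs_ln (sin (x + c))).
Proof.
apply/integrableP; split.
  apply: (measurableT_comp measurable_abs_ln_sin); exact: measurable_funD.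
under eq_integral do rewrite gee0_abs ?abs_ln_ge0//.
rewrite (@ge0_circle_shift _ (fun x => abs_ln (sin x)) c).
- exact: abs_ln_sin_lty.
- exact: measurable_abs_ln_sin.
- by move=> x; exact: abs_ln_ge0.
- by move=> x; rewrite sinD2pi.
Qed.

(** An integrable function is almost everywhere finite, and [abs_ln] is infinite at 0. *)
Lemma ae_sin_neq0 (c : R) : {ae U, forall x, sin (x + c) != 0}.
Proof.
have := integrable_ae measurableT (integrable_abs_ln_sin c).
apply: filterS => x /(_ I); apply: contraTneq => ->.
by rewrite /abs_ln eqxx.
Qed.

Lemma circle_ae_eq (f g : R -> \bar R) (c : R) :
  measurable_fun setT f -> measurable_fun setT g ->
  (forall x, sin (x + c) != 0 -> f x = g x) ->
  (\int[U]_x f x = \int[U]_x g x)%E.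
Proof.
move=> mf mg fg; apply: ae_eq_integral => //.
have [N [mN N0 sN]] := ae_sin_neq0 c; exists N; split => // x nfg.
by apply: sN => sx; apply: nfg => _; exact: fg.
Qed.

End log_sine.

(** * Jensen's formula *)

Local Open Scope complex_scope.
Import Normc.
Local Notation Re := (@complex.Re _).
Local Notation Im := (@complex.Im _).

Section cis.
Variable R : realType.
Implicit Types (s t r : R) (z : R[i]).

Lemma normcE2 z : normc z ^+ 2 = Re z ^+ 2 + Im z ^+ 2.
Proof. by case: z => a b; rewrite /= sqr_sqrtr// addr_ge0// sqr_ge0. Qed.

Lemma normc_ge0 z : 0 <= normc z.
Proof. by case: z => a b; rewrite sqrtr_ge0. Qed.

Lemma normc_gt0 z : (0 < normc z) = (z != 0).
Proof.
rewrite lt_def normc_ge0 andbT; congr (~~ _).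
by apply/eqP/eqP => [/eq0_normc//|->]; rewrite normc0.
Qed.

Lemma normc_real r : 0 <= r -> normc r%:C = r.
Proof. by move=> r0; rewrite /= expr0n addr0 sqrtr_sqr ger0_norm. Qed.

Lemma normcX z n : normc (z ^+ n) = normc z ^+ n.
Proof. by elim: n => [|n IH]; rewrite ?expr0 ?normc1// !exprS normcM IH. Qed.

Lemma ler_normc_sub z1 z2 : normc z1 - normc z2 <= normc (z1 + z2).
Proof.
rewrite lerBlDr -{1}(addrK z2 z1) (le_trans (le_normcD _ _))//.
by rewrite normcN.
Qed.

Lemma norm_Im_le z : `|Im z| <= normc z.
Proof.
rewrite -ler_sqr ?nnegrE ?normc_ge0// real_normK ?num_real//.
by rewrite normcE2 lerDr sqr_ge0.
Qed.

Lemma cis_norm t : normc (cis t) = 1.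
Proof. by rewrite /= cos2Dsin2 sqrtr1. Qed.

Lemma cis_neq0 t : cis t != 0.
Proof. by rewrite -normc_gt0 cis_norm. Qed.

Lemma cisD s t : cis (s + t) = cis s * cis t.
Proof. by rewrite /cis cosD sinD; simpc; congr (_ +i* _); ring. Qed.

Lemma cis0 : cis (0 : R) = 1.
Proof. by rewrite /cis cos0 sin0. Qed.

Lemma cisN t : cis (- t) = (cis t)^-1.
Proof.
by apply: (mulfI (cis_neq0 t)); rewrite -cisD subrr cis0 mulfV ?cis_neq0.
Qed.

Lemma cis_pi : cis (pi : R) = -1.
Proof. by rewrite /cis cospi sinpi; apply/eqP; rewrite eq_complex /= oppr0 !eqxx. Qed.

Lemma cis_periodic : periodic2pi (@cis R).
Proof. by move=> t; rewrite /cis cosD2pi sinD2pi. Qed.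

Lemma polar z : exists t, z = (normc z)%:C * cis t.
Proof.
have [->|z0] := eqVneq z 0; first by exists 0; rewrite normc0 mul0r.
have n0 : 0 < normc z by rewrite normc_gt0.
have nE := normcE2 z.
have cI : -1 <= Re z / normc z <= 1.
  rewrite -ler_norml normrM normfV (gtr0_norm n0) ler_pdivrMr// mul1r.
  rewrite -ler_sqr ?nnegrE ?normc_ge0// real_normK ?num_real//.
  by rewrite nE lerDl sqr_ge0.
have cK : cos (acos (Re z / normc z)) = Re z / normc z by rewrite acosK// in_itv.
have sK : sin (acos (Re z / normc z)) = `|Im z| / normc z.
  rewrite sin_acos//.
  have -> : 1 - (Re z / normc z) ^+ 2 = (Im z / normc z) ^+ 2.
    rewrite !expr_div_n nE; field.
    by rewrite -nE expf_neq0// gt_eqF.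
  by rewrite sqrtr_sqr normrM normfV (gtr0_norm n0).
have zE : z = (normc z)%:C * ((Re z / normc z) +i* (Im z / normc z)).
  case: z z0 n0 {nE cI cK sK} => a b z0 n0 /=.
  rewrite -/(normc (a +i* b)); simpc.
  by rewrite mulrCA mulfV ?gt_eqF// mulr1 mulrCA mulfV ?gt_eqF// mulr1.
have [i0|i0] := leP 0 (Im z).
  exists (acos (Re z / normc z)); rewrite {1}zE /cis cK sK.
  by rewrite ger0_norm.
exists (- acos (Re z / normc z)); rewrite {1}zE /cis cosN sinN cK sK.
by rewrite ltr0_norm// mulNr opprK.
Qed.

End cis.

Section measurable_complex.
Context d (T : measurableType d) (R : realType).
Implicit Types f g : T -> R[i].

Definition cmeasurable f :=
  measurable_fun setT (fun x => Re (f x)) /\ measurable_fun setT (fun x => Im (f x)).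

Lemma cmeasurable_cst (c : R[i]) : cmeasurable (fun=> c).
Proof. by split; exact: measurable_cst. Qed.

Lemma cmeasurableD f g : cmeasurable f -> cmeasurable g ->
  cmeasurable (fun x => f x + g x).
Proof.
move=> [fr fi] [gr gi]; split.
- rewrite (_ : (fun x => _) = (fun x => Re (f x) + Re (g x))).
    exact: measurable_funD.
  by apply/funext => x; case: (f x) (g x) => ? ? [].
- rewrite (_ : (fun x => _) = (fun x => Im (f x) + Im (g x))).
    exact: measurable_funD.
  by apply/funext => x; case: (f x) (g x) => ? ? [].
Qed.

Lemma cmeasurableM f g : cmeasurable f -> cmeasurable g ->
  cmeasurable (fun x => f x * g x).
Proof.
move=> [fr fi] [gr gi]; split.
- rewrite (_ : (fun x => _) = (fun x => Re (f x) * Re (g x) - Im (f x) * Im (g x))).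
    by apply: measurable_funB; exact: measurable_funM.
  by apply/funext => x; case: (f x) (g x) => ? ? [].
- rewrite (_ : (fun x => _) = (fun x => Re (f x) * Im (g x) + Im (f x) * Re (g x))).
    by apply: measurable_funD; exact: measurable_funM.
  by apply/funext => x; case: (f x) (g x) => ? ? [].
Qed.

Lemma cmeasurableB f g : cmeasurable f -> cmeasurable g ->
  cmeasurable (fun x => f x - g x).
Proof.
move=> mf mg; under [X in cmeasurable X]eq_fun do rewrite -mulN1r.
by apply: cmeasurableD => //; apply: cmeasurableM => //; exact: cmeasurable_cst.
Qed.

Lemma cmeasurableX f n : cmeasurable f -> cmeasurable (fun x => f x ^+ n).
Proof.
move=> mf; elim: n => [|n IH].
  by under [X in cmeasurable X]eq_fun do rewrite expr0; exact: cmeasurable_cst.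
by under [X in cmeasurable X]eq_fun do rewrite exprS; exact: cmeasurableM.
Qed.

Lemma cmeasurable_cis (f : T -> R) : measurable_fun setT f ->
  cmeasurable (fun x => cis (f x)).
Proof.
move=> mf; split; apply: measurableT_comp => //.
  exact: measurable_cos.
exact: measurable_sin.
Qed.

Lemma measurable_normc f : cmeasurable f -> measurable_fun setT (fun x => normc (f x)).
Proof.
move=> [fr fi].
rewrite (_ : (fun x => _) = (fun x => Num.sqrt (Re (f x) ^+ 2 + Im (f x) ^+ 2))).
  apply: (@measurableT_comp _ _ _ _ _ _ (@Num.sqrt R)).
    by apply: continuous_measurable_fun; exact: sqrt_continuous.
  by apply: measurable_funD; exact: measurable_funX.
by apply/funext => x; case: (f x).
Qed.

Lemma measurable_ln_normc f : cmeasurable f ->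
  measurable_fun setT (fun x => ln (normc (f x))).
Proof.
by move=> mf; apply: measurableT_comp; [exact: measurable_ln|exact: measurable_normc].
Qed.

End measurable_complex.

Section jensen.
Variable R : realType.
Local Notation U := (circle R).

Let J (r s : R) := ln (normc (cis s - r%:C)).
Let L (r : R) := (\int[U]_s J r s)%R.

Let mJ r : measurable_fun setT (J r).
Proof.
apply: measurable_ln_normc; apply: cmeasurableB; last exact: cmeasurable_cst.
exact: cmeasurable_cis.
Qed.

Let sin_le (r s : R) : `|sin s| <= normc (cis s - r%:C).
Proof.
by apply: le_trans (norm_Im_le _); rewrite /= subr0.
Qed.

Let le_1r (r s : R) : 0 <= r -> normc (cis s - r%:C) <= 1 + r.
Proof.
move=> r0; apply: (le_trans (le_normcD _ _)).
by rewrite cis_norm normcN normc_real.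
Qed.

(** The imaginary part of [cis s - r] is sin s whatever the real r, so a single integrable function
    dominates, up to a constant, all these logarithms. *)
Let J_bound (r s : R) : 0 <= r -> (`|(J r s)%:E| <= abs_ln (sin s) + (ln (1 + r))%:E)%E.
Proof.
move=> r0.
have [s0|s0] := eqVneq (sin s) 0; first by rewrite /abs_ln s0 eqxx/= leey.
rewrite abs_ln_sinE// -EFinD abse_EFin lee_fin ler_norml /J.
have sp : 0 < `|sin s| by rewrite normr_gt0.
have np : 0 < normc (cis s - r%:C) by exact: lt_le_trans (sin_le r s).
have l0 : ln `|sin s| <= 0 by apply: ln_le0; exact: sin_max.
have l1 : 0 <= ln (1 + r) by apply: ln_ge0; rewrite lerDl.
have h1 : ln `|sin s| <= J r s by rewrite ler_ln ?posrE.
have h2 : J r s <= ln (1 + r) by rewrite ler_ln ?posrE ?le_1r// ltr_wpDr.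
rewrite -/(J r s); apply/andP; split; lra.
Qed.

Let integrable_bound (c : R) :
  U.-integrable setT (fun s => abs_ln (sin s) + c%:E)%E.
Proof.
apply: integrableD => //.
  by have := integrable_abs_ln_sin (0:R); under eq_fun do rewrite addr0.
exact: finite_measure_integrable_cst.
Qed.

Let iJ (r : R) : 0 <= r -> U.-integrable setT (EFin \o J r).
Proof.
move=> r0; apply: le_integrable (integrable_bound (ln (1 + r))) => //.
  by apply/measurable_EFinP; exact: mJ.
move=> s _ /=; rewrite [leRHS]gee0_abs ?J_bound//.
exact: le_trans (abse_ge0 _) (J_bound s r0).
Qed.

Let J_periodic r : periodic2pi (J r).
Proof. by move=> s; rewrite /J cis_periodic. Qed.

(** On the circle (z - r)(-z - r) = -(z^2 - r^2), and the mean is invariant under z -> -z and under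
    z -> z^2. *)
Let L_double (r : R) : 0 <= r -> 2 * L r = L (r ^+ 2).
Proof.
move=> r0; have r20 : 0 <= r ^+ 2 by exact: sqr_ge0.
have shE : \int[U]_s J r (s + pi) = L r.
  by congr fine; exact: circle_shift.
have dbE : \int[U]_s J (r ^+ 2) (2 * s) = L (r ^+ 2).
  by congr fine; exact: circle_double.
have iJs : U.-integrable setT (EFin \o (fun s => J r (s + pi))).
  apply: le_integrable (integrable_bound (ln (1 + r))) => //.
    by apply/measurable_EFinP; apply: (measurableT_comp (mJ r)); exact: measurable_funD.
  move=> s _ /=.
  have := J_bound (s + pi) r0; rewrite sinDpi /abs_ln oppr_eq0 normrN -/(abs_ln _) => h.
  by rewrite [leRHS]gee0_abs// (le_trans _ h).
have -> : 2 * L r = L r + \int[U]_s J r (s + pi) by rewrite shE; ring.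
transitivity (\int[U]_s (J r s + J r (s + pi))).
  by rewrite (RintegralD measurableT (iJ r0) iJs).
rewrite -[RHS]dbE.
congr fine; apply: (@circle_ae_eq _ _ _ 0).
- apply/measurable_EFinP; apply: measurable_funD; first exact: mJ.
  by apply: (measurableT_comp (mJ r)); exact: measurable_funD.
- apply/measurable_EFinP; apply: (measurableT_comp (mJ (r ^+ 2))).
  exact: mulrl_measurable.
move=> s; rewrite addr0 => s0.
have pos t : sin t != 0 -> 0 < normc (cis t - r%:C).
  by move=> t0; rewrite (lt_le_trans _ (sin_le r t))// normr_gt0.
congr EFin; rewrite /J -lnM ?posrE ?pos ?sinDpi ?oppr_eq0// -normcM.
rewrite cisD cis_pi.
have -> : cis (2 * s) = cis s * cis s by rewrite -cisD; congr cis; ring.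
rewrite (rmorphXn (real_complex R)).
have -> : (cis s - r%:C) * (cis s * -1 - r%:C) = - (cis s * cis s - r%:C ^+ 2) by ring.
by rewrite normcN.
Qed.

Let L_bound : exists2 M : R, 0 <= M & forall r, 0 <= r <= 1 -> `|L r| <= M.
Proof.
exists (fine (\int[U]_s (abs_ln (sin s) + (ln 2)%:E))%E).
  rewrite fine_ge0// integral_ge0// => s _.
  by rewrite adde_ge0 ?abs_ln_ge0// lee_fin ln_ge0// ler1n.
move=> r /andP[r0 r1].
apply: (le_trans (le_normr_Rintegral measurableT (iJ r0))).
rewrite /Rintegral fine_le//.
- apply: integrable_fin_num => //; rewrite -[X in _.-integrable _ X]/(abse \o (EFin \o J r)).
  exact/integrable_abse/iJ.
- exact: integrable_fin_num.
apply: ge0_le_integral => //.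
- by do 2 apply: measurableT_comp => //; exact: mJ.
- exact: measurable_int (integrable_bound (ln 2)).
move=> s _; apply: (le_trans (J_bound s r0)).
by rewrite leeD2l// lee_fin ler_ln ?posrE//; [lra|rewrite (lt_le_trans ltr01)// lerDl].
Qed.

(** Iterating the doubling relation keeps r in [0, 1], so 2^n |L r| stays below one bound for all n.
    The boundary case r = 1 needs no separate argument. *)
Let L_eq0 r : 0 <= r <= 1 -> L r = 0.
Proof.
move=> r01; have [M M0 LM] := L_bound.
have Ln n : forall r, 0 <= r <= 1 -> 2 ^+ n * `|L r| <= M.
  elim: n => [|n IH] r' /andP[r0 r1]; first by rewrite mul1r LM ?r0.
  have <- : 2 ^+ n * `|L (r' ^+ 2)| = 2 ^+ n.+1 * `|L r'|.
    by rewrite -L_double// normrM ger0_norm// mulrA -exprSr.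
  by apply: IH; rewrite sqr_ge0 expr_le1.
apply/eqP; apply: contraT; rewrite -normr_gt0 => Lp.
have := archi_boundP (divr_ge0 M0 (ltW Lp)); set n := Num.bound _.
rewrite ltr_pdivrMr// => Mn; suff : M < M by rewrite ltxx.
apply: (lt_le_trans Mn); apply: le_trans (Ln n r r01); rewrite ler_wpM2r ?(ltW Lp)//.
by rewrite -natrX ler_nat ltnW// ltn_expl.
Qed.

Let L_ge1 r : 1 <= r -> L r = ln r.
Proof.
move=> r1; have r0 : 0 < r by exact: lt_le_trans r1.
have rV : 0 <= r^-1 <= 1 by rewrite invr_ge0 ltW//= invf_le1.
have rV0 : 0 <= r^-1 by case/andP: rV.
have -> : L r = \int[U]_s (ln r + J r^-1 s).
  congr fine; apply: (@circle_ae_eq _ _ _ 0).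
  - by apply/measurable_EFinP; exact: mJ.
  - by apply/measurable_EFinP; apply: measurable_funD => //; exact: mJ.
  - move=> s; rewrite addr0 => s0.
  have pos t : 0 < normc (cis s - t%:C).
    by rewrite (lt_le_trans _ (sin_le t s))// normr_gt0.
  congr EFin; rewrite /J -lnM ?posrE//; congr ln.
  (* |e^{is} - r| = r |e^{-is} - 1/r| = r |e^{is} - 1/r| *)
  rewrite -{2}(normc_real (ltW r0)) -normcM.
  have -> : r%:C * (cis s - r^-1%:C) = r%:C * cis s - 1.
    by rewrite mulrBr -(rmorphM (real_complex R)) mulfV ?gt_eqF.
  apply/eqP; rewrite -(@eqrXn2 _ 2)// ?normc_ge0// !normcE2 /=.
  have : (1 - r ^+ 2) * (cos s ^+ 2 + sin s ^+ 2 - 1) = 0.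
    by rewrite cos2Dsin2 subrr mulr0.
  by move=> h; apply/eqP; move: h; move: (cos s) (sin s) => c t; lra.
rewrite RintegralD//; [|exact: finite_measure_integrable_cst|exact: iJ].
rewrite -[X in _ + X]/(L _) L_eq0// addr0 Rintegral_cst//.
rewrite [X in _ * fine X](_ : _ = 1%E) ?mulr1//; exact: probability_setT.
Qed.

Lemma jensen_real (r : R) : 0 <= r ->
  \int[U]_s ln (normc (cis s - r%:C)) = ln (Num.max 1 r).
Proof.
move=> r0; have [r1|r1] := leP r 1.
  by rewrite ln1; apply: L_eq0; rewrite r0.
by apply: L_ge1; exact: ltW.
Qed.

Lemma ln_cis_sub_bound (r s : R) : 0 <= r ->
  (`|(ln (normc (cis s - r%:C)))%:E| <= abs_ln (sin s) + (ln (1 + r))%:E)%E.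
Proof. exact: J_bound. Qed.

End jensen.

Section jensen_complex.
Variable R : realType.
Local Notation U := (circle R).
Implicit Types a : R[i].

Lemma cis_sub_polar a : exists t : R, forall s,
  normc (cis s - a) = normc (cis (s + t) - (normc a)%:C).
Proof.
have [t aE] := polar a; exists (- t) => s.
rewrite cisD -[RHS]mul1r -(cis_norm t) -normcM mulrBr mulrCA -cisD subrr cis0.
by rewrite mulr1 mulrC -aE.
Qed.

Lemma jensen_linear a :
  [/\ U.-integrable setT (EFin \o (fun s => ln (normc (cis s - a)))),
      \int[U]_s ln (normc (cis s - a)) = ln (Num.max 1 (normc a)) &
      {ae U, forall s, cis s != a}].
Proof.
have [t aE] := cis_sub_polar a.
pose f s := ln (normc (cis s - (normc a)%:C)).
have mf : measurable_fun setT f.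
  by apply: measurable_ln_normc; apply: cmeasurableB;
    [exact: cmeasurable_cis|exact: cmeasurable_cst].
split.
- have ib : U.-integrable setT
      (fun s => abs_ln (sin (s + t)) + (ln (1 + normc a))%:E)%E.
    apply: integrableD => //; first exact: integrable_abs_ln_sin.
    exact: finite_measure_integrable_cst.
  apply: le_integrable ib => //.
  + apply/measurable_EFinP; apply: measurable_ln_normc; apply: cmeasurableB;
      [exact: cmeasurable_cis|exact: cmeasurable_cst].
  + move=> s _ /=; rewrite aE [leRHS]gee0_abs.
      exact: ln_cis_sub_bound (normc_ge0 a).
    by rewrite adde_ge0 ?abs_ln_ge0// lee_fin ln_ge0// lerDl normc_ge0.
- rewrite -jensen_real ?normc_ge0//.
  under eq_Rintegral do rewrite aE.
  congr fine; apply: (@circle_shift _ f t) => //.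
  by move=> s; rewrite /f cis_periodic.
- have [N [mN N0 sN]] := ae_sin_neq0 t; exists N; split => // s sa.
  apply: sN => st; apply: sa.
  apply/eqP => ca; move: (aE s); rewrite ca subrr normc0 => /esym/eq0_normc.
  by move=> /(congr1 Im)/= /eqP; rewrite subr0; exact/negP.
Qed.

(** The third clause is carried through the induction because [ln] of a product splits only where
    both factors are nonzero. *)
Lemma jensen_prod (rs : seq R[i]) :
  [/\ U.-integrable setT (EFin \o (fun s => ln (normc (\prod_(a <- rs) (cis s - a))))),
      \int[U]_s ln (normc (\prod_(a <- rs) (cis s - a))) =
        \sum_(a <- rs) ln (Num.max 1 (normc a)) &
      {ae U, forall s, \prod_(a <- rs) (cis s - a) != 0}].
Proof.
elim: rs => [|a rs [iI IE ane0]].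
  split.
  - under [X in EFin \o X]eq_fun do rewrite big_nil normc1 ln1.
    exact: finite_measure_integrable_cst.
  - rewrite big_nil; under eq_Rintegral do rewrite big_nil normc1 ln1.
    by rewrite Rintegral_cst// mul0r.
  - by exists set0; split => // s /= [] ; rewrite big_nil oner_neq0.
have [iA AE ae0] := jensen_linear a.
have ae1 : {ae U, forall s, \prod_(b <- a :: rs) (cis s - b) != 0}.
  case: ae0 => [N [mN N0 sN]]; case: ane0 => [M [mM M0 sM]].
  exists (N `|` M); split.
  - exact: measurableU.
  - by apply/eqP; rewrite eq_le measure_ge0 andbT -(adde0 0%E) -{1}N0 -M0 measureU2.
  - move=> s /=; rewrite big_cons => h.
    apply: contrapT => /not_orP[sN' sM']; apply: h.
    have sa : cis s != a by apply: contrapT => h; exact/sN'/sN.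
    have sr : \prod_(b <- rs) (cis s - b) != 0 by apply: contrapT => h; exact/sM'/sM.
    by rewrite mulf_neq0// subr_eq0.
have mP (l : seq R[i]) : measurable_fun setT
    (EFin \o (fun s : R => ln (normc (\prod_(b <- l) (cis s - b))))).
  apply/measurable_EFinP; apply: measurable_ln_normc.
  elim: l => [|b l IH].
    by under [X in cmeasurable X]eq_fun do rewrite big_nil; exact: cmeasurable_cst.
  under [X in cmeasurable X]eq_fun do rewrite big_cons.
  apply: cmeasurableM => //; apply: cmeasurableB;
    [exact: cmeasurable_cis|exact: cmeasurable_cst].
have eqA : {ae U, forall s, ln (normc (\prod_(b <- a :: rs) (cis s - b))) =
    ln (normc (cis s - a)) + ln (normc (\prod_(b <- rs) (cis s - b)))}.
  case: ae1 => [N [mN N0 sN]]; exists N; split => // s h; apply: sN => s0; apply: h.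
  move: s0; rewrite /= !big_cons mulf_eq0 negb_or => /andP[? ?].
  by rewrite normcM lnM ?posrE ?normc_gt0.
have iS : U.-integrable setT (EFin \o (fun s =>
    ln (normc (cis s - a)) + ln (normc (\prod_(b <- rs) (cis s - b))))).
  by have := integrableD measurableT iA iI; apply: eq_integrable => // s _; rewrite /= -EFinD.
have mS := measurable_int _ iS.
split => //.
- apply/integrableP; split; first exact: mP.
  suff -> : (\int[U]_s `|(ln (normc (\prod_(b <- a :: rs) (cis s - b))))%:E| =
      \int[U]_s `|(ln (normc (cis s - a)) +
        ln (normc (\prod_(b <- rs) (cis s - b))))%:E|)%E.
    by case/integrableP : iS.
  apply: ae_eq_integral => //.
  + by apply: measurableT_comp => //; exact: mP.
  + exact: measurableT_comp.
  + case: eqA => [N [mN N0 sN]]; exists N; split => // s h; apply: sN => s0.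
    by apply: h => _ /=; rewrite s0.
- rewrite big_cons -AE -IE -RintegralD//; congr fine; apply: ae_eq_integral => //.
  + exact: mP.
  + case: eqA => [N [mN N0 sN]]; exists N; split => // s h; apply: sN => s0.
    by apply: h => _ /=; rewrite s0.
Qed.

(** Each root a contributes log max(1, |a|) >= 0, and the leading coefficient contributes
    nothing. *)
Lemma jensen_poly_ge0 (p : {poly R[i]}) : normc (lead_coef p) = 1 ->
  U.-integrable setT (EFin \o (fun s => ln (normc p.[cis s]))) /\
  0 <= \int[U]_s ln (normc p.[cis s]).
Proof.
move=> lp; have [rs pE] := closed_field_poly_normal p.
have pP s : normc p.[cis s] = normc (\prod_(a <- rs) (cis s - a)).
  rewrite pE hornerZ normcM lp mul1r horner_prod; congr normc.
  by apply: eq_bigr => a _; rewrite !hornerE.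
have [iP PE _] := jensen_prod rs; split.
  by apply: eq_integrable iP => // s _; rewrite /= pP.
under eq_Rintegral do rewrite pP.
rewrite PE sumr_ge0// => a _.
by rewrite ln_ge0// le_max lexx.
Qed.

End jensen_complex.

(** * The linear recurrence on the torus *)

Section linear_recurrence.
Variables (F : fieldType).

(** Indexed from 1, as [xseq] is. *)
Definition yseq (K u v : F) (n : nat) : F :=
  (iter n.-1 (fun p => (p.2, K * p.2 - p.1)) (u, v)).1.

Lemma yseq_pair (K u v : F) n :
  iter n (fun p => (p.2, K * p.2 - p.1)) (u, v) = (yseq K u v n.+1, yseq K u v n.+2).
Proof. by rewrite /yseq/=; case: (iter _ _ _). Qed.

Lemma yseq1 (K u v : F) : yseq K u v 1 = u. Proof. by []. Qed.
Lemma yseq2 (K u v : F) : yseq K u v 2 = v. Proof. by []. Qed.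
Lemma yseqSS (K u v : F) n :
  yseq K u v n.+3 = K * yseq K u v n.+2 - yseq K u v n.+1.
Proof. by rewrite {1}/yseq -[n.+3.-1]/(n.+2) iterS yseq_pair. Qed.

(** Binet's formula, multiplied by l - 1/l so that it remains valid when the two roots l and 1/l
    coincide. *)
Lemma yseq_closed (K u v l : F) n : l != 0 -> l + l^-1 = K ->
  (l - l^-1) * yseq K u v n.+2 =
  l ^+ n * (v * l - u) - l ^- n * (v / l - u).
Proof.
move=> l0 lK.
suff [] : (l - l^-1) * yseq K u v n.+2 =
     l ^+ n * (v * l - u) - l ^- n * (v / l - u) /\
  (l - l^-1) * yseq K u v n.+3 =
     l ^+ n.+1 * (v * l - u) - l ^- n.+1 * (v / l - u) by [].
elim: n => [|n [IH1 IH2]].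
  rewrite yseqSS yseq2 yseq1 -lK !expr1 !expr0 invr1; split; first by ring.
  by field.
split => //; rewrite yseqSS mulrBr mulrCA IH1 IH2 -lK !exprS.
by field; rewrite l0 expf_neq0.
Qed.

End linear_recurrence.

Lemma bernoulli_ge (R : realFieldType) (x : R) n : 0 <= x -> 1 + n%:R * x <= (1 + x) ^+ n.
Proof.
move=> x0; elim: n => [|n IH]; first by rewrite mul0r addr0 expr0.
rewrite exprS -natr1.
have : 0 <= n%:R :> R by [].
move: (n%:R : R) ((1 + x) ^+ n) IH => m y IH m0; nra.
Qed.

(** * Growth of the solutions in terms of the root l *)

Section growth.
Variable R : realType.
Implicit Types u v l K : R[i].

(** The integrand of [Cstar] as a function of K alone: log|l| for the root l of l + 1/l = K with |l|
    >= 1. *)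
Definition Gfun K : R := `| ln (normc ((K + sqrtC (K ^+ 2 - 4)) / 2)) |.

Lemma Gfun_root K : exists l, [/\ l != 0, l + l^-1 = K, 1 <= normc l & Gfun K = ln (normc l)].
Proof.
rewrite /Gfun; set q := sqrtC (K ^+ 2 - 4).
have q2 : q ^+ 2 = K ^+ 2 - 4 by rewrite /q sqrtCK.
set l := (K + q) / 2; set m := (K - q) / 2.
have lm : l * m = 1.
  have -> : l * m = (K ^+ 2 - q ^+ 2) / 4 by rewrite /l /m; field.
  by rewrite q2; field.
have l0 : l != 0 by apply: contra_eqN lm => /eqP ->; rewrite mul0r eq_sym oner_neq0.
have mE : m = l^-1 by apply: (mulfI l0); rewrite lm mulfV.
have lK : l + l^-1 = K by rewrite -mE /l /m; field.
have n0 : 0 < normc l by rewrite normc_gt0.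
have [l1|l1] := leP 1 (normc l).
  by exists l; split => //; rewrite ger0_norm// ln_ge0.
exists l^-1; split; rewrite ?invr_eq0 ?invrK 1?addrC//.
  by rewrite normcV invf_ge1// ltW.
by rewrite normcV lnV ?posrE// ler0_norm// ln_le0// ltW.
Qed.

(** Because Im (l + 1/l) = Im l (1 - |l|^(-2)) and |Im l| <= |l|. A nonreal K thus keeps |l| away
    from 1, quantitatively. *)
Lemma Im_inv_le l : l != 0 -> 1 <= normc l ->
  `|Im (l + l^-1)| <= normc l - (normc l)^-1.
Proof.
move=> l0 l1; have n0 : 0 < normc l by exact: lt_le_trans l1.
have -> : Im (l + l^-1) = Im l * (1 - normc l ^- 2).
  case: l l0 l1 n0 => a b l0 l1 n0.
  rewrite -exprVn -normcV -normcX.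
  rewrite exprVn normcV normcX normcE2 /=; field.
  by rewrite -(normcE2 (a +i* b)) expf_neq0// gt_eqF.
have le1 : normc l ^- 2 <= 1 by rewrite -exprVn expr_le1// ?invr_ge0 ?invf_le1// ltW.
rewrite normrM [X in _ * X]ger0_norm ?subr_ge0//.
apply: (le_trans (ler_wpM2r _ (norm_Im_le l))); rewrite ?subr_ge0//.
by rewrite mulrBr mulr1 exprS expr1 invfM mulrA mulfV ?mul1r// gt_eqF.
Qed.

Section bounds.
Variables (u v l : R[i]) (n : nat).
Hypotheses (u1 : normc u = 1) (v1 : normc v = 1) (l0 : l != 0) (l1 : 1 <= normc l).
Hypothesis lK : l + l^-1 = Kfun u v.
Let y := yseq (Kfun u v) u v n.+2.
Let A := v * l - u.
Let B := v / l - u.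

Let u0 : u != 0. Proof. by rewrite -normc_gt0 u1. Qed.
Let v0 : v != 0. Proof. by rewrite -normc_gt0 v1. Qed.
Let n0 : 0 < normc l. Proof. exact: lt_le_trans l1. Qed.
Let lV1 : (normc l)^-1 <= 1. Proof. by rewrite invf_le1. Qed.

Lemma normc_root_le : normc l <= 4.
Proof.
have lE : l = Kfun u v - l^-1 by rewrite -lK addrK.
have K3 : normc (Kfun u v) <= 3.
  apply: (le_trans (le_normcD _ _)); apply: (le_trans (lerD (le_normcD _ _) (lexx _))).
  by rewrite !normcM !normcV normcM u1 v1 normc1 !(invr1, mulr1); lra.
rewrite {1}lE; apply: (le_trans (le_normcD _ _)).
by rewrite normcN normcV; move: K3 lV1; lra.
Qed.

(** The product is v^2 - u v K + u^2, to which the definition of K applies. Together with |B| <= 2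
    this gives |A| >= 1/2, so the growing term never disappears. *)
Let AB : A * B = -1.
Proof.
have -> : A * B = v ^+ 2 - u * v * (l + l^-1) + u ^+ 2 by rewrite /A /B; field.
by rewrite lK /Kfun; field; rewrite u0 v0.
Qed.

Let B2 : normc B <= 2.
Proof.
apply: (le_trans (le_normcD _ _)); rewrite normcN normcM normcV u1 v1 mul1r.
by move: lV1; lra.
Qed.

Let A5 : normc A <= 5.
Proof.
apply: (le_trans (le_normcD _ _)); rewrite normcN normcM u1 v1 mul1r.
by move: normc_root_le; lra.
Qed.

Let A2 : 2^-1 <= normc A.
Proof.
have h : normc A * normc B = 1 by rewrite -normcM AB normcN normc1.
by have := normc_ge0 A; have := B2; nra.
Qed.

Let yE : normc (l - l^-1) * normc y = normc (l ^+ n * A - l ^- n * B).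
Proof. by rewrite -normcM yseq_closed. Qed.

Let ln0 : 0 < normc l ^+ n. Proof. by rewrite exprn_gt0. Qed.
Let lnV : normc l ^- n <= normc l ^+ n.
Proof.
by rewrite (@le_trans _ _ 1)// ?invf_le1 ?exprn_ege1.
Qed.

Let ImK : `|Im (Kfun u v)| <= normc l - (normc l)^-1.
Proof. by rewrite -lK; exact: Im_inv_le. Qed.

(** |Im K| <= |l| - 1/|l| <= |l - 1/l|, so Binet's formula applies without division by l - 1/l,
    which may be arbitrarily small; 7 = 5 + 2 bounds |A| + |B|. *)
Lemma yseq_upper : `|Im (Kfun u v)| * normc y <= 7 * normc l ^+ n.
Proof.
have h : `|Im (Kfun u v)| <= normc (l - l^-1).
  by rewrite (le_trans ImK)// -normcV -[normc l^-1]normcN ler_normc_sub.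
apply: (le_trans (ler_wpM2r (normc_ge0 _) h)).
rewrite yE; apply: (le_trans (le_normcD _ _)).
rewrite normcN !normcM normcV normcX.
have := A5; have := B2; have := normc_ge0 A; have := normc_ge0 B.
have := lnV; have := ln0.
have : 0 <= normc l ^- n by rewrite invr_ge0 ltW.
move: (normc l ^+ n) (normc l ^- n) (normc A) (normc B) => x z a b; nra.
Qed.

(** As |l| - 1/|l| <= 2 (|l| - 1), one has |l| >= 1 + |Im K|/2, and Bernoulli's inequality gives
    |l|^(2n) >= 1 + n |Im K| >= 8: this is where 7 comes from. Then |l|^n / 2 - 2 |l|^(-n) >= |l|^n
    / 4, and |l - 1/l| <= 5 produces 20 = 4 * 5. *)
Lemma yseq_lower : 7 <= n%:R * `|Im (Kfun u v)| -> normc l ^+ n <= 20 * normc y.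
Proof.
move=> h7.
have d5 : normc (l - l^-1) <= 5.
  apply: (le_trans (le_normcD _ _)); rewrite normcN normcV.
  by have := normc_root_le; have := lV1; lra.
have l2 : 1 + `|Im (Kfun u v)| / 2 <= normc l.
  have := ImK; have : normc l * (normc l)^-1 = 1 by rewrite mulfV// gt_eqF.
  move: (`|_|) (normc l) l1 (_^-1) => i x x1 z xz iz.
  have : (x - z) <= 2 * (x - 1).
    have : 0 <= (x - 1) ^+ 2 by exact: sqr_ge0.
    rewrite expr2; nra.
  lra.
have l8 : 8 <= normc l ^+ n * normc l ^+ n.
  rewrite -exprD addnn -mul2n.
  have e : 0 <= `|Im (Kfun u v)| / 2 by rewrite divr_ge0.
  apply: le_trans (lerXn2r (2 * n) _ _ l2); rewrite ?nnegrE ?addr_ge0 ?(ltW n0)//.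
  apply: le_trans (bernoulli_ge (2 * n) e); rewrite natrM.
  by move: h7; move: (n%:R : R) (`|_|) => a b; lra.
have : normc l ^+ n * 2^-1 - normc l ^- n * 2 <= normc (l - l^-1) * normc y.
  rewrite yE; apply: le_trans (ler_normc_sub _ _).
  rewrite normcN !normcM normcV normcX.
  have := A2; have := B2; have := ln0.
  have : 0 <= normc l ^- n by rewrite invr_ge0 ltW.
  move: (normc l ^+ n) (normc l ^- n) (normc A) (normc B) => x z a b; nra.
have := normc_ge0 y.
have : normc l ^+ n * normc l ^- n = 1 by rewrite mulfV// gt_eqF.
have : 0 <= normc l ^- n by rewrite invr_ge0 ltW.
move: (normc l ^+ n) ln0 l8 (normc l ^- n) (normc (l - _)) d5 (normc y).
move=> x x0 x8 z d d5 w z0 xz w0 h.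
have : z * 8 <= x by nra.
nra.
Qed.

End bounds.
End growth.

(** * Integrals over the torus and the shear *)

Section torus.
Variable R : realType.
Local Notation mu := (@lebesgue_measure R).
Local Notation U := (circle R).
Local Notation P := (circle R \x circle R)%E.

Lemma ge0_torus_integralE (F : R * R -> \bar R) :
  measurable_fun setT F -> (forall x, 0 <= F x)%E ->
  (((2 * pi) ^+ 2)^-1%:E * \int[(mu \x mu)]_(x in @torus R) F x = \int[P]_x F x)%E.
Proof.
move=> mF F0.
have mD : measurable (`]- pi, pi]%classic : set R) by exact: measurable_itv.
have mT : measurable (@torus R) by exact: measurableX.
have mFT : measurable_fun setT (F \_ (@torus R)).
  by apply/(measurable_restrictT _ _).1 => //; exact: measurable_funTS.
have FT0 x : (0 <= (F \_ (@torus R)) x)%E by rewrite patchE; case: ifPn.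
have p0 : 0 <= (2 * pi)^-1 :> R by rewrite invr_ge0 mulr_ge0// pi_ge0.
have mF1 s : measurable_fun setT (fun t => F (s, t)) by exact: measurableT_comp.
rewrite integral_mkcond fubini_tonelli1// [RHS]fubini_tonelli1// /fubini_F.
have innerE s : (\int[U]_t F (s, t) = (2 * pi)^-1%:E *
    \int[mu]_(t in `](- pi)%R, pi]) F (s, t))%E by rewrite ge0_circleE.
have mI : measurable_fun setT (fun s => \int[U]_t F (s, t))%E.
  exact: (@measurable_fun_fubini_tonelli_F _ _ _ _ R (circle R) F mF F0).
rewrite ge0_circleE//; last by move=> s; exact: integral_ge0.
under [in RHS]eq_integral do rewrite innerE.
have -> : (\int[mu]_s \int[mu]_t (F \_ (@torus R)) (s, t) =
    \int[mu]_(s in `](- pi)%R, pi]) \int[mu]_(t in `](- pi)%R, pi]) F (s, t))%E.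
  rewrite [RHS]integral_mkcond; apply: eq_integral => s _.
  rewrite patchE; case: ifPn => sD.
    rewrite [RHS]integral_mkcond; apply: eq_integral => t _.
    rewrite !patchE; congr (if _ then _ else _).
    by apply/idP/idP; rewrite !inE /torus/=; [case|move=> ?; split => //; move: sD; rewrite inE].
  rewrite integral0_eq// => t _; rewrite patchE ifF//.
  by apply/negP; rewrite inE /torus/= => -[h _]; move: sD; rewrite notin_setE; exact.
rewrite ge0_integralZl//.
- by rewrite muleA -EFinM; congr (_%:E * _)%E; rewrite expr2 invfM.
- apply: measurable_funTS.
  under eq_fun do rewrite integral_mkcond.
  pose H (x : R * R) := ((fun t => F (x.1, t)) \_ `](- pi), pi]) x.2.
  apply: (@measurable_fun_fubini_tonelli_F _ _ _ _ R mu H); rewrite /H.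
    rewrite (_ : (fun x => _) = F \_ (setT `*` `](- pi), pi])).
      by apply/(measurable_restrictT _ _).1 => //; [exact: measurableX|exact: measurable_funTS].
    apply/funext => -[s t] /=; rewrite !patchE/=; congr (if _ then _ else _).
    by apply/idP/idP; rewrite !inE/=; [move=> ?; split|case].
  by move=> x; rewrite patchE; case: ifPn.
- by move=> s _; exact: integral_ge0.
Qed.

Lemma torus_integralE (f : R[i] -> R[i] -> R) :
  measurable_fun setT (fun x : R * R => f (cis x.1) (cis x.2)) ->
  torus_integral f = \int[P]_x f (cis x.1) (cis x.2).
Proof.
move=> mf; rewrite /torus_integral /Rintegral.
set F := fun x : R * R => f (cis x.1) (cis x.2).
have mF : measurable_fun setT (EFin \o F) by exact/measurable_EFinP.
rewrite integralE [in RHS]integralE.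
rewrite -[X in _ = fine (X - _)]ge0_torus_integralE//; last exact: measurable_funepos.
rewrite -[X in _ = fine (_ - X)]ge0_torus_integralE//; last exact: measurable_funeneg.
have c0 : 0 < ((2 * pi) ^+ 2)^-1 :> R.
  by rewrite invr_gt0 exprn_gt0// mulr_gt0// pi_gt0.
move: (_^-1) c0 => c c0.
have : (0 <= \int[(mu \x mu)]_(x in @torus R) (EFin \o F)^\+ x)%E by exact: integral_ge0.
have : (0 <= \int[(mu \x mu)]_(x in @torus R) (EFin \o F)^\- x)%E by exact: integral_ge0.
move: (integral _ _ _) (integral _ _ _) => b a; rewrite /F.
(* When one of the two parts is infinite, [fine] returns 0 on both sides, so no integrability is
   assumed. *)
case: a b => [a||] [b||]//= _ _; rewrite ?(gt0_muley, mulr0, gt0_mulNye)//= ?mulr0//.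
by rewrite mulrBr.
Qed.

Lemma ge0_torus_shear (F : R * R -> \bar R) :
  measurable_fun setT F -> (forall x, 0 <= F x)%E -> periodic2pi2 F ->
  (\int[P]_x F (x.2 - x.1, x.1)%R = \int[P]_x F x)%E.
Proof.
move=> mF F0 [pF _].
have mG : measurable_fun setT (fun x : R * R => F (x.2 - x.1, x.1)%R).
  apply: (measurableT_comp mF); apply: measurable_fun_pair => //=.
  exact: measurable_funB.
rewrite fubini_tonelli1// [RHS]fubini_tonelli2// /fubini_F /fubini_G/=.
apply: eq_integral => s _.
rewrite (@ge0_circle_shift _ (fun t => F (t, s)) (- s))//.
  exact: measurableT_comp.
Qed.

Lemma torus_shear (F : R * R -> R) :
  measurable_fun setT F -> periodic2pi2 F ->
  \int[P]_x F (x.2 - x.1, x.1) = \int[P]_x F x.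
Proof.
move=> mF [p1 p2]; congr fine.
have mF' : measurable_fun setT (EFin \o F) by exact/measurable_EFinP.
rewrite integralE [in RHS]integralE; congr (_ - _)%E.
- rewrite -[RHS]ge0_torus_shear.
  + by apply: eq_integral => x _; rewrite !funeposE.
  + exact: measurable_funepos.
  + by [].
  + by split=> s t; rewrite !funeposE/= ?p1 ?p2.
- rewrite -[RHS]ge0_torus_shear.
  + by apply: eq_integral => x _; rewrite !funenegE.
  + exact: measurable_funeneg.
  + by [].
  + by split=> s t; rewrite !funenegE/= ?p1 ?p2.
Qed.

End torus.

Section recurrence_on_torus.
Variable R : realType.
Local Notation U := (circle R).
Local Notation P := (circle R \x circle R)%E.
Implicit Types (s t : R) (x : R * R).

Definition Kcis x : R[i] := Kfun (cis x.1) (cis x.2).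
Definition ycis n x : R[i] := yseq (Kcis x) (cis x.1) (cis x.2) n.
(** Torus coordinates whose second component is t1 + t2. The imaginary part of K then depends on it
    alone, and freezing it leaves one free angle for Jensen's formula. *)
Definition shear x : R * R := (x.2 - x.1, x.1).

Lemma KcisE x :
  Kcis x = cis (x.1 - x.2) + cis (x.2 - x.1) + cis (- (x.1 + x.2)).
Proof. by rewrite /Kcis /Kfun !cisD !cisN cisD invfM mul1r. Qed.

(** The first two terms of [KcisE] are conjugate to each other, so their imaginary parts cancel. *)
Lemma Im_Kcis_shear x : Im (Kcis (shear x)) = - sin x.2.
Proof.
rewrite KcisE /= subrK; have -> : x.1 - (x.2 - x.1) = - (x.2 - x.1 - x.1) by ring.
by rewrite !sinN subrr add0r.
Qed.

Lemma normc_Kcis x : normc (Kcis x) <= 3.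
Proof.
rewrite KcisE; apply: (le_trans (le_normcD _ _)).
apply: (le_trans (lerD (le_normcD _ _) (lexx _))).
by rewrite !cis_norm; lra.
Qed.

Lemma measurable_shear : measurable_fun setT (shear : R * R -> R * R).
Proof.
by apply: measurable_fun_pair => //=; exact: measurable_funB.
Qed.

Lemma cmeasurable_Kcis : cmeasurable Kcis.
Proof.
rewrite (funext KcisE); apply: cmeasurableD; first apply: cmeasurableD.
- by apply: cmeasurable_cis; exact: measurable_funB.
- by apply: cmeasurable_cis; exact: measurable_funB.
- apply: cmeasurable_cis; apply: measurableT_comp; first exact: oppr_measurable.
  exact: measurable_funD.
Qed.

Lemma cmeasurable_ycis n : cmeasurable (ycis n.+1).
Proof.
suff [] : cmeasurable (ycis n.+1) /\ cmeasurable (ycis n.+2) by [].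
elim: n => [|n [IH1 IH2]]; first by split; exact: cmeasurable_cis.
split => //; rewrite /ycis; under [X in cmeasurable X]eq_fun do rewrite yseqSS.
apply: cmeasurableB => //; apply: cmeasurableM => //; exact: cmeasurable_Kcis.
Qed.

Lemma Kcis_periodic : periodic2pi2 Kcis.
Proof. by split=> s t; congr (Kfun _ _); exact: cis_periodic. Qed.

Lemma ycis_periodic n : periodic2pi2 (ycis n).
Proof.
split=> s t; rewrite /ycis.
  by rewrite Kcis_periodic.1 (cis_periodic s).
by rewrite Kcis_periodic.2 (cis_periodic t).
Qed.

Lemma normc_ycis n x : normc (ycis n.+1 x) <= 4 ^+ n.
Proof.
suff [] : normc (ycis n.+1 x) <= 4 ^+ n /\ normc (ycis n.+2 x) <= 4 ^+ n.+1 by [].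
elim: n => [|n [IH1 IH2]].
  by rewrite /ycis yseq1 yseq2 !cis_norm expr0 expr1; split; lra.
split => //; rewrite /ycis yseqSS; apply: (le_trans (le_normcD _ _)).
rewrite normcN normcM.
have := normc_Kcis x; have := normc_ge0 (Kcis x); have := normc_ge0 (ycis n.+2 x).
move: IH1 IH2; rewrite /ycis !exprS.
have : 0 <= 4 ^+ n :> R by rewrite exprn_ge0.
move: (4 ^+ n) (normc (Kcis x)) (normc _) (normc _) => a b c d; nra.
Qed.

(* In the variable Z = e^{is}, with x_1 = e^{i(t-s)} and x_2 = e^{is}, the function
   Z^{2n} x_n is a polynomial of degree 4n-3 with unimodular leading coefficient. *)
Lemma ycis_shear_poly n t : exists p : {poly R[i]}, normc (lead_coef p) = 1 /\
  forall s, normc (ycis n.+1 (shear (s, t))) = normc p.[cis s].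
Proof.
(* With x_1 = c/Z and x_2 = Z, the polynomial Q is Z^2 K. Multiplying each x_m by Z^(2m) turns the
   recurrence into p_(m+2) = Q p_(m+1) - Z^4 p_m, with initial values c Z and Z^5. *)
pose c := cis t; pose Q : {poly R[i]} := c^-1 *: 'X^4 + (c^-1 *: 'X^2 + c%:P).
have c0 : c != 0 by exact: cis_neq0.
have sQ : size (c^-1 *: 'X^2 + c%:P) = 3%N.
  by rewrite size_polyDl ?size_scale ?invr_eq0// size_polyXn// size_polyC; case: (c != 0).
have szQ : size Q = 5%N.
  by rewrite size_polyDl ?size_scale ?invr_eq0// ?size_polyXn ?sQ.
have lQ : lead_coef Q = c^-1.
  rewrite lead_coefDl ?size_scale ?invr_eq0// ?size_polyXn ?sQ//.
  by rewrite lead_coefZ lead_coefXn mulr1.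
pose p n := (iter n (fun p => (p.2, Q * p.2 - 'X^4 * p.1)) (c *: 'X, 'X^5)).
have pP m : [/\ size (p m).2 = (4 * m + 6)%N, normc (lead_coef (p m).2) = 1,
    (size (p m).1 <= 4 * m + 2)%N, normc (lead_coef (p m).1) = 1 &
    forall s, (p m).1.[cis s] = cis s ^+ (2 * m.+1) * ycis m.+1 (shear (s, t)) /\
      (p m).2.[cis s] = cis s ^+ (2 * m.+2) * ycis m.+2 (shear (s, t))].
  elim: m => [|m [s2 l2 s1 l1 E]].
    rewrite /p /=; split.
    - by rewrite size_polyXn.
    - by rewrite lead_coefXn normc1.
    - by rewrite size_scale// size_polyX.
    - by rewrite lead_coefZ lead_coefX mulr1 cis_norm.
    - move=> s; rewrite !hornerE /ycis yseq1 yseq2 /= cisD cisN -/c.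
      have := cis_neq0 s; move: (cis s) => z z0.
      by split; [field|ring].
  have pS : p m.+1 = ((p m).2, Q * (p m).2 - 'X^4 * (p m).1) by [].
  have p20 : (p m).2 != 0 by rewrite -size_poly_gt0 s2; lia.
  have Q0 : Q != 0 by rewrite -size_poly_gt0 szQ.
  have sQp : size (Q * (p m).2) = (4 * m + 10)%N.
    by rewrite size_mul// szQ s2; lia.
  (* The subtracted term has smaller degree, so each step multiplies the leading coefficient by the
     unimodular number 1/c. *)
  have sX : (size (- ('X^4 * (p m).1)%R) < size (Q * (p m).2)%R)%N.
    rewrite size_polyN sQp; apply: (leq_ltn_trans (size_polyMleq _ _)).
    by rewrite size_polyXn; move: s1; lia.
  rewrite pS /=; split => //.
  - by rewrite size_polyDl// sQp; lia.
  - by rewrite lead_coefDl// lead_coefM lQ normcM l2 normcV cis_norm invr1 mulr1.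
  - by rewrite s2; lia.
  - move=> s; have [E1 E2] := E s; split; first exact: E2.
    have -> : ycis m.+3 (shear (s, t)) = Kcis (shear (s, t)) * ycis m.+2 (shear (s, t))
       - ycis m.+1 (shear (s, t)) by rewrite /ycis yseqSS.
    have e2 : cis s ^+ (2 * m.+2) = cis s ^+ (2 * m.+1) * cis s ^+ 2.
      by rewrite -exprD; congr (_ ^+ _); lia.
    have e3 : cis s ^+ (2 * m.+3) = cis s ^+ (2 * m.+1) * cis s ^+ 4.
      by rewrite -exprD; congr (_ ^+ _); lia.
    rewrite hornerD hornerN !hornerM E1 E2 e2 e3 !hornerE.
    move: (ycis m.+1 _) (ycis m.+2 _) (_ ^+ (2 * m.+1)) => y1 y2 w.
    rewrite /Kcis /Kfun /= cisD cisN -/c.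
    have := cis_neq0 s; move: (cis s) => z z0.
    by field; rewrite z0 c0.
have [_ _ _ l1 E] := pP n; exists (p n).1; split => // s.
by have [-> _] := E s; rewrite normcM normcX cis_norm expr1n mul1r.
Qed.

End recurrence_on_torus.

Lemma normc_parallelogram (R : realType) (z w : R[i]) :
  normc (z + w) ^+ 2 + normc (z - w) ^+ 2 = 2 * (normc z ^+ 2 + normc w ^+ 2).
Proof. by case: z w => a b [c d]; rewrite !normcE2 /=; ring. Qed.

Section Gfun_measurable.
Variable R : realType.
Implicit Types K : R[i].

(** A form of G free of complex square roots, from which measurability can be read off. By the
    parallelogram law for l + 1/l and l - 1/l, q equals |l|^2 + |l|^(-2), and the real square root
    recovers |l|^2. *)
Lemma GfunE K (q := (normc K ^+ 2 + normc (K ^+ 2 - 4)) / 2) :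
  Gfun K = 2^-1 * ln ((q + Num.sqrt (q ^+ 2 - 4)) / 2).
Proof.
have [l [l0 lK l1 ->]] := Gfun_root K.
have n0 : 0 < normc l by exact: lt_le_trans l1.
have qE : q = normc l ^+ 2 + normc l ^- 2.
  have -> : q = (normc (l + l^-1) ^+ 2 + normc (l - l^-1) ^+ 2) / 2.
    rewrite /q lK -[normc (l - _) ^+ 2]normcX; congr ((_ + normc _) / _).
    by rewrite -lK; field.
  by rewrite normc_parallelogram mulrC mulKf ?pnatr_eq0// normcV exprVn.
have lge : normc l ^- 2 <= normc l ^+ 2.
  by rewrite (@le_trans _ _ 1)// ?invf_le1 ?exprn_ege1// exprn_gt0.
have -> : q ^+ 2 - 4 = (normc l ^+ 2 - normc l ^- 2) ^+ 2.
  by rewrite qE; field; rewrite gt_eqF.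
rewrite sqrtr_sqr ger0_norm ?subr_ge0// qE.
have -> : (normc l ^+ 2 + normc l ^- 2 + (normc l ^+ 2 - normc l ^- 2)) / 2 = normc l ^+ 2.
  by field; rewrite gt_eqF.
by rewrite lnXn// mulr2n; field.
Qed.

Lemma measurable_Gfun d (T : measurableType d) (f : T -> R[i]) :
  cmeasurable f -> measurable_fun setT (fun x => Gfun (f x)).
Proof.
move=> mf; under eq_fun do rewrite GfunE.
have mq : measurable_fun setT (fun x => (normc (f x) ^+ 2 + normc (f x ^+ 2 - 4)) / 2).
  apply: measurable_funM => //; apply: measurable_funD.
    by apply: measurable_funX; exact: measurable_normc.
  apply: measurable_normc; apply: cmeasurableB; last exact: cmeasurable_cst.
  exact: cmeasurableX.
apply: measurable_funM => //; apply: measurableT_comp; first exact: measurable_ln.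
apply: measurable_funM => //; apply: measurable_funD => //.
apply: (@measurableT_comp _ _ _ _ _ _ (@Num.sqrt R)).
  by apply: continuous_measurable_fun; exact: sqrt_continuous.
by apply: measurable_funB => //; exact: measurable_funX.
Qed.

Lemma Gfun_ge0 K : 0 <= Gfun K. Proof. exact: normr_ge0. Qed.

End Gfun_measurable.

Section thin_zone.
Variable R : realType.
Local Notation U := (circle R).
Local Notation mu := (@lebesgue_measure R).

Lemma measurable_sin_lt (e : R) : measurable [set t : R | `|sin t| < e].
Proof.
rewrite -[X in measurable X]setTI.
apply: (measurable_fun_ltr (f := fun t : R => `|sin t|) (g := fun=> e)) => //.
by apply: measurableT_comp => //; exact: measurable_sin.
Qed.

(** On a quarter period sin t >= t/4 puts the set inside []0, 4e]], and the normalizing factor 2/pi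
    is at most 1. *)
Lemma circle_sin_lt (e : R) : 0 <= e -> (U [set t : R | (`|sin t| < e)%R] <= (4 * e)%:E)%E.
Proof.
move=> e0; set Z := [set _ | _].
have mZ : measurable Z by exact: measurable_sin_lt.
pose f (x : R) : \bar R := (\1_[set y : R | y < e] x)%:E.
have mS : measurable [set y : R | y < e].
  by rewrite (_ : [set _ | _] = `]-oo, e[%classic)//; apply/seteqP; split => x /=; rewrite in_itv.
have mf : measurable_fun setT f by apply/measurable_EFinP; exact: measurable_indic.
rewrite -[X in (U X <= _)%E]setIT -integral_indic//.
have -> : (\int[U]_x (\1_Z x)%:E = \int[U]_x f `|sin x|%R)%E.
  by apply: eq_integral => x _; rewrite /f !indicE; congr (_%:R%:E); rewrite !inE.
rewrite ge0_circle_abs_sin//; last by move=> x; rewrite /f lee_fin.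
have p0 := pi_gt0 R; have p2 := pi_ge2 R; have p4 := pihalf_lt2 R.
apply: (@le_trans _ _ ((2 / pi)%:E * mu `]0%R, (4 * e)%R])%E); last first.
  rewrite lebesgue_measure_itv/= lte_fin; case: ifPn => h; rewrite ?mule0 ?lee_fin ?mulr_ge0//.
  by rewrite subr0 ler_piMl ?mulr_ge0// ler_pdivrMr// mul1r.
apply: lee_wpmul2l; first by rewrite lee_fin divr_ge0// ltW.
rewrite -[X in (_ <= mu X)%E]setIT -integral_indic//.
rewrite [leLHS]integral_mkcond. apply: ge0_le_integral => //.
- by move=> x _; rewrite patchE; case: ifPn => // _; rewrite /f lee_fin.
- apply/(measurable_restrictT _ _).1 => //; apply: measurable_funTS.
  by apply: (measurableT_comp mf); exact: measurable_sin.
- by apply/measurable_EFinP; exact: measurable_indic.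
- move=> x _; rewrite patchE; case: ifPn => [|_]; last by rewrite lee_fin.
  rewrite inE/= in_itv/= => /andP[x0 x2]; rewrite /f !indicE lee_fin ler_nat.
  case: (boolP (_ \in _)) => //; rewrite inE/= => se.
  rewrite mem_set//= in_itv/= x0/=.
  have := @sin_ge_quarter _ x; rewrite (ltW x0) x2 => /(_ isT); lra.
Qed.

End thin_zone.

(** * Linear growth of the Mahler measure *)

Section asymptotics.
Variable R : realType.
Local Notation U := (circle R).
Local Notation P := (circle R \x circle R)%E.
Local Notation T := (R * R)%type.

Let L n (x : T) : R := ln (normc (ycis n.+2 (shear x))).
Let G (x : T) : R := Gfun (Kcis (shear x)).
Let A (x : T) : \bar R := abs_ln (sin x.2).
(** For n > 0 the hypothesis of [yseq_lower] is exactly that of lying outside [Z n]. Since 7 / 0 =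
    0, the set [Z 0] is empty. *)
Let Z n : set T := [set x | `|sin x.2| < 7 / n%:R].

Let mL n : measurable_fun setT (L n).
Proof.
have mf : measurable_fun setT (fun x : T => ln (normc (ycis n.+2 x))).
  by apply: measurable_ln_normc; exact: cmeasurable_ycis.
exact: (measurableT_comp mf (@measurable_shear R)).
Qed.

Let mG : measurable_fun setT G.
Proof.
have mf : measurable_fun setT (fun x : T => Gfun (Kcis x)).
  by apply: measurable_Gfun; exact: cmeasurable_Kcis.
exact: (measurableT_comp mf (@measurable_shear R)).
Qed.

Let mA : measurable_fun setT A.
Proof.
exact: (measurableT_comp (@measurable_abs_ln_sin R) (measurable_snd)).
Qed.

Let mZ n : measurable (Z n).
Proof.
rewrite -[Z n]setTI.
have m2 : measurable_fun setT (snd : T -> R) by exact: measurable_snd.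
exact: (m2 measurableT _ (measurable_sin_lt _)).
Qed.

Let rootP (x : T) : exists l, [/\ 1 <= normc l, normc l <= 4, G x = ln (normc l),
  (forall n, `|sin x.2| * normc (ycis n.+2 (shear x)) <= 7 * normc l ^+ n) &
  (forall n, 7 <= n%:R * `|sin x.2| -> normc l ^+ n <= 20 * normc (ycis n.+2 (shear x)))].
Proof.
have [l [l0 lK l1 GE]] := Gfun_root (Kcis (shear x)); exists l.
have u1 := cis_norm (shear x).1; have v1 := cis_norm (shear x).2.
split => //.
- exact: (normc_root_le u1 v1 l1 lK).
- by move=> n; have := yseq_upper n u1 v1 l0 l1 lK; rewrite -/(Kcis _) Im_Kcis_shear normrN.
- by move=> n; have := @yseq_lower _ _ _ _ n u1 v1 l0 l1 lK; rewrite -/(Kcis _) Im_Kcis_shear normrN.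
Qed.

Let G_bound x : 0 <= G x <= ln 4.
Proof.
have [l [l1 l4 -> _ _]] := rootP x.
have n0 : 0 < normc l by exact: lt_le_trans l1.
by rewrite ln_ge0// ler_ln ?posrE.
Qed.

Let L_upper n x : ((L n x)%:E <= (n%:R * G x + ln 7)%:E + A x)%E.
Proof.
rewrite /A; have [s0|s0] := eqVneq (sin x.2) 0.
  by rewrite /abs_ln s0 eqxx addey// leey.
rewrite abs_ln_sinE// -EFinD lee_fin.
have sp : 0 < `|sin x.2| by rewrite normr_gt0.
have [l [l1 l4 -> hU _]] := rootP x.
have n0 : 0 < normc l by exact: lt_le_trans l1.
have ll0 : 0 <= ln (normc l) by exact: ln_ge0.
have s1 : ln `|sin x.2| <= 0 by apply: ln_le0; exact: sin_max.
have l7 : 0 <= ln 7 :> R by rewrite ln_ge0// ler1n.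
(* At a zero of x_(n+2) the convention ln 0 = 0 replaces -oo, and 0 is still below the right-hand
   side. *)
rewrite /L; have [y0|y0] := eqVneq (ycis n.+2 (shear x)) 0.
  have : 0 <= n%:R * ln (normc l) by rewrite mulr_ge0.
  by rewrite y0 normc0 [ln 0]exp.ln0//; lra.
have yp : 0 < normc (ycis n.+2 (shear x)) by rewrite normc_gt0.
have : ln (`|sin x.2| * normc (ycis n.+2 (shear x))) <= ln (7 * normc l ^+ n).
  by rewrite ler_ln ?posrE ?mulr_gt0 ?exprn_gt0.
rewrite !lnM ?posrE ?exprn_gt0// lnXn// -mulr_natl; lra.
Qed.

Let L_lower n x : ~ Z n x -> n%:R * G x - ln 20 <= L n x.
Proof.
have l20 : 0 <= ln 20 :> R by rewrite ln_ge0// ler1n.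
case: n => [|n].
  by move=> _; rewrite /L /ycis yseq2 cis_norm ln1 mul0r sub0r oppr_le0.
move=> /negP; rewrite -leNgt ler_pdivrMr// mulrC => h.
have [l [l1 l4 -> _ hL]] := rootP x.
have n0 : 0 < normc l by exact: lt_le_trans l1.
have := hL n.+1 h; rewrite -/(L n.+1 x).
have lp : 0 < normc l ^+ n.+1 by rewrite exprn_gt0.
move=> hl; have y0 : 0 < normc (ycis n.+3 (shear x)).
  by have := lt_le_trans lp hl; rewrite pmulr_rgt0.
have : ln (normc l ^+ n.+1) <= ln (20 * normc (ycis n.+3 (shear x))).
  by rewrite ler_ln ?posrE ?mulr_gt0.
by rewrite lnM ?posrE// lnXn// lerBlDr addrC mulr_natl.
Qed.

Let L_le n x : L n x <= n.+1%:R * ln 4.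
Proof.
have l4 : 0 <= ln 4 :> R by rewrite ln_ge0// ler1n.
rewrite /L; have [y0|y0] := eqVneq (ycis n.+2 (shear x)) 0.
  by rewrite y0 normc0 exp.ln0// mulr_ge0.
have : ln (normc (ycis n.+2 (shear x))) <= ln (4 ^+ n.+1).
  by rewrite ler_ln ?posrE ?normc_gt0 ?exprn_gt0// normc_ycis.
by rewrite lnXn// mulr_natl.
Qed.

Let L_slice n t : U.-integrable setT (EFin \o (fun s => L n (s, t))) /\
  0 <= \int[U]_s L n (s, t).
Proof.
have [p [lp pE]] := @ycis_shear_poly R n.+1 t.
have [ip p0] := jensen_poly_ge0 lp; split.
  by apply: eq_integrable ip => // s _; rewrite /= /L pE.
by under eq_Rintegral do rewrite /L pE.
Qed.

Let integrable_bounded (F : T -> R) (c : R) : measurable_fun setT F ->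
  (forall x, `|F x| <= c) -> P.-integrable setT (EFin \o F).
Proof.
move=> mF Fc; apply: measurable_bounded_integrable => //.
  by rewrite (@le_lt_trans _ _ 1%E) ?ltry ?probability_le1.
exists c; split => [|y cy x _]; first exact: num_real.
by apply: (le_trans (Fc x)); exact: ltW.
Qed.

Let integrable_cst (c : R) : P.-integrable setT (EFin \o (fun _ : T => c)).
Proof. exact: (@integrable_bounded _ `|c|). Qed.

(** From L <= M with M >= 0 follows |L| <= 2M - L. As each slice integral of L is nonnegative, the
    slice integrals of |L| are at most 2M, and Tonelli's theorem concludes. *)
Let iL n : P.-integrable setT (EFin \o L n).
Proof.
have mLn : measurable_fun setT (EFin \o L n) by exact/measurable_EFinP.
apply/(@integrable21ltyP _ _ _ _ R (circle R) (circle R) _ mLn) => /=.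
have l4 : 0 <= ln 4 :> R by rewrite ln_ge0// ler1n.
pose M : R := n.+1%:R * ln 4.
have M0 : 0 <= M by rewrite mulr_ge0.
apply: (@le_lt_trans _ _ (\int[U]_t (2 * M)%:E)%E); last first.
  by rewrite integral_cst//= probability_setT mule1 ltry.
apply: ge0_le_integral => //.
- by move=> t _; exact: integral_ge0.
- apply: (@measurable_fun_fubini_tonelli_G _ _ _ _ R (circle R) (abse \o (EFin \o L n))).
    exact: measurableT_comp.
  by move=> x; exact: abse_ge0.
move=> t _; have [it t0] := L_slice n t.
have iB : U.-integrable setT (EFin \o (fun s => 2 * M - L n (s, t))).
  have := integrableB measurableT (finite_measure_integrable_cst U (2 * M) measurableT) it.
  exact: eq_integrable.
apply: (@le_trans _ _ (\int[U]_s (2 * M - L n (s, t))%:E)%E).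
  apply: ge0_le_integral => //.
  - have mt := measurable_int _ it; apply/measurable_EFinP.
    by apply: measurableT_comp; [exact: normr_measurable|exact/measurable_EFinP].
  - exact: (measurable_int _ iB).
  - move=> s _; rewrite lee_fin; have := L_le n (s, t); rewrite -/M.
    by rewrite ler_norml => h; apply/andP; split; lra.
have -> : (\int[U]_s (2 * M - L n (s, t))%:E)%E = (\int[U]_s (2 * M - L n (s, t)))%:E.
  by rewrite fineK//; exact: integrable_fin_num.
rewrite lee_fin RintegralB//; last exact: finite_measure_integrable_cst.
rewrite Rintegral_cst//.
rewrite [X in _ * fine X](_ : _ = 1%E) ?mulr1; last exact: probability_setT.
by rewrite gerBl.
Qed.

Let iG : P.-integrable setT (EFin \o G).
Proof.
apply: (@integrable_bounded _ (ln 4)) => // x; have /andP[? ?] := G_bound x.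
by rewrite ger0_norm.
Qed.

Let iA : P.-integrable setT A.
Proof.
apply/integrableP; split => //.
under eq_integral do rewrite gee0_abs ?abs_ln_ge0//.
rewrite fubini_tonelli1// => [|x]; last exact: abs_ln_ge0.
rewrite -[ltLHS]/(\int[U]_s (cst (\int[U]_t abs_ln (sin t)) s))%E.
rewrite integral_cst//= probability_setT mule1.
exact: abs_ln_sin_lty.
Qed.

Let integrable_slice (f : T -> \bar R) : P.-integrable setT f ->
  U.-integrable setT (fun t => \int[U]_s f (s, t))%E.
Proof.
move=> fi; have mf : measurable_fun setT f := measurable_int _ fi.
apply/integrableP; split.
  exact: (@measurable_fubini_G _ _ _ _ R (circle R) (circle R) _ fi).
have fy : (\int[U]_t \int[U]_s `|f (s, t)| < +oo)%E.
  exact/(@integrable21ltyP _ _ _ _ R (circle R) (circle R) _ mf).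
apply: le_lt_trans fy; apply: ge0_le_integral => //.
- apply: measurableT_comp => //.
  exact: (@measurable_fubini_G _ _ _ _ R (circle R) (circle R) _ fi).
- apply: (@measurable_fun_fubini_tonelli_G _ _ _ _ R (circle R) (abse \o f)).
    exact: measurableT_comp.
  by move=> x; exact: abse_ge0.
- move=> t _; apply: le_abse_integral => //.
  by apply: (measurableT_comp mf); exact: pair2_measurable.
Qed.

Let upper : exists C : R, forall n, \int[P]_x L n x <= n%:R * (\int[P]_x G x) + C.
Proof.
exists (ln 7 + fine (\int[P]_x A x)%E) => n.
have iGn : P.-integrable setT (EFin \o (fun x => n%:R * G x + ln 7)).
  have l4 : 0 <= ln 4 :> R by rewrite ln_ge0// ler1n.
  apply: (@integrable_bounded _ (n%:R * ln 4 + ln 7)).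
    by apply: measurable_funD => //; exact: measurable_funM.
  move=> x; have /andP[g0 g4] := G_bound x.
  have l7 : 0 <= ln 7 :> R by rewrite ln_ge0// ler1n.
  by rewrite ger0_norm ?addr_ge0 ?mulr_ge0// lerD2r ler_wpM2l.
have E : (\int[P]_x (L n x)%:E <= \int[P]_x ((n%:R * G x + ln 7)%:E + A x))%E.
  apply: le_integral; first by [].
  - exact: iL.
  - exact: (integrableD measurableT iGn iA).
  - by move=> x _; exact: L_upper.
rewrite integralD// in E.
have LE : (\int[P]_x (L n x)%:E = (\int[P]_x L n x)%:E)%E.
  by rewrite fineK//; apply: integrable_fin_num => //; exact: iL.
have GE : (\int[P]_x (n%:R * G x + ln 7)%:E = (\int[P]_x (n%:R * G x + ln 7))%:E)%E.
  by rewrite fineK//; exact: integrable_fin_num.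
have AE : (\int[P]_x A x = (fine (\int[P]_x A x))%:E)%E.
  by rewrite fineK//; exact: integrable_fin_num.
move: E; rewrite LE GE AE -EFinD lee_fin => /le_trans; apply.
rewrite /= addrA lerD2r.
rewrite RintegralD//.
- rewrite RintegralZl// Rintegral_cst//.
  by rewrite [X in ln 7 * fine X](_ : _ = 1%E) ?mulr1//; exact: probability_setT.
- by have := integrableZl measurableT n%:R iG; exact: eq_integrable.
Qed.

(** 28 = 4 * 7, by [circle_sin_lt] with e = 7 / n. *)
Let measure_Z n : (P (Z n) <= (28 / n%:R)%:E)%E.
Proof.
have -> : Z n = setT `*` [set t | `|sin t| < 7 / n%:R].
  by apply/seteqP; split => [[s t]|[s t] []].
rewrite product_measure1E//; last exact: measurable_sin_lt.
rewrite [X in (X * _)%E](_ : _ = 1%E); last exact: probability_setT.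
rewrite mul1e (le_trans (circle_sin_lt _))// ?divr_ge0// lee_fin.
by rewrite mulrA -natrM.
Qed.

(** The minorant H is compared with L line by line. On a line inside the strip H <= 0, because G <=
    ln 4, while the integral of L is nonnegative by Jensen's formula; on the other lines [L_lower]
    holds pointwise. The indicator term costs n ln 4 times 28 / n. *)
Let lower : exists C : R, forall n, n%:R * (\int[P]_x G x) - C <= \int[P]_x L n x.
Proof.
exists (ln 20 + 28 * ln 4) => n.
have l4 : 0 <= ln 4 :> R by rewrite ln_ge0// ler1n.
have l20 : 0 <= ln 20 :> R by rewrite ln_ge0// ler1n.
have n0 : 0 <= n%:R :> R by [].
pose H (x : T) := n%:R * G x - (ln 20 + n%:R * ln 4 * \1_(Z n) x).
have mI : measurable_fun setT (\1_(Z n) : T -> R) by exact: measurable_indic.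
have i1 : P.-integrable setT (EFin \o (fun x => n%:R * G x)).
  by have := integrableZl measurableT n%:R iG; exact: eq_integrable.
have i2 : P.-integrable setT (EFin \o (fun x => n%:R * ln 4 * \1_(Z n) x)).
  apply: (@integrable_bounded _ (n%:R * ln 4)).
    exact: measurable_funM.
  move=> x; have /andP[x0 x1] : 0 <= (\1_(Z n) x : R) <= 1.
    by rewrite indicE; case: (x \in Z n); rewrite ?lexx ?ler01.
  by rewrite ger0_norm ?mulr_ge0// ler_piMr ?mulr_ge0.
have i3 : P.-integrable setT (EFin \o (fun x => ln 20 + n%:R * ln 4 * \1_(Z n) x)).
  have := integrableD measurableT (integrable_cst (ln 20)) i2.
  exact: eq_integrable.
have iH : P.-integrable setT (EFin \o H).
  by have := integrableB measurableT i1 i3; exact: eq_integrable.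
have HL : \int[P]_x H x <= \int[P]_x L n x.
  rewrite -lee_fin.
  have -> : (\int[P]_x H x)%:E = (\int[P]_x (H x)%:E)%E.
    by rewrite fineK//; exact: integrable_fin_num.
  have -> : (\int[P]_x L n x)%:E = (\int[P]_x (L n x)%:E)%E.
    by rewrite fineK//; apply: integrable_fin_num => //; exact: iL.
  rewrite -(@integral21_prod_meas1 _ _ _ _ R (circle R) (circle R) _ iH).
  rewrite -(@integral21_prod_meas1 _ _ _ _ R (circle R) (circle R) _ (iL n)).
  apply: le_integral => //.
  - exact: (integrable_slice iH).
  - exact: (integrable_slice (iL n)).
  move=> t _; rewrite /fubini_G /=.
  have [it t0] := L_slice n t.
  have mHt : measurable_fun setT (fun s => (H (s, t))%:E).
    by apply: (measurableT_comp (measurable_int _ iH)); exact: pair2_measurable.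
  have iHt : U.-integrable setT (EFin \o (fun s => H (s, t))).
    apply: measurable_bounded_integrable => //.
    - by rewrite (@le_lt_trans _ _ 1%E) ?ltry ?probability_le1.
    - exact/measurable_EFinP.
    - exists (2 * (n%:R * ln 4) + ln 20); split => [|y cy s _]; first exact: num_real.
      apply: le_trans (ltW cy); have /andP[g0 g4] := G_bound (s, t).
      have : 0 <= n%:R * G (s, t) <= n%:R * ln 4 by rewrite mulr_ge0//= ler_wpM2l.
      have : 0 <= n%:R * ln 4 * (\1_(Z n) ((s, t) : T) : R) <= n%:R * ln 4.
        have /andP[x0 x1] : 0 <= (\1_(Z n) ((s, t) : T) : R) <= 1.
          by rewrite indicE; case: (_ \in _); rewrite ?lexx ?ler01.
        by apply/andP; split; [rewrite !mulr_ge0|rewrite ler_piMr ?mulr_ge0].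
      by rewrite /H ler_norml => /andP[? ?] /andP[? ?]; apply/andP; split; lra.
  have [Zt|Zt] := pselect (`|sin t| < 7 / n%:R).
    apply: (@le_trans _ _ 0%E); last first.
      rewrite -(@fineK _ (integral _ _ _)) ?lee_fin//.
      exact: integrable_fin_num.
    rewrite -(integral0 U setT); apply: le_integral => //.
      exact: integrable0.
    move=> s _; rewrite /= lee_fin /H indicE mem_set//= mulr1.
    have /andP[g0 g4] := G_bound (s, t).
    have : n%:R * G (s, t) <= n%:R * ln 4 by rewrite ler_wpM2l.
    lra.
  apply: le_integral => //.
  move=> s _; rewrite lee_fin; apply: le_trans (L_lower (x := (s, t)) Zt).
  have x0 : 0 <= (\1_(Z n) ((s, t) : T) : R) by rewrite indicE; case: (_ \in _).
  have : 0 <= n%:R * ln 4 * (\1_(Z n) ((s, t) : T) : R) by rewrite mulr_ge0 ?mulr_ge0.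
  by rewrite /H; lra.
have iI : P.-integrable setT (EFin \o (\1_(Z n) : T -> R)).
  apply: (@integrable_bounded _ 1) => // x.
  by rewrite indicE; case: (_ \in _); rewrite ?normr1 ?normr0.
have IE : \int[P]_x \1_(Z n) x = fine (P (Z n)).
  rewrite /Rintegral integral_indic; [by rewrite setIT|by []|exact: mZ].
have HE : \int[P]_x H x = n%:R * (\int[P]_x G x) -
    (ln 20 + n%:R * ln 4 * fine (P (Z n))).
  rewrite /H (RintegralB measurableT i1 i3).
  rewrite (RintegralD measurableT (integrable_cst (ln 20)) i2).
  rewrite (RintegralZl n%:R measurableT iG) (RintegralZl (n%:R * ln 4) measurableT iI).
  rewrite Rintegral_cst// IE.
  by rewrite [X in ln 20 * fine X](_ : _ = 1%E) ?mulr1//; exact: probability_setT.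
apply: le_trans HL; rewrite HE lerD2l lerN2 lerD2l.
have : fine (P (Z n)) <= 28 / n%:R.
  rewrite -lee_fin fineK; first exact: measure_Z.
  by rewrite ge0_fin_numE// (le_lt_trans (measure_Z n))// ltry.
have := n0; rewrite le_eqVlt => /predU1P[<-|np].
  by rewrite !mul0r mulr_ge0.
rewrite ler_pdivlMr// => h; rewrite mulrAC ler_wpM2r// mulrC.
exact: h.
Qed.

Lemma mahler_ycis_asymptotics : exists C : R, forall n : nat,
  `|torus_integral (fun u v : R[i] => ln (normc (yseq (Kfun u v) u v n.+2)))
    - Cstar R * n%:R| <= C.
Proof.
have [C1 h1] := upper; have [C2 h2] := lower.
have CE : Cstar R = \int[P]_x G x.
  have mf : measurable_fun setT (fun x : T => Gfun (Kcis x)).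
    by apply: measurable_Gfun; exact: cmeasurable_Kcis.
  transitivity (\int[P]_x Gfun (Kcis x)).
    exact: (@torus_integralE R (fun u v => Gfun (Kfun u v)) mf).
  symmetry; apply: (@torus_shear R (fun x => Gfun (Kcis x)) mf).
  by have [p1 p2] := @Kcis_periodic R; split=> s t; rewrite ?p1 ?p2.
have LE n : torus_integral (fun u v : R[i] => ln (normc (yseq (Kfun u v) u v n.+2)))
    = \int[P]_x L n x.
  have mf : measurable_fun setT (fun x : T => ln (normc (ycis n.+2 x))).
    by apply: measurable_ln_normc; exact: cmeasurable_ycis.
  transitivity (\int[P]_x ln (normc (ycis n.+2 x))).
    exact: (@torus_integralE R (fun u v => ln (normc (yseq (Kfun u v) u v n.+2))) mf).
  symmetry; apply: (@torus_shear R (fun x => ln (normc (ycis n.+2 x))) mf).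
  by have [p1 p2] := @ycis_periodic R n.+2; split=> s t; rewrite ?p1 ?p2.
exists (Num.max C1 C2) => n; rewrite LE CE ler_norml.
have := h1 n; have := h2 n.
have : C1 <= Num.max C1 C2 by rewrite le_max lexx.
have : C2 <= Num.max C1 C2 by rewrite le_max lexx orbT.
rewrite [n%:R * _]mulrC; move: (Num.max _ _) (\int[P]_x _) (_ * n%:R) => m a b ? ? ? ?.
by apply/andP; split; lra.
Qed.

End asymptotics.

(** * The constant as an integral over a quarter of the torus *)

Definition lnp (R : realType) (y : R) : R := ln (Num.max 1 y).

Section cstar_reduction.
Variable R : realType.
Local Notation U := (circle R).
Local Notation P := (circle R \x circle R)%E.
Local Notation T := (R * R)%type.

Lemma lnp_ge0 (y : R) : 0 <= lnp y.
Proof. by rewrite ln_ge0// le_max lexx. Qed.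

Lemma lnp_le1 (y : R) : y <= 1 -> lnp y = 0.
Proof. by move=> y1; rewrite /lnp max_l// ln1. Qed.

Lemma lnp_ge1 (y : R) : 1 <= y -> lnp y = ln y.
Proof. by move=> y1; rewrite /lnp max_r. Qed.

Lemma lnp_inv (w : R) : 0 < w -> lnp w = ln w + lnp w^-1.
Proof.
move=> w0; have [w1|/ltW w1] := leP w 1.
  by rewrite lnp_le1// lnp_ge1 ?invf_ge1// lnV ?posrE// subrr.
by rewrite lnp_ge1// lnp_le1 ?addr0// invf_le1.
Qed.

Lemma measurable_lnp d (X : measurableType d) (f : X -> R) :
  measurable_fun setT f -> measurable_fun setT (fun x => lnp (f x)).
Proof.
move=> mf; have mm : measurable_fun setT (fun x => Num.max 1 (f x)).
  by apply: measurable_maxr => //; exact: measurable_cst.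
exact: (measurableT_comp (@measurable_ln R) mm).
Qed.

Lemma cis_addV (s : R) : cis s + cis (- s) = (2 * cos s)%:C.
Proof.
rewrite /cis cosN sinN; apply/eqP; rewrite eq_complex /=.
by apply/andP; split; apply/eqP; ring.
Qed.

(** Jensen's formula for (z - l)(z - 1/l), which at z = e^{ir} equals z (2 cos r - K). The root 1/l
    contributes nothing. *)
Lemma Gfun_jensen (K : R[i]) :
  (\int[U]_r (ln (normc ((2 * cos r)%:C - K)))%:E = (Gfun K)%:E)%E.
Proof.
have [l [l0 lK l1 ->]] := Gfun_root K.
have n0 : 0 < normc l by exact: lt_le_trans l1.
have [iP + _] := jensen_prod [:: l; l^-1].
rewrite !big_cons big_nil addr0 max_r// [X in _ + ln X]max_l; last first.
  by rewrite normcV invf_le1.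
rewrite ln1 addr0 => <-; rewrite fineK; last exact: integrable_fin_num.
apply: eq_integral => r _; congr (ln _)%:E.
rewrite !big_cons big_nil mulr1 -cis_addV -lK.
have -> : (cis r - l) * (cis r - l^-1) = cis r * (cis r + cis (- r) - (l + l^-1)).
  rewrite cisN; have := cis_neq0 r; move: (cis r) => z z0.
  by field; rewrite ?z0 ?l0.
by rewrite normcM cis_norm mul1r.
Qed.

Let integrand (t : R) (x : T) := ln (normc ((2 * cos x.2)%:C - ((2 * cos t)%:C + cis x.1))).

(** Justifies the exchange of integrals. The complex number has imaginary part - sin s whatever r
    and t are, and modulus at most 5 = 2 + 2 + 1. *)
Let integrable_integrand t : P.-integrable setT (EFin \o integrand t).
Proof.
have mI : measurable_fun setT (integrand t).
  apply: measurable_ln_normc; apply: cmeasurableB.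
    split => /=; last exact: measurable_cst.
    apply: measurable_funM => //; apply: measurableT_comp => //.
    exact: measurable_cos.
  by apply: cmeasurableD; [exact: cmeasurable_cst|exact: cmeasurable_cis].
have mI' : measurable_fun setT (EFin \o integrand t) by exact/measurable_EFinP.
have bound (s r : R) : (`|(integrand t (s, r))%:E| <= abs_ln (sin s) + (ln 5)%:E)%E.
  have [s0|s0] := eqVneq (sin s) 0; first by rewrite /abs_ln s0 eqxx/= leey.
  pose z := (2 * cos r)%:C - ((2 * cos t)%:C + cis s).
  have -> : integrand t (s, r) = ln (normc z) by [].
  rewrite abs_ln_sinE// -EFinD abse_EFin lee_fin ler_norml.
  have sp : 0 < `|sin s| by rewrite normr_gt0.
  have zs : `|sin s| <= normc z.
    have -> : sin s = - Im z by rewrite /z/= add0r add0r opprK.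
    by rewrite normrN norm_Im_le.
  have z5 : normc z <= 5.
    have c2 (a : R) : normc (2 * cos a)%:C <= 2.
      rewrite /= expr0n addr0 sqrtr_sqr normrM ger0_norm//.
      by rewrite ler_piMr// cos_max.
    apply: (le_trans (le_normcD _ _)); rewrite normcN.
    apply: (le_trans (lerD (c2 r) (le_normcD _ _))).
    by rewrite cis_norm; have := c2 t; lra.
  have zp : 0 < normc z by exact: lt_le_trans zs.
  have l0 : ln `|sin s| <= 0 by apply: ln_le0; exact: sin_max.
  have l5 : 0 <= ln 5 :> R by rewrite ln_ge0// ler1n.
  have h1 : ln `|sin s| <= ln (normc z) by rewrite ler_ln ?posrE.
  have h2 : ln (normc z) <= ln 5 by rewrite ler_ln ?posrE.
  by apply/andP; split; lra.
apply/(@integrable12ltyP _ _ _ _ R (circle R) (circle R) _ mI') => /=.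
have iB : U.-integrable setT (fun s => abs_ln (sin s) + (ln 5)%:E)%E.
  apply: integrableD => //.
    by have := integrable_abs_ln_sin (0:R); under eq_fun do rewrite addr0.
  exact: finite_measure_integrable_cst.
have B0 s : (0 <= abs_ln (sin s) + (ln 5)%:E)%E.
  by rewrite adde_ge0 ?abs_ln_ge0// lee_fin ln_ge0// ler1n.
apply: (@le_lt_trans _ _ (\int[U]_s (abs_ln (sin s) + (ln 5)%:E))%E); last first.
  have /integrableP[_] := iB; apply: le_lt_trans.
  by under [leRHS]eq_integral do rewrite gee0_abs//.
apply: ge0_le_integral => //.
- by move=> s _; exact: integral_ge0.
- apply: (@measurable_fun_fubini_tonelli_F _ _ _ _ R (circle R) (abse \o (EFin \o integrand t))).
    exact: measurableT_comp.
  by move=> x; exact: abse_ge0.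
- exact: (measurable_int _ iB).
move=> s _; apply: (@le_trans _ _ (\int[U]_(r in setT) (cst (abs_ln (sin s) + (ln 5)%:E) r))%E).
  apply: ge0_le_integral => //.
  - apply/measurable_EFinP; apply: measurableT_comp; first exact: normr_measurable.
    by apply: (measurableT_comp mI); exact: pair1_measurable.
  - by move=> r _; exact: bound.
by rewrite integral_cst//= probability_setT mule1.
Qed.

(** G is written as a mean over r; after exchanging the integrals, the integrand is the logarithm of
    a function linear in e^{is}, and Jensen's formula applies once more. *)
Lemma int_Gfun (t : R) :
  (\int[U]_s (Gfun ((2 * cos t)%:C + cis s))%:E =
   \int[U]_r (lnp `|2 * cos r - 2 * cos t|)%:E)%E.
Proof.
have iI := integrable_integrand t.
have E : (\int[U]_s \int[U]_r
      (ln (normc ((2 * cos r)%:C - ((2 * cos t)%:C + cis s))))%:E =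
    \int[U]_r \int[U]_s
      (ln (normc ((2 * cos r)%:C - ((2 * cos t)%:C + cis s))))%:E)%E.
  exact: (@Fubini _ _ _ _ R (circle R) (circle R) _ iI).
transitivity (\int[U]_s \int[U]_r
    (ln (normc ((2 * cos r)%:C - ((2 * cos t)%:C + cis s))))%:E)%E.
  by apply: eq_integral => s _; rewrite Gfun_jensen.
rewrite E; apply: eq_integral => r _.
have [iL LE _] := jensen_linear ((2 * cos r - 2 * cos t)%:C).
have nE : normc (2 * cos r - 2 * cos t)%:C = `|2 * cos r - 2 * cos t|.
  by rewrite /= expr0n addr0 sqrtr_sqr.
rewrite /lnp -nE -LE fineK; last exact: integrable_fin_num.
apply: eq_integral => s _; congr (ln _)%:E; rewrite -normcN; congr normc.
by rewrite (rmorphB (real_complex R)); ring.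
Qed.

(** The rotation serves twice: to bring K to the form 2 cos t + e^{-is}, with real part and phase in
    separate variables, and to turn 2 cos r - 2 cos t into a product of sines. *)
Lemma Cstar_lnp :
  (Cstar R)%:E = (\int[P]_x (lnp (4 * `|sin x.1| * `|sin x.2|))%:E)%E.
Proof.
pose Phi (x : T) : R := Gfun ((2 * cos x.2)%:C + cis (- x.1)).
have cmPhi : cmeasurable (fun x : T => (2 * cos x.2)%:C + cis (- x.1)).
  apply: cmeasurableD.
    split => /=; last exact: measurable_cst.
    apply: measurable_funM => //; apply: measurableT_comp => //.
    exact: measurable_cos.
  by apply: cmeasurable_cis; apply: measurableT_comp => //; exact: oppr_measurable.
have mPhi : measurable_fun setT Phi by exact: measurable_Gfun.
have mPhi' : measurable_fun setT (EFin \o Phi) by exact/measurable_EFinP.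
have Phi0 x : (0 <= (EFin \o Phi) x)%E by rewrite lee_fin Gfun_ge0.
have perPhi : periodic2pi2 (EFin \o Phi).
  by split=> s t; rewrite /Phi /= ?cosD2pi// opprD -(cis_periodic (- s - _)) subrK.
have mK : measurable_fun setT (fun x : T => Gfun (Kcis x)).
  by apply: measurable_Gfun; exact: cmeasurable_Kcis.
have PhiE x : Gfun (Kcis x) = Phi (x.1 + x.2, x.1 - x.2).
  rewrite /Phi KcisE [(x.1 + x.2, _).2]/= [(_, x.1 - x.2).1]/= -cis_addV opprB.
  by [].
have CE : (Cstar R)%:E = (\int[P]_x (EFin \o Phi) x)%E.
  have -> : Cstar R = (\int[P]_x Gfun (Kcis x))%R.
    exact: (@torus_integralE R (fun u v => Gfun (Kfun u v)) mK).
  rewrite -ge0_torus_rotate// fineK.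
    by apply: eq_integral => x _; rewrite PhiE.
  apply: integrable_fin_num => //; apply: measurable_bounded_integrable => //.
    by rewrite (@le_lt_trans _ _ 1%E) ?ltry ?probability_le1.
  exists (ln 4); split => [|y cy x _]; first exact: num_real.
  apply: le_trans (ltW cy); rewrite ger0_norm ?Gfun_ge0//.
  have [l [l0 lK l1 ->]] := Gfun_root (Kcis x).
  rewrite ler_ln ?posrE// ?(lt_le_trans ltr01)//.
  exact: (normc_root_le (cis_norm x.1) (cis_norm x.2) l1 lK).
rewrite CE fubini_tonelli2// /fubini_G/=.
transitivity (\int[U]_t \int[U]_r (lnp `|2 * cos r - 2 * cos t|)%:E)%E.
  apply: eq_integral => t _; rewrite -int_Gfun /Phi/=.
  apply: (@ge0_circle_opp _ (fun s => (Gfun ((2 * cos t)%:C + cis s))%:E)).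
    apply/measurable_EFinP; apply: measurable_Gfun; apply: cmeasurableD;
      [exact: cmeasurable_cst|exact: cmeasurable_cis].
  by move=> s; rewrite lee_fin Gfun_ge0.
pose H (x : T) := (lnp `|2 * cos x.1 - 2 * cos x.2|)%:E.
have mH : measurable_fun setT H.
  apply/measurable_EFinP; apply: measurable_lnp.
  apply: measurableT_comp; first exact: normr_measurable.
  by apply: measurable_funB; apply: measurable_funM => //;
    apply: measurableT_comp => //; exact: measurable_cos.
have H0 x : (0 <= H x)%E by rewrite lee_fin lnp_ge0.
have -> : (\int[U]_t \int[U]_r (lnp `|2 * cos r - 2 * cos t|)%:E = \int[P]_x H x)%E.
  by rewrite fubini_tonelli2.
rewrite -ge0_torus_rotate//; last by split=> s t; rewrite /H/= cosD2pi.
apply: eq_integral => x _; rewrite /H /= cosD cosB; congr (lnp _)%:E.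
have -> : 2 * (cos x.1 * cos x.2 - sin x.1 * sin x.2) -
   2 * (cos x.1 * cos x.2 + sin x.1 * sin x.2) = - (4 * (sin x.1 * sin x.2)) by ring.
by rewrite normrN !normrM ger0_norm// mulrA.
Qed.

End cstar_reduction.

Section cstar_quarter.
Variable R : realType.
Local Notation mu := (@lebesgue_measure R).
Local Notation U := (circle R).
Local Notation P := (circle R \x circle R)%E.
Local Notation T := (R * R)%type.

Let S (s : R) := ln (2 * `|sin s|).

Let normc_cis_double (s : R) : normc (cis (2 * s) - 1) = 2 * `|sin s|.
Proof.
have -> : cis (2 * s) - 1 = cis s * (0 +i* (2 * sin s)).
  have -> : 2 * s = s + s by ring.
  apply/eqP; rewrite /cis cosD sinD eq_complex /=.
  apply/andP; split; apply/eqP; have := cos2Dsin2 s; move: (cos s) (sin s) => c d; lra.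
by rewrite normcM cis_norm mul1r /= expr0n add0r sqrtr_sqr normrM ger0_norm.
Qed.

Let mS : measurable_fun setT S.
Proof.
apply: measurableT_comp; first exact: measurable_ln.
apply: measurable_funM => //; apply: measurableT_comp; first exact: normr_measurable.
exact: measurable_sin.
Qed.

Let iS : U.-integrable setT (EFin \o S).
Proof.
have iB : U.-integrable setT (fun s => abs_ln (sin s) + (ln 2)%:E)%E.
  apply: integrableD => //.
    by have := integrable_abs_ln_sin (0:R); under eq_fun do rewrite addr0.
  exact: finite_measure_integrable_cst.
apply: le_integrable iB => //; first by apply/measurable_EFinP; exact: mS.
have l2 : 0 <= ln 2 :> R by rewrite ln_ge0// ler1n.
move=> s _; rewrite [leRHS]gee0_abs ?adde_ge0 ?abs_ln_ge0//.
have [s0|s0] := eqVneq (sin s) 0; first by rewrite /abs_ln s0 eqxx/= leey.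
have sp : 0 < `|sin s| by rewrite normr_gt0.
have l0 : ln `|sin s| <= 0 by apply: ln_le0; exact: sin_max.
rewrite abs_ln_sinE// -EFinD abse_EFin lee_fin ler_norml /S lnM ?posrE//.
by apply/andP; split; lra.
Qed.

(** 2 |sin s| = |e^{2is} - 1|, so this is Jensen's formula with a root on the unit circle. *)
Let int_S : (\int[U]_s (S s)%:E = 0)%E.
Proof.
have [iL LE _] := @jensen_linear R 1.
transitivity (\int[U]_s (ln (normc (cis (2 * s) - 1)))%:E)%E.
  by apply: eq_integral => s _; rewrite normc_cis_double.
rewrite (@circle_double _ (fun s => ln (normc (cis s - 1)))).
- rewrite -[LHS]fineK; last exact: integrable_fin_num.
  by rewrite -/(Rintegral _ _ _) LE normc1 maxxx ln1.
- by apply: measurable_ln_normc; apply: cmeasurableB;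
    [exact: cmeasurable_cis|exact: cmeasurable_cst].
- by move=> s; rewrite cis_periodic.
Qed.

(** The reciprocal is preferred to 4 |sin s| |sin t| because, for t beyond pi/6, the inner integrand
    is then supported on s <= pi/6, where the arcsine series converges fast. *)
Let V (s t : R) := lnp (4 * `|sin s| * `|sin t|)^-1.

Let V_le (s t : R) : V s t <= `|S s| + `|S t|.
Proof.
rewrite /V; have [W1|W1] := leP 1 (4 * `|sin s| * `|sin t|).
  rewrite lnp_le1 ?addr_ge0// invf_le1//; exact: lt_le_trans W1.
(* Here the inverse of 0 is 0, so V is 0 where the true value is +oo; this affects only a null
   set. *)
have [->|s0] := eqVneq (sin s) 0.
  by rewrite normr0 mulr0 mul0r invr0 lnp_le1// addr_ge0.
have [->|t0] := eqVneq (sin t) 0.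
  by rewrite normr0 mulr0 invr0 lnp_le1// addr_ge0.
have sp : 0 < `|sin s| by rewrite normr_gt0.
have tp : 0 < `|sin t| by rewrite normr_gt0.
have Wp : 0 < 4 * `|sin s| * `|sin t| by rewrite !mulr_gt0.
rewrite lnp_ge1 ?invf_ge1// ?(ltW W1)// lnV ?posrE//.
have -> : 4 * `|sin s| * `|sin t| = (2 * `|sin s|) * (2 * `|sin t|) by ring.
rewrite lnM ?posrE ?mulr_gt0// -/(S s) -/(S t).
by rewrite opprD lerD// -normrN ler_norm.
Qed.

Let mW : measurable_fun setT (fun x : T => 4 * `|sin x.1| * `|sin x.2|).
Proof.
have m1 : measurable_fun setT (fun x : T => `|sin x.1|).
  apply: measurableT_comp; first exact: normr_measurable.
  by apply: measurableT_comp => //; exact: measurable_sin.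
have m2 : measurable_fun setT (fun x : T => `|sin x.2|).
  apply: measurableT_comp; first exact: normr_measurable.
  by apply: measurableT_comp => //; exact: measurable_sin.
by apply: measurable_funM => //; exact: measurable_funM.
Qed.

Let mV : measurable_fun setT (fun x : T => (V x.1 x.2)%:E).
Proof.
apply/measurable_EFinP; apply: measurable_lnp.
rewrite (_ : (fun x => _) = (fun x : T => (4 * `|sin x.1| * `|sin x.2|) `^ (-1))).
  have mp : measurable_fun setT (fun x : R => x `^ (-1)) by exact: measurable_powR.
  exact: (measurableT_comp mp mW).
by apply/funext => x; rewrite powR_inv1 ?mulr_ge0.
Qed.

Let mV1 (t : R) : measurable_fun setT (fun s => (V s t)%:E).
Proof. exact: (measurableT_comp mV (pair2_measurable t)). Qed.

Let iV (t : R) : U.-integrable setT (fun s => (V s t)%:E).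
Proof.
have iB : U.-integrable setT (fun s => (`|S s| + `|S t|)%:E).
  have := integrableD measurableT (integrable_abse iS)
    (finite_measure_integrable_cst U `|S t| measurableT).
  by apply: eq_integrable.
apply: le_integrable iB => //; first exact: mV1.
move=> s _.
rewrite !abse_EFin lee_fin [leLHS]ger0_norm ?lnp_ge0// [leRHS]ger0_norm ?addr_ge0//.
Qed.

(** log^+ w = log w + log^+ (1/w) for w = (2 |sin s|)(2 |sin t|), and log (2 |sin s|) has mean
    zero. *)
Let inner (t : R) : sin t != 0 ->
  (\int[U]_s (lnp (4 * `|sin s| * `|sin t|))%:E = (S t)%:E + \int[U]_s (V s t)%:E)%E.
Proof.
move=> t0; have tp : 0 < `|sin t| by rewrite normr_gt0.
have iSt : U.-integrable setT (EFin \o (fun s => S s + S t)).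
  have := integrableD measurableT iS (finite_measure_integrable_cst U (S t) measurableT).
  by apply: eq_integrable.
transitivity (\int[U]_s ((S s + S t)%:E + (V s t)%:E))%E.
  apply: (@circle_ae_eq _ _ _ 0).
  - apply/measurable_EFinP; apply: measurable_lnp.
    exact: (measurableT_comp mW (pair2_measurable t)).
  - by apply: emeasurable_funD => //; exact: (measurable_int _ iSt).
  move=> s; rewrite addr0 => s0; have sp : 0 < `|sin s| by rewrite normr_gt0.
  rewrite -EFinD; congr EFin; rewrite lnp_inv ?mulr_gt0// -/(V s t); congr (_ + _).
  by rewrite /S -lnM ?posrE ?mulr_gt0//; congr ln; ring.
rewrite integralD//; congr (_ + _)%E.
under eq_integral do rewrite EFinD.
rewrite integralD//; last exact: finite_measure_integrable_cst.
by rewrite int_S add0e integral_cst//= probability_setT mule1.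
Qed.

Lemma Cstar_V : ((Cstar R)%:E = \int[U]_t \int[U]_s (V s t)%:E)%E.
Proof.
have mIV : measurable_fun setT (fun t => \int[U]_s (V s t)%:E)%E.
  apply: (@measurable_fun_fubini_tonelli_G _ _ _ _ R (circle R) (fun x : T => (V x.1 x.2)%:E)).
    exact: mV.
  by move=> x; rewrite lee_fin lnp_ge0.
have iIV : U.-integrable setT (fun t => \int[U]_s (V s t)%:E)%E.
  have iB : U.-integrable setT (fun t => (fine (\int[U]_s `|(S s)%:E|) + `|S t|)%:E)%E.
    have := integrableD measurableT (finite_measure_integrable_cst U
      (fine (\int[U]_s `|(S s)%:E|)%E) measurableT) (integrable_abse iS).
    by apply: eq_integrable.
  apply: le_integrable iB => // t _.
  have I0 : (0 <= \int[U]_s (V s t)%:E)%E.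
    by apply: integral_ge0 => s _; rewrite lee_fin lnp_ge0.
  have iA : U.-integrable setT (abse \o (EFin \o S)) := integrable_abse iS.
  have F0 : 0 <= fine (\int[U]_s `|(S s)%:E|)%E by rewrite fine_ge0// integral_ge0.
  rewrite gee0_abs// abse_EFin ger0_norm ?addr_ge0//.
  apply: (@le_trans _ _ (\int[U]_s (`|S s| + `|S t|)%:E)%E).
    apply: ge0_le_integral => //.
    - by move=> s _; rewrite lee_fin lnp_ge0.
    - exact: mV1.
    - apply/measurable_EFinP; apply: measurable_funD => //.
      by apply: measurableT_comp; [exact: normr_measurable|exact: mS].
    - by move=> s _; rewrite lee_fin V_le.
  under eq_integral do rewrite EFinD.
  rewrite integralD//; last exact: finite_measure_integrable_cst.
  rewrite EFinD fineK; last exact: integrable_fin_num.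
  by rewrite leeD2l// integral_cst//= probability_setT mule1.
rewrite Cstar_lnp.
have mL : measurable_fun setT (fun x : T => (lnp (4 * `|sin x.1| * `|sin x.2|))%:E).
  by apply/measurable_EFinP; exact: measurable_lnp.
have L0 (x : T) : (0 <= (lnp (4 * `|sin x.1| * `|sin x.2|))%:E)%E.
  by rewrite lee_fin lnp_ge0.
transitivity (\int[U]_t \int[U]_s (lnp (4 * `|sin s| * `|sin t|))%:E)%E.
  exact: (@fubini_tonelli2 _ _ _ _ R (circle R) (circle R) _ mL L0).
transitivity (\int[U]_t ((S t)%:E + \int[U]_s (V s t)%:E))%E.
  apply: (@circle_ae_eq _ _ _ 0).
  - exact: (@measurable_fun_fubini_tonelli_G _ _ _ _ R (circle R) _ mL L0).
  - by apply: emeasurable_funD => //; exact: (measurable_int _ iS).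
  - by move=> t; rewrite addr0; exact: inner.
by rewrite integralD// int_S add0e.
Qed.

Lemma Cstar_quarter : (Cstar R)%:E = (((2 / pi) ^+ 2)%:E *
  \int[mu]_(t in `]0%R, (pi / 2)%R]) \int[mu]_(s in `]0%R, (pi / 2)%R])
    (lnp (4 * `|sin s| * `|sin t|)^-1)%:E)%E.
Proof.
rewrite Cstar_V; have p0 := pi_gt0 R.
pose g (y x : R) : \bar R := (lnp (4 * `|x| * `|y|)^-1)%:E.
pose f (y : R) : \bar R := (\int[U]_s g y (sin s))%E.
have mabs : measurable_fun setT (fun x : T => 4 * `|x.1| * `|x.2|).
  have m1 : measurable_fun setT (fun x : T => `|x.1|).
    by apply: measurableT_comp; [exact: normr_measurable|exact: measurable_fst].
  have m2 : measurable_fun setT (fun x : T => `|x.2|).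
    by apply: measurableT_comp; [exact: normr_measurable|exact: measurable_snd].
  by apply: measurable_funM => //; exact: measurable_funM.
have mg2 : measurable_fun setT (fun x : T => g x.2 x.1).
  apply/measurable_EFinP; apply: measurable_lnp.
  rewrite (_ : (fun x => _) = (fun x : T => (4 * `|x.1| * `|x.2|) `^ (-1))).
    have mp : measurable_fun setT (fun x : R => x `^ (-1)) by exact: measurable_powR.
    exact: (measurableT_comp mp mabs).
  by apply/funext => x; rewrite powR_inv1 ?mulr_ge0.
have g0 y x : (0 <= g y x)%E by rewrite lee_fin lnp_ge0.
have mg (y : R) : measurable_fun setT (g y).
  exact: (measurableT_comp mg2 (pair2_measurable y)).
have mf : measurable_fun setT f.
  have mgs : measurable_fun setT (fun x : T => g x.2 (sin x.1)).
    have ms : measurable_fun setT (fun x : T => (sin x.1, x.2)).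
      apply: measurable_fun_pair => //=; apply: measurableT_comp => //.
      exact: measurable_sin.
    exact: (measurableT_comp mg2 ms).
  exact: (@measurable_fun_fubini_tonelli_G _ _ _ _ R (circle R) _ mgs (fun=> g0 _ _)).
have f0 y : (0 <= f y)%E by apply: integral_ge0 => s _; exact: g0.
transitivity (\int[U]_t f `|sin t|%R)%E.
  by apply: eq_integral => t _; rewrite /f /g normr_id.
rewrite ge0_circle_abs_sin//.
have IE (y : R) : f y = ((2 / pi)%:E * \int[mu]_(s in `]0%R, (pi / 2)%R]) g y (sin s))%E.
  rewrite /f -ge0_circle_abs_sin//.
  by apply: eq_integral => s _; rewrite /g normr_id.
have IE' (y : R) : (\int[mu]_(s in `]0%R, (pi / 2)%R]) g y (sin s) = (pi / 2)%:E * f y)%E.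
  rewrite IE muleA -EFinM; have -> : pi / 2 * (2 / pi) = 1 :> R.
    by move: (pi) p0 => p p0; field; rewrite gt_eqF.
  by rewrite mul1e.
under [in RHS]eq_integral do rewrite -/(g _ _) IE'.
rewrite ge0_integralZl//; last 2 first.
- apply: measurable_funTS; apply: (measurableT_comp mf); exact: measurable_sin.
- by rewrite lee_fin divr_ge0// ltW.
rewrite muleA -EFinM; congr (_%:E * _)%E.
by move: (pi) p0 => p p0; field; rewrite gt_eqF.
Qed.

End cstar_quarter.

(** * Numerical bounds *)

Section arcsine_series.
Variable R : realType.
Local Notation mu := (@lebesgue_measure R).
Implicit Types (a : nat -> R) (N m : nat) (x s b : R).

Definition oddsum a N x := \sum_(j < N) a j * x ^+ (2 * j).+1.
Definition evensum a N x := \sum_(j < N) a j * x ^+ (2 * j).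
(** Applied once to [binc] it gives the arcsine coefficients, applied twice those of the series
    S. *)
Definition over_odd a j := a j / (2 * j).+1%:R.

Lemma der_oddsum a N x :
  is_derive x 1 (oddsum (over_odd a) N) (evensum a N x).
Proof.
elim: N => [|N IH].
  rewrite /evensum big_ord0 (_ : oddsum _ _ = fun=> 0); first exact: der_cst.
  by apply/funext => y; rewrite /oddsum big_ord0.
rewrite (_ : oddsum (over_odd a) N.+1 =
    fun y => oddsum (over_odd a) N y + over_odd a N * y ^+ (2 * N).+1).
  apply: der_eq (derD IH (derZ _ (derX _ (der_id x)))) _.
  rewrite /evensum big_ord_recr/=; congr (_ + _).
  by rewrite /over_odd mulr1 mulrA mulrVK// unitfE pnatr_eq0.
by apply/funext => y; rewrite /oddsum big_ord_recr.
Qed.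

Definition devensum a N x := \sum_(j < N) a j * ((2 * j)%:R * x ^+ (2 * j).-1).

Lemma evensumS a N x : evensum a N.+1 x = evensum a N x + a N * x ^+ (2 * N).
Proof. exact: big_ord_recr. Qed.

Lemma devensumS a N x :
  devensum a N.+1 x = devensum a N x + a N * ((2 * N)%:R * x ^+ (2 * N).-1).
Proof. exact: big_ord_recr. Qed.

Lemma der_evensum a N x : is_derive x 1 (evensum a N) (devensum a N x).
Proof.
elim: N => [|N IH].
  rewrite /devensum big_ord0 (_ : evensum _ _ = fun=> 0); first exact: der_cst.
  by apply/funext => y; rewrite /evensum big_ord0.
rewrite (_ : evensum a N.+1 = fun y => evensum a N y + a N * y ^+ (2 * N)).
  apply: der_eq (derD IH (derZ _ (derX _ (der_id x)))) _.
  by rewrite devensumS mulr1.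
by apply/funext => y; rewrite evensumS.
Qed.

(* Coefficients of (1 - x^2)^(-1/2) in powers of x^2. *)
Fixpoint binc (j : nat) : R :=
  if j is i.+1 then binc i * ((2 * i).+1%:R / (2 * i).+2%:R) else 1.

Lemma binc_gt0 j : 0 < binc j.
Proof. by elim: j => //= j IH; rewrite mulr_gt0// divr_gt0. Qed.

(* The last coefficient of the truncated series is inflated so as to dominate
   the tail for x <= 1/2. *)
Definition binc_up m j := if j == m then binc m * ((8 * m)%:R / (6 * m - 1)%:R) else binc j.

(** The derivative in s of the partial sum at sin s. For the full series it would be the constant 1,
    so the bounds on the arcsine amount to comparing psi with 1. *)
Let psi a N s := cos s * evensum a N (sin s).

Let der_psi a N s : is_derive s 1 (psi a N)
  ((1 - sin s ^+ 2) * devensum a N (sin s)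
   - sin s * evensum a N (sin s)).
Proof.
apply: der_eq (derM (is_derive_cos s) (der_comp (is_derive_sin s) (der_evensum a N (sin s)))) _.
rewrite -cos2sin2; ring.
Qed.

(** (1 - x^2)^(-1/2) solves (1 - x^2) f' = x f. For a truncation only the term beyond the cut
    survives. *)
Let telescope m x :
  (1 - x ^+ 2) * devensum binc m.+1 x - x * evensum binc m.+1 x
  = - ((2 * m).+1%:R * binc m * x ^+ (2 * m).+1).
Proof.
elim: m => [|m IH].
  by rewrite /evensum /devensum !big_ord1 muln0 expr0 expr1 mul0r; ring.
rewrite devensumS evensumS mulrDr [x * (_ + _)]mulrDr opprD addrACA IH.
rewrite mulnS add2n /= !exprS -!natr1.
move: (x ^+ _) (binc m) => y c.
have : 0 <= (2 * m)%:R :> R by [].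
move: ((2 * m)%:R : R) => n n0; field.
by rewrite gt_eqF//; lra.
Qed.

Let evensum0 a N : evensum a N.+1 0 = a 0%N.
Proof.
rewrite /evensum big_ord_recl muln0 expr0 mulr1 big1 ?addr0// => i _.
by rewrite lift0 mulnS expr0n mulr0.
Qed.

Let psi0 a N : psi a N.+1 0 = a 0%N.
Proof. by rewrite /psi cos0 sin0 mul1r evensum0. Qed.

Let cont (f : R -> R) (df : R -> R) : (forall x, is_derive x 1 f (df x)) ->
  forall x, {for x, continuous f}.
Proof. by move=> h x; exact: is_derive_continuous (h x). Qed.

Let der_arc a N s : is_derive s 1 (fun s => s - oddsum (over_odd a) N (sin s)) (1 - psi a N s).
Proof.
apply: der_eq (derB (der_id s) (der_comp (is_derive_sin s) (der_oddsum a N (sin s)))) _.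
by rewrite /psi mulrC.
Qed.

Let oddsum0 a N : oddsum a N 0 = 0.
Proof. by rewrite /oddsum big1// => i _; rewrite expr0n mulr0. Qed.

(** psi starts at 1 and decreases by [telescope], so the partial sum grows no faster than s. *)
Lemma arcsine_lower m s : 0 <= s <= pi / 6 -> oddsum (over_odd binc) m.+1 (sin s) <= s.
Proof.
move=> /andP[s0 s6]; have p0 := pi_gt0 R.
have sin0' t : 0 <= t <= s -> 0 <= sin t.
  by move=> /andP[t0 ts]; apply: sin_ge0_pi; rewrite t0/=; lra.
have psi1 t : 0 <= t <= s -> psi binc m.+1 t <= 1.
  move=> /andP[t0 ts].
  suff : 1 - psi binc m.+1 0 <= 1 - psi binc m.+1 t by rewrite psi0 lerD2l lerN2.
  have dN (u : R) : is_derive u 1 (fun u => 1 - psi binc m.+1 u)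
      ((2 * m).+1%:R * binc m * sin u ^+ (2 * m).+1).
    by apply: der_eq (derB (der_cst 1 u) (der_psi binc m.+1 u)) _; rewrite telescope sub0r opprK.
  apply: (is_derive_ge0_le t0 (fun u _ => dN u)) => [u _|u /andP[u0 ut]].
    exact: cont dN u.
  rewrite mulr_ge0 ?exprn_ge0 ?mulr_ge0 ?(ltW (binc_gt0 _))//.
  by apply: sin0'; rewrite ltW//= (le_trans (ltW ut)).
rewrite -subr_ge0.
have -> : 0 = 0 - oddsum (over_odd binc) m.+1 (sin 0) :> R by rewrite sin0 oddsum0 subr0.
apply: (is_derive_ge0_le s0 (fun u _ => der_arc binc m.+1 u)) => [u _|u /andP[u0 ut]].
  exact: cont (der_arc binc m.+1) u.
by rewrite subr_ge0 psi1// !ltW.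
Qed.

Lemma sin_pi6 : sin (pi / 6) = 2^-1 :> R.
Proof.
have p0 := pi_gt0 R.
have s0 : 0 < sin (pi / 6 : R) by apply: sin_gt0_pi; apply/andP; split; lra.
have := sin_pihalf R.
have -> : pi / 2 = pi / 6 + (pi / 6 + pi / 6) :> R by field.
rewrite sinD sinD cosD; have := cos2Dsin2 (pi / 6 : R).
move: (sin _) (cos _) s0 => y c y0 h h2.
have c2 : c ^+ 2 = 1 - y ^+ 2 by rewrite -h; ring.
have h3 : 3 * y * c ^+ 2 - y ^+ 3 = 1 by rewrite -[RHS]h2; ring.
have : (2 * y - 1) ^+ 2 * (y + 1) = 0.
  have -> : (2 * y - 1) ^+ 2 * (y + 1) = 1 - (3 * y * (1 - y ^+ 2) - y ^+ 3) by ring.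
  by rewrite -c2 h3 subrr.
move/eqP; rewrite mulf_eq0 sqrf_eq0 => /orP[/eqP|/eqP]; lra.
Qed.

Lemma sin_le_half s : 0 <= s <= pi / 6 -> 0 <= sin s <= 2^-1.
Proof.
move=> /andP[s0 s6]; have p0 := pi_gt0 R; rewrite sin_ge0_pi ?s0/=; last by lra.
rewrite -sin_pi6; move: s6; rewrite le_eqVlt => /predU1P[->//|s6].
by rewrite ltW// ltr_sin// in_itv/=; apply/andP; split; lra.
Qed.

Let up_gt0 m : 0 < binc_up m.+1 m.+1.
Proof.
rewrite /binc_up eqxx; apply: mulr_gt0; first exact: binc_gt0.
by apply: divr_gt0; rewrite ltr0n; lia.
Qed.

(** With the inflated last coefficient psi is nondecreasing as long as sin s <= 1/2, so psi >= 1 and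
    the sum grows at least as fast as s. *)
Lemma arcsine_upper m s : 0 <= s <= pi / 6 ->
  s <= oddsum (over_odd (binc_up m.+1)) m.+2 (sin s).
Proof.
move=> /andP[s0 s6]; have p0 := pi_gt0 R.
pose a := binc_up m.+1.
have lt_a j : (j < m.+1)%N -> a j = binc j by rewrite /a /binc_up => jm; rewrite ltn_eqF.
have der x : (1 - x ^+ 2) * devensum a m.+2 x - x * evensum a m.+2 x =
   x ^+ (2 * m).+1 * (a m.+1 * ((2 * m).+2%:R - (2 * m).+3%:R * x ^+ 2)
     - (2 * m).+1%:R * binc m).
  rewrite devensumS evensumS.
  have -> : devensum a m.+1 x = devensum binc m.+1 x.
    by apply: eq_bigr => i _; rewrite lt_a.
  have -> : evensum a m.+1 x = evensum binc m.+1 x.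
    by apply: eq_bigr => i _; rewrite lt_a.
  have := telescope m x; move: (devensum _ _ _) (evensum _ _ _) => A B h.
  rewrite mulrDr [x * (_ + _)]mulrDr opprD addrACA h.
  rewrite mulnS add2n /= !exprS -!natr1.
  by move: (x ^+ _) (binc m) (a m.+1) ((2 * m)%:R : R) => y c d n; ring.
(* The inflation factor in [binc_up] is chosen to make this an equality at x = 1/2. *)
have ab x : 0 <= x <= 2^-1 -> (2 * m).+1%:R * binc m <=
    a m.+1 * ((2 * m).+2%:R - (2 * m).+3%:R * x ^+ 2).
  move=> /andP[x0 x2]; have xx : x ^+ 2 <= 4^-1.
    by have := ler_pM x0 x0 x2 x2; rewrite -expr2; lra.
  apply: (@le_trans _ _ (a m.+1 * ((2 * m).+2%:R - (2 * m).+3%:R * 4^-1))); last first.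
    rewrite ler_wpM2l//; first exact: ltW (up_gt0 m).
    by rewrite lerD2l lerN2 ler_wpM2l.
  rewrite /a /binc_up eqxx /=; have -> : (6 * m.+1 - 1 = 6 * m + 5)%N by lia.
  rewrite natrD !natrM -!natr1 !natrM -natr1; have : 0 <= m%:R :> R by [].
  move: (m%:R : R) (binc m) => n c n0.
  rewrite le_eqVlt; apply/orP; left; apply/eqP; field.
  by apply/andP; split; rewrite gt_eqF//; lra.
have psi1 t : 0 <= t <= s -> 1 <= psi a m.+2 t.
  move=> /andP[t0 ts].
  have a0 : a 0%N = 1 by rewrite lt_a.
  suff : psi a m.+2 0 <= psi a m.+2 t by rewrite psi0 a0.
  apply: (is_derive_ge0_le t0 (fun u _ => der_psi a m.+2 u)) => [u _|u /andP[u0 ut]].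
    exact: cont (der_psi a m.+2) u.
  have su : 0 <= sin u <= 2^-1.
    by apply: sin_le_half; apply/andP; split; lra.
  rewrite der; apply: mulr_ge0; last by rewrite subr_ge0 ab.
  by apply: exprn_ge0; case/andP: su.
have dN (u : R) : is_derive u 1 (fun s => oddsum (over_odd a) m.+2 (sin s) - s) (psi a m.+2 u - 1).
  apply: der_eq (derB (der_comp (is_derive_sin u) (der_oddsum a m.+2 (sin u))) (der_id u)) _.
  by rewrite /psi mulrC.
rewrite -subr_ge0.
have -> : 0 = oddsum (over_odd a) m.+2 (sin 0) - 0 :> R by rewrite sin0 oddsum0 subr0.
apply: (is_derive_ge0_le s0 (fun u _ => dN u)) => [u _|u /andP[u0 ut]].
  exact: cont dN u.
by rewrite subr_ge0 psi1// !ltW.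
Qed.

End arcsine_series.

(** * The integral of log (sin b / sin s) over ]0, b] *)

Section log_sine_integral.
Variable R : realType.
Local Notation mu := (@lebesgue_measure R).
Implicit Types (a : nat -> R) (N m : nat) (x s b : R).

Lemma oddsumE a N x : oddsum a N x = x * evensum a N x.
Proof. by rewrite /oddsum /evensum mulr_sumr; apply: eq_bigr => i _; rewrite exprS; ring. Qed.

(** Integration by parts, with s in the remaining integral of s cot s replaced by its truncated
    arcsine series. The derivative differs from the integrand by a term whose sign is given by the
    arcsine bounds. *)
Let prim a N b s := s * (ln (sin b) - ln (sin s)) + oddsum (over_odd (over_odd a)) N (sin s).

Let dprim a N b s := ln (sin b) - ln (sin s)
  + cos s * (evensum (over_odd a) N (sin s) - s / sin s).

Let sin_pos s : 0 < s <= pi / 6 -> 0 < sin s.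
Proof. by have := pi_gt0 R => p0 /andP[s0 s6]; apply: sin_gt0_pi; rewrite s0/=; lra. Qed.

Let der_ln_sin s : 0 < sin s -> is_derive s 1 (fun s : R => ln (sin s)) ((sin s)^-1 * cos s).
Proof. by move=> s0; exact: der_eq (der_comp (is_derive_sin s) (is_derive1_ln s0)) _. Qed.

Let der_prim a N b s : 0 < sin s -> is_derive s 1 (prim a N b) (dprim a N b s).
Proof.
move=> s0.
apply: der_eq (derD (derM (der_id s) (derB (der_cst (ln (sin b)) s) (der_ln_sin s0)))
  (der_comp (is_derive_sin s) (der_oddsum (over_odd a) N (sin s)))) _.
by rewrite /dprim; move: (evensum _ _ _) => e; field; rewrite gt_eqF.
Qed.

Let cont_dprim a N b s : 0 < sin s -> {for s, continuous (dprim a N b)}.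
Proof.
move=> s0; have s0' : sin s != 0 by rewrite gt_eqF.
exact: is_derive_continuous (derD (derB (der_cst (ln (sin b)) s) (der_ln_sin s0))
  (derM (is_derive_cos s)
    (derB (der_comp (is_derive_sin s) (der_evensum (over_odd a) N (sin s)))
      (derM (der_id s) (derV s0' (is_derive_sin s)))))).
Qed.

Let prim_cvg0 a N b : prim a N b s @[s --> 0^'+] --> (0 : R).
Proof.
have p0 := pi_gt0 R.
rewrite -[X in _ --> X]addr0; apply: cvgD; last first.
  have h : {for 0, continuous (fun s : R => oddsum (over_odd (over_odd a)) N (sin s))}.
    exact: is_derive_continuous (der_comp (is_derive_sin 0) (der_oddsum (over_odd a) N (sin 0))).
  apply: cvg_at_right_filter; move: h => /=; rewrite /continuous_at /prop_for sin0.
  rewrite (_ : oddsum _ _ 0 = 0)//.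
  by rewrite /oddsum big1// => i _; rewrite expr0n mulr0.
have cid : s @[s --> 0^'+] --> (0 : R) by apply: cvg_at_right_filter; exact: cvg_id.
rewrite (_ : (fun s : R => _) = fun s : R => s * ln (sin b) - s * ln (sin s)); last first.
  by apply/funext => s; rewrite mulrBr.
rewrite -[X in _ --> X]subr0; apply: cvgB.
  by rewrite -[X in _ --> X](mul0r (ln (sin b))); apply: cvgMl.
apply/cvgrPdist_le => e e0.
have /cvgrPdist_le/(_ (e / 4))/= := @xlnx_cvg0 R.
rewrite divr_gt0// => /(_ isT) H.
have H4 : \forall s \near (0:R)^'+, `|s / 4 * ln (s / 4)| <= e / 4.
  have [d /= d0 Hd] := H; exists (4 * d) => /=; first by rewrite mulr_gt0.
  move=> y /=; rewrite sub0r normrN => yd y0.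
  rewrite -normrN -sub0r; apply: Hd => /=; last by rewrite divr_gt0.
  by rewrite sub0r normrN normrM (ger0_norm (_ : 0 <= 4^-1))// ltr_pdivrMr// mulrC.
near=> s; rewrite sub0r normrN.
have s0 : 0 < s by near: s; exact: nbhs_right_gt.
have s1 : s <= pi / 2 by near: s; apply: nbhs_right_le; rewrite divr_gt0.
have ss : s / 4 <= sin s by apply: sin_ge_quarter; rewrite ltW.
have ss0 : 0 < sin s by apply: lt_le_trans ss; rewrite divr_gt0.
have hs : `|s / 4 * ln (s / 4)| <= e / 4 by near: s; exact: H4.
have l1 : ln (sin s) <= 0 by apply: ln_le0; exact: sin_le1.
have l2 : ln (s / 4) <= ln (sin s) by rewrite ler_ln ?posrE// divr_gt0.
have l3 := le_trans l2 l1.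
rewrite normrM (gtr0_norm s0) (ler0_norm l1).
move: hs; rewrite normrM (ler0_norm l3) (gtr0_norm (divr_gt0 s0 _))// => hs.
have : s * - ln (sin s) <= s * - ln (s / 4) by rewrite ler_pM2l// lerN2.
by lra.
Unshelve. all: by end_near. Qed.

Let mln b : 0 < b <= pi / 6 ->
  measurable_fun `]0, b]%classic (fun s : R => (ln (sin b) - ln (sin s))%:E).
Proof.
move=> _; apply/measurable_EFinP; apply: (@measurable_funS _ _ _ _ setT) => //.
by apply: measurable_funB => //; apply: measurableT_comp; [exact: measurable_ln|exact: measurable_sin].
Qed.

Let ln_sin_le b s : 0 < s <= b -> b <= pi / 6 -> 0 <= ln (sin b) - ln (sin s).
Proof.
have p0 := pi_gt0 R => /andP[s0 sb] b6.
rewrite subr_ge0 ler_ln ?posrE ?sin_pos//; last 2 first.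
- by rewrite s0 (le_trans sb).
- by rewrite (lt_le_trans s0).
move: sb; rewrite le_eqVlt => /predU1P[->//|sb].
by rewrite ltW// ltr_sin// in_itv/=; apply/andP; split; lra.
Qed.

Let sub_pi6 b s : b <= pi / 6 -> 0 < s <= b -> 0 < s <= pi / 6.
Proof. by move=> b6 /andP[-> sb]/=; exact: le_trans b6. Qed.

Let prim_end a N b : prim a N b b = oddsum (over_odd (over_odd a)) N (sin b).
Proof. by rewrite /prim subrr mulr0 add0r. Qed.

(** For the inflated coefficients the correction in [dprim] is nonnegative, so [dprim] dominates the
    integrand; only the boundary value at b remains. *)
Lemma int_ln_sin_upper m b : 0 < b <= pi / 6 ->
  (\int[mu]_(s in `]0%R, b]) (ln (sin b) - ln (sin s))%:E
   <= (oddsum (over_odd (over_odd (binc_up R m.+1))) m.+2 (sin b))%:E)%E.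
Proof.
move=> b06; case/andP: (b06) => b0 b6; have p0 := pi_gt0 R.
pose a := binc_up R m.+1.
have le s : 0 < s <= b -> ln (sin b) - ln (sin s) <= dprim a m.+2 b s.
  move=> sb; have s6 := sub_pi6 b6 sb; case/andP: (s6) => s0 s6'.
  rewrite /dprim lerDl mulr_ge0 ?cos_ge0_pihalf//; first by apply/andP; split; lra.
  rewrite subr_ge0 ler_pdivrMr ?sin_pos// mulrC -oddsumE.
  by apply: arcsine_upper; rewrite (ltW s0).
have FTC : (\int[mu]_(s in `]0%R, b]) (dprim a m.+2 b s)%:E = (prim a m.+2 b b - 0)%:E)%E.
  apply: ge0_FTC_right0 => //.
  - by move=> x xb; apply: der_prim; apply: sin_pos; exact: sub_pi6 xb.
  - by move=> x xb; apply: cont_dprim; apply: sin_pos; exact: sub_pi6 xb.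
  - by move=> x xb; apply: le_trans (le _ xb); exact: ln_sin_le.
rewrite -prim_end -/a -[prim _ _ _ _]subr0 -FTC; apply: ge0_le_integral.
- by [].
- by move=> s /=; rewrite in_itv/= => sb; rewrite lee_fin ln_sin_le.
- exact: mln.
- apply/measurable_EFinP; apply: subspace_continuous_measurable_fun => //.
  apply: continuous_in_subspaceT => x; rewrite inE/= in_itv/= => xb.
  by apply: cont_dprim; apply: sin_pos; exact: sub_pi6 xb.
- by move=> s /=; rewrite in_itv/= => sb; rewrite lee_fin le.
Qed.

(* The derivative of [prim] changes sign; adding 4 makes it nonnegative. *)
Lemma int_ln_sin_lower m b : 0 < b <= pi / 6 ->
  ((oddsum (over_odd (over_odd (binc R))) m.+1 (sin b))%:E <=
   \int[mu]_(s in `]0%R, b]) (ln (sin b) - ln (sin s))%:E)%E.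
Proof.
move=> b06; case/andP: (b06) => b0 b6; have p0 := pi_gt0 R.
pose a := binc R.
have le s : 0 < s <= b -> dprim a m.+1 b s <= ln (sin b) - ln (sin s).
  move=> sb; have s6 := sub_pi6 b6 sb; case/andP: (s6) => s0 s6'.
  rewrite /dprim gerDl mulr_ge0_le0 ?cos_ge0_pihalf//; first by apply/andP; split; lra.
  rewrite subr_le0 ler_pdivlMr ?sin_pos// mulrC -oddsumE.
  by apply: arcsine_lower; rewrite (ltW s0).
(* The only negative contribution is - cos s (s / sin s), and s / sin s <= 4. *)
have ge s : 0 < s <= b -> 0 <= dprim a m.+1 b s + 4.
  move=> sb; have s6 := sub_pi6 b6 sb; case/andP: (s6) => s0 s6'.
  have l0 := ln_sin_le sb b6; have ss := sin_pos s6.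
  have c1 := cos_le1 s; have c0 : 0 <= cos s by apply: cos_ge0_pihalf; apply/andP; split; lra.
  have e0 : 0 <= evensum (over_odd a) m.+1 (sin s).
    apply: sumr_ge0 => i _; rewrite mulr_ge0 ?exprn_ge0 ?(ltW ss)//.
    by rewrite divr_ge0// ltW// binc_gt0.
  have q4 : s / sin s <= 4.
    rewrite ler_pdivrMr// -ler_pdivrMl// mulrC.
    by apply: sin_ge_quarter; rewrite (ltW s0)/=; lra.
  have h : cos s * (s / sin s) <= 4.
    by apply: le_trans q4; rewrite ler_piMl// divr_ge0 ?ltW.
  rewrite /dprim mulrBr; have := mulr_ge0 c0 e0; lra.
have cont x : 0 < x <= b -> {for x, continuous (fun s => dprim a m.+1 b s + 4)}.
  move=> xb; apply: cvgD; last exact: cvg_cst.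
  by apply: cont_dprim; apply: sin_pos; exact: sub_pi6 xb.
have FTC : (\int[mu]_(s in `]0%R, b]) (dprim a m.+1 b s + 4)%:E =
    (prim a m.+1 b b + 4 * b - 0)%:E)%E.
  apply: (@ge0_FTC_right0 R (fun s => prim a m.+1 b s + 4 * s)
    (fun s => dprim a m.+1 b s + 4) b 0) => //.
  - move=> x xb; apply: der_eq (derD (der_prim _ _ _ (sin_pos (sub_pi6 b6 xb)))
      (derZ 4 (der_id x))) _; by rewrite mulr1.
  - rewrite -[X in _ --> X]addr0; apply: cvgD; first exact: prim_cvg0.
    rewrite -[X in _ --> X](mulr0 4); apply: cvgMr.
    by apply: cvg_at_right_filter; exact: cvg_id.
have : ((prim a m.+1 b b + 4 * b - 0)%:E <=
    \int[mu]_(s in `]0%R, b]) ((ln (sin b) - ln (sin s))%:E + 4%:E))%E.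
  rewrite -FTC; apply: ge0_le_integral.
  - by [].
  - by move=> s /=; rewrite in_itv/= => sb; rewrite lee_fin ge.
  - apply/measurable_EFinP; apply: subspace_continuous_measurable_fun => //.
    by apply: continuous_in_subspaceT => x; rewrite inE/= in_itv/=; exact: cont.
  - by apply: emeasurable_funD; [exact: mln|exact: measurable_cst].
  - by move=> s /=; rewrite in_itv/= => sb; rewrite lee_fin lerD2r le.
rewrite ge0_integralD//; last 2 first.
- by move=> s /=; rewrite in_itv/= => sb; rewrite lee_fin ln_sin_le.
- exact: mln.
rewrite integral_cst//= lebesgue_measure_itv/= lte_fin b0 oppr0 addr0 prim_end.
by rewrite -EFinD addr0 EFinD -EFinM leeD2rE.
Qed.

End log_sine_integral.

Section tonelli.
Variable R : realType.
Local Notation mu := (@lebesgue_measure R).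
Variables (f : R -> R -> \bar R) (A B : set R).
Hypotheses (mf : measurable_fun setT (fun x : R * R => f x.1 x.2))
  (f0 : forall x y, (0 <= f x y)%E) (mA : measurable A) (mB : measurable B).

Let g (x : R * R) := ((fun x => f x.1 x.2) \_ (A `*` B)) x.

Let mg : measurable_fun setT g.
Proof.
apply/(measurable_restrictT _ _).1; first exact: measurableX.
exact: measurable_funTS.
Qed.

Let g0 x : (0 <= g x)%E. Proof. by rewrite /g patchE; case: ifPn. Qed.

Lemma ge0_integral_swap :
  (\int[mu]_(x in A) \int[mu]_(y in B) f x y =
   \int[mu]_(y in B) \int[mu]_(x in A) f x y)%E.
Proof.
have inE2 (x y : R) : ((x, y) \in A `*` B) = (x \in A) && (y \in B).
  by apply/idP/andP; rewrite !inE/=.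
transitivity (\int[mu]_x \int[mu]_y g (x, y))%E.
  rewrite integral_mkcond; apply: eq_integral => x _; rewrite patchE; case: ifPn => xA.
    rewrite integral_mkcond; apply: eq_integral => y _.
    by rewrite /g !patchE inE2 xA.
  by rewrite integral0_eq// => y _; rewrite /g patchE inE2 (negbTE xA).
transitivity (\int[mu]_y \int[mu]_x g (x, y))%E.
  exact: (@fubini_tonelli _ _ _ _ R mu mu g mg g0).
rewrite [RHS]integral_mkcond; apply: eq_integral => y _; rewrite patchE; case: ifPn => yB.
  rewrite [RHS]integral_mkcond; apply: eq_integral => x _.
  by rewrite /g !patchE inE2 yB andbT.
by rewrite integral0_eq// => x _; rewrite /g patchE inE2 (negbTE yB) andbF.
Qed.

End tonelli.

Lemma measurable_ge0_integral (R : realType) (f : R -> R -> \bar R) (B : set R) :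
  measurable_fun setT (fun x : R * R => f x.1 x.2) ->
  (forall x y, (0 <= f x y)%E) -> measurable B ->
  measurable_fun setT (fun x => \int[@lebesgue_measure R]_(y in B) f x y)%E.
Proof.
move=> mf f0 mB; under eq_fun do rewrite integral_mkcond.
pose g (x : R * R) := ((fun x => f x.1 x.2) \_ (setT `*` B)) x.
have mg : measurable_fun setT g.
  apply/(measurable_restrictT _ _).1; first exact: measurableX.
  exact: measurable_funTS.
have g0 x : (0 <= g x)%E by rewrite /g patchE; case: ifPn.
have := @measurable_fun_fubini_tonelli_F _ _ _ _ R (@lebesgue_measure R) g mg g0.
rewrite (_ : fubini_F _ _ = (fun x => \int[@lebesgue_measure R]_y ((f x) \_ B) y)%E)//.
apply/funext => x; apply: eq_integral => y _; rewrite /g !patchE; congr (if _ then _ else _).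
by apply/idP/idP; rewrite !inE/=; [case|move=> ?; split].
Qed.

Section csc_continuity.
Variable R : realType.
Implicit Types t : R.

Lemma cont_oddsum_csc (a : nat -> R) N t : 0 < sin t ->
  {for t, continuous (fun t => oddsum (over_odd a) N (4 * sin t)^-1)}.
Proof.
move=> t0; have t40 : 4 * sin t != 0 by rewrite gt_eqF// mulr_gt0.
exact: is_derive_continuous (der_comp
  (@derV R (fun t : R => 4 * sin t) t _ t40 (derZ 4 (is_derive_sin t)))
  (der_oddsum a N (4 * sin t)^-1)).
Qed.

End csc_continuity.

(** * Cutting the quarter square at pi/6 *)

Section quarter_plane.
Variable R : realType.
Local Notation mu := (@lebesgue_measure R).
Local Notation h := (pi / 2 : R).
Local Notation q := (pi / 6 : R).

Let V (s t : R) : \bar R := (lnp (4 * `|sin s| * `|sin t|)^-1)%:E.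
Let W (t : R) : \bar R := (\int[mu]_(s in `]0%R, h]) V s t)%E.
Let J (b : R) : \bar R := (\int[mu]_(s in `]0%R, b]) (ln (sin b) - ln (sin s))%:E)%E.

Let V0 s t : (0 <= V s t)%E. Proof. by rewrite lee_fin lnp_ge0. Qed.

Let VC s t : V s t = V t s. Proof. by rewrite /V mulrAC. Qed.

Let mV : measurable_fun setT (fun x : R * R => V x.1 x.2).
Proof.
have msin i : i = fst \/ i = snd -> measurable_fun setT (fun x : R * R => `|sin (i x)|).
  by move=> [->|->]; apply: measurableT_comp; try exact: normr_measurable;
    apply: measurableT_comp => //; exact: measurable_sin.
have mabs : measurable_fun setT (fun x : R * R => 4 * `|sin x.1| * `|sin x.2|).
  apply: measurable_funM; last by apply: msin; right.
  by apply: measurable_funM => //; apply: msin; left.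
apply/measurable_EFinP; apply: measurable_lnp.
rewrite (_ : (fun x => _) = (fun x : R * R => (4 * `|sin x.1| * `|sin x.2|) `^ (-1))).
  have mp : measurable_fun setT (fun x : R => x `^ (-1)) by exact: measurable_powR.
  exact: (measurableT_comp mp mabs).
by apply/funext => x; rewrite powR_inv1 ?mulr_ge0.
Qed.

Let mVC : measurable_fun setT (fun x : R * R => V x.2 x.1).
Proof. by under eq_fun do rewrite VC; exact: mV. Qed.

Let mV1 t : measurable_fun setT (V^~ t).
Proof. exact: (measurableT_comp mV (pair2_measurable t)). Qed.

Let mW : measurable_fun setT W.
Proof.
by apply: (@measurable_ge0_integral _ (fun t s => V s t)); [exact: mVC|move=> *|].
Qed.

Let p0 : 0 < pi :> R. Proof. exact: pi_gt0. Qed.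

Let sin_lt s t : 0 <= s -> t <= h -> s < t -> sin s < sin t.
Proof. by move=> s0 th st; rewrite ltr_sin// in_itv/=; apply/andP; split; by move: p0; lra. Qed.

Let sin_le s t : 0 <= s -> t <= h -> s <= t -> sin s <= sin t.
Proof.
by move=> s0 th; rewrite le_eqVlt => /predU1P[->//|st]; exact/ltW/sin_lt.
Qed.

Let sin_gt0h s : 0 < s <= h -> 0 < sin s.
Proof. by move=> /andP[s0 sh]; apply: sin_gt0_pi; rewrite s0/=; by move: p0; lra. Qed.

Let V_eq0 s t : 0 < s <= h -> 0 < t <= h -> 1 <= 4 * sin s * sin t -> V s t = 0%E.
Proof.
move=> /sin_gt0h s0 /sin_gt0h t0 st.
rewrite /V !gtr0_norm// lnp_le1// invf_le1//.
by apply: lt_le_trans st.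
Qed.

Let V_ln s t : 0 < s <= h -> 0 < t <= h -> 4 * sin s * sin t <= 1 ->
  V s t = (- ln 4 - ln (sin s) - ln (sin t))%:E.
Proof.
move=> /sin_gt0h s0 /sin_gt0h t0 st.
have s40 : 0 < 4 * sin s by rewrite mulr_gt0.
have st0 : 0 < 4 * sin s * sin t by rewrite mulr_gt0.
rewrite /V !gtr0_norm// lnp_ge1; last by rewrite invf_ge1.
by rewrite lnV// !lnM ?posrE// !opprD.
Qed.

(** Here sin t >= 1/2, so b = asin (1 / (4 sin t)) is at most pi/6. V is log (sin b / sin s) up to s
    = b and 0 afterwards. *)
Let W_far t : q <= t <= h ->
  exists2 b, 0 < b <= q & sin b = (4 * sin t)^-1 /\ W t = J b.
Proof.
move=> /andP[qt th].
have t0h : 0 < t <= h by apply/andP; split; by move: p0; lra.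
have st0 := sin_gt0h t0h.
have st2 : 2^-1 <= sin t by rewrite -sin_pi6 sin_le//; by move: p0; lra.
pose x := (4 * sin t)^-1.
have s4 : 0 < 4 * sin t by rewrite mulr_gt0.
have x0 : 0 < x by rewrite invr_gt0.
have x2 : x <= 2^-1 by rewrite lef_pV2 ?posrE//; by move: p0; lra.
have x11 : -1 <= x <= 1 by apply/andP; split; by move: p0; lra.
have [b1 sb] : (- h <= asin x <= h) /\ sin (asin x) = x.
  by rewrite asin_geNpi2// asin_lepi2// asinK// in_itv.
move: (asin x) b1 sb => b /andP[hb bh] sb.
have b0 : 0 < b.
  rewrite ltNge; apply/negP => b0.
  have : 0 <= sin (- b) by apply: sin_ge0_pi; apply/andP; split; by move: p0; lra.
  by rewrite sinN sb; by move: p0; lra.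
have bq : b <= q.
  rewrite leNgt; apply/negP => qb; have : sin q < sin b by apply: sin_lt; by move: p0; lra.
  by rewrite sin_pi6 sb; by move: p0; lra.
exists b; first by rewrite b0.
split => //; rewrite /W (ge0_integral_itv_split (mV1 t) (fun s => V0 s t) (ltW b0) bh).
rewrite [X in (_ + X)%E]integral0_eq ?adde0.
  apply: eq_integral => s; rewrite inE/= in_itv/= => /andP[s0 sb'].
  have s0h : 0 < s <= h by rewrite s0/=; by move: p0; lra.
  have sle : sin s <= x by rewrite -sb sin_le// ltW.
  rewrite V_ln//; last by rewrite mulrAC -ler_pdivlMl// mulr1.
  by rewrite sb /x lnV ?posrE// lnM ?posrE//; congr _%:E; ring.
move=> s /=; rewrite in_itv/= => /andP[bs sh].
apply: V_eq0 => //; first by apply/andP; split; by move: p0; lra.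
by rewrite mulrAC -ler_pdivrMl// mulr1 -/x -sb sin_le// ltW.
Qed.

Let V_qq s t : q <= s <= h -> q <= t <= h -> V s t = 0%E.
Proof.
move=> /andP[qs sh] /andP[qt th]; apply: V_eq0; try by apply/andP; split; by move: p0; lra.
have h2 u : q <= u -> u <= h -> 2^-1 <= sin u.
  by move=> qu uh; rewrite -sin_pi6 sin_le//; by move: p0; lra.
have := h2 _ qs sh; have := h2 _ qt th; nra.
Qed.

Let q0 : 0 <= q. Proof. by rewrite divr_ge0 ?ltW. Qed.
Let qh : q <= h. Proof. by move: p0; lra. Qed.

(** As sin q = 1/2, the term - ln 4 equals 2 ln (sin q), one half for each variable. *)
Let near_near t : 0 < t <= q ->
  (\int[mu]_(s in `]0%R, q]) V s t = J q + q%:E * (ln (sin q) - ln (sin t))%:E)%E.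
Proof.
move=> /andP[t0 tq].
have le2 s : 0 < s -> s <= q -> sin s <= 2^-1 /\ 0 < sin s.
  move=> s0 sq; split; last by apply: sin_gt0h; rewrite s0/= (le_trans sq).
  by rewrite -sin_pi6 sin_le// ltW.
have [t2 st0] := le2 _ t0 tq.
have c0 s : 0 < s -> s <= q -> (0 <= (ln (sin q) - ln (sin s))%:E)%E.
  move=> s0 sq; have [s2 ss0] := le2 _ s0 sq.
  by rewrite lee_fin subr_ge0 sin_pi6 ler_ln ?posrE.
rewrite [LHS](_ : _ = \int[mu]_(s in `]0%R, q])
    ((ln (sin q) - ln (sin s))%:E + (ln (sin q) - ln (sin t))%:E))%E; last first.
  apply: eq_integral => s; rewrite inE/= in_itv/= => /andP[s0 sq].
  have [s2 ss0] := le2 _ s0 sq.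
  rewrite V_ln//; [|by rewrite s0 (le_trans sq)|by rewrite t0 (le_trans tq)|by nra].
  rewrite sin_pi6 (_ : 4 = 2 * 2); last by ring.
  by rewrite lnM ?posrE// lnV ?posrE// -EFinD; congr _%:E; ring.
rewrite ge0_integralD//.
- rewrite integral_cst//= lebesgue_measure_itv/= lte_fin divr_gt0// oppr0 addr0.
  by rewrite muleC.
- by move=> s /=; rewrite in_itv/= => /andP[s0 sq]; exact: c0.
- apply/measurable_EFinP; apply: measurable_funTS.
  apply: measurable_funB => //; apply: measurableT_comp; [exact: measurable_ln|exact: measurable_sin].
- by move=> s _; exact: c0.
Qed.

Let J_ge0 : (0 <= J q)%E.
Proof.
apply: integral_ge0 => s /=; rewrite in_itv/= => /andP[s0 sq].
rewrite lee_fin subr_ge0 ler_ln ?posrE; [|by apply: sin_gt0h; rewrite s0 (le_trans sq)|].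
  by apply: sin_le => //; exact: ltW.
by apply: sin_gt0h; rewrite qh divr_gt0.
Qed.

(** V vanishes on the far square, and the two mixed rectangles are mirror images, each contributing
    the integral of W over []q, h]]. The near square separates by [near_near]. *)
Lemma integral_quarter_split :
  (\int[mu]_(t in `]0%R, h]) \int[mu]_(s in `]0%R, h]) V s t =
   (2 * q)%:E * J q + 2%:E * \int[mu]_(t in `]q, h]) W t)%E.
Proof.
have W0 t : (0 <= W t)%E by exact: integral_ge0.
rewrite (ge0_integral_itv_split mW W0 q0 qh).
pose W1 t := (\int[mu]_(s in `]0%R, q]) V s t)%E.
pose W2 t := (\int[mu]_(s in `]q, h]) V s t)%E.
have mWi a b : measurable_fun setT (fun t => \int[mu]_(s in `]a, b]) V s t)%E.
  by apply: (@measurable_ge0_integral _ (fun t s => V s t)); [exact: mVC|move=> *|].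
have -> : (\int[mu]_(t in `]0%R, q]) W t =
    \int[mu]_(t in `]0%R, q]) W1 t + \int[mu]_(t in `]0%R, q]) W2 t)%E.
  rewrite -ge0_integralD//.
  - apply: eq_integral => t _.
    exact: (ge0_integral_itv_split (mV1 t) (fun s => V0 s t) q0 qh).
  - by move=> t _; exact: integral_ge0.
  - by apply: measurable_funTS; exact: mWi.
  - by move=> t _; exact: integral_ge0.
  - by apply: measurable_funTS; exact: mWi.
have -> : (\int[mu]_(t in `]0%R, q]) W2 t = \int[mu]_(t in `]q, h]) W t)%E.
  have mI (i : interval R) : measurable ([set` i] : set R) by exact: measurable_itv.
  transitivity (\int[mu]_(s in `]q, h]) \int[mu]_(t in `]0%R, q]) V s t)%E.
    exact: (@ge0_integral_swap _ (fun t s => V s t) _ _ mVC (fun t s => V0 s t) (mI _) (mI _)).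
  apply: eq_integral => s; rewrite inE/= in_itv/= => /andP[qs sh].
  rewrite /W (ge0_integral_itv_split (mV1 s) (fun t => V0 t s) q0 qh).
  rewrite [X in (_ + X)%E]integral0_eq ?adde0.
    by apply: eq_integral => t _; rewrite VC.
  move=> t /=; rewrite in_itv/= => /andP[qt th].
  by apply: V_qq; apply/andP; split => //; exact: ltW.
have -> : (\int[mu]_(t in `]0%R, q]) W1 t = (2 * q)%:E * J q)%E.
  rewrite [LHS](_ : _ = \int[mu]_(t in `]0%R, q])
      (J q + q%:E * (ln (sin q) - ln (sin t))%:E))%E; last first.
    by apply: eq_integral => t; rewrite inE/= in_itv/=; exact: near_near.
  have c0 t : `]0, q]%classic t -> (0 <= (ln (sin q) - ln (sin t))%:E)%E.
    rewrite /= in_itv/= => /andP[s0 sq].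
    rewrite lee_fin subr_ge0 ler_ln ?posrE; [|by apply: sin_gt0h; rewrite s0 (le_trans sq)|].
      by apply: sin_le => //; exact: ltW.
    by apply: sin_gt0h; rewrite qh divr_gt0.
  have mc : measurable_fun `]0, q]%classic (fun t : R => (ln (sin q) - ln (sin t))%:E).
    apply/measurable_EFinP; apply: measurable_funTS; apply: measurable_funB => //.
    by apply: measurableT_comp; [exact: measurable_ln|exact: measurable_sin].
  rewrite ge0_integralD//; last 2 first.
  - by move=> t tq; rewrite mule_ge0 ?lee_fin// -lee_fin c0.
  - exact: measurable_funeM.
  rewrite ge0_integralZl// integral_cst//= lebesgue_measure_itv/= lte_fin divr_gt0//.
  rewrite oppr0 addr0 -/(J q) muleC -ge0_muleDl ?lee_fin// -EFinD.
  by congr (_%:E * _)%E; ring.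
have I0 : (0 <= \int[mu]_(t in `]q, h]) W t)%E by exact: integral_ge0.
rewrite -addeA; congr (_ + _)%E.
by rewrite (_ : 2%:E = 1%:E + 1%:E)%E// ge0_muleDl// !mul1e.
Qed.

Let sin_far t : q <= t <= h -> 0 < sin t.
Proof. by move=> /andP[qt th]; apply: sin_gt0h; apply/andP; split; move: p0; lra. Qed.

Let measurable_oddsum_csc a N :
  measurable_fun `]q, h]%classic (fun t => (oddsum (over_odd a) N (4 * sin t)^-1)%:E).
Proof.
apply/measurable_EFinP; apply: subspace_continuous_measurable_fun => //.
apply: continuous_in_subspaceT => t; rewrite inE/= in_itv/= => /andP[qt th].
by apply: cont_oddsum_csc; apply: sin_far; rewrite th ltW.
Qed.

Let oddsum_csc_ge0 a N t : (forall j, 0 <= a j) -> `]q, h]%classic t ->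
  (0 <= (oddsum (over_odd (over_odd a)) N (4 * sin t)^-1)%:E)%E.
Proof.
move=> a0; rewrite /= in_itv/= => /andP[qt th]; rewrite lee_fin sumr_ge0// => i _.
rewrite mulr_ge0//; first by rewrite divr_ge0// divr_ge0.
by rewrite exprn_ge0// invr_ge0 mulr_ge0// ltW// sin_far// th ltW.
Qed.

Let binc_ge0 j : 0 <= binc R j. Proof. exact/ltW/binc_gt0. Qed.

Lemma integral_quarter_lower m :
  ((2 * q)%:E * (oddsum (over_odd (over_odd (binc R))) m.+1 2^-1)%:E + 2%:E *
   \int[mu]_(t in `]q, h]) (oddsum (over_odd (over_odd (binc R))) m.+1 (4 * sin t)^-1)%:E
   <= \int[mu]_(t in `]0%R, h]) \int[mu]_(s in `]0%R, h]) V s t)%E.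
Proof.
rewrite integral_quarter_split; apply: leeD.
  apply: lee_wpmul2l; first by rewrite lee_fin mulr_ge0.
  by rewrite -sin_pi6; apply: int_ln_sin_lower; rewrite lexx divr_gt0.
apply: lee_wpmul2l; first by [].
apply: ge0_le_integral.
- by [].
- by move=> t; exact: oddsum_csc_ge0.
- exact: measurable_oddsum_csc.
- exact: measurable_funTS.
- move=> t /=; rewrite in_itv/= => /andP[qt th].
  have [|b b6 [<- ->]] := @W_far t; first by rewrite th ltW.
  exact: int_ln_sin_lower.
Qed.

Lemma integral_quarter_upper m :
  (\int[mu]_(t in `]0%R, h]) \int[mu]_(s in `]0%R, h]) V s t <=
   (2 * q)%:E * (oddsum (over_odd (over_odd (binc_up R m.+1))) m.+2 2^-1)%:E + 2%:E *
   \int[mu]_(t in `]q, h])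
     (oddsum (over_odd (over_odd (binc_up R m.+1))) m.+2 (4 * sin t)^-1)%:E)%E.
Proof.
rewrite integral_quarter_split; apply: leeD.
  apply: lee_wpmul2l; first by rewrite lee_fin mulr_ge0.
  by rewrite -sin_pi6; apply: int_ln_sin_upper; rewrite lexx divr_gt0.
apply: lee_wpmul2l; first by [].
apply: ge0_le_integral.
- by [].
- by move=> t _; exact: integral_ge0.
- exact: measurable_funTS.
- exact: measurable_oddsum_csc.
- move=> t /=; rewrite in_itv/= => /andP[qt th].
  have [|b b6 [<- ->]] := @W_far t; first by rewrite th ltW.
  exact: int_ln_sin_upper.
Qed.

End quarter_plane.

(** * Integrals of odd powers of the cosecant *)

Section cosecant.
Variable R : realType.
Local Notation mu := (@lebesgue_measure R).

(** The classical reduction formula; the base case is log tan (t/2). The constants are such that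
    every primitive vanishes at pi/2. *)
Fixpoint csc_prim j (t : R) : R :=
  if j is i.+1
  then ((2 * i).+1%:R * csc_prim i t - cos t * (sin t ^+ (2 * i).+2)^-1) / (2 * i).+2%:R
  else (ln (1 - cos t) - ln (1 + cos t)) / 2.

Lemma der_csc_prim j (t : R) : 0 < sin t ->
  is_derive t 1 (csc_prim j) ((sin t)^-1 ^+ (2 * j).+1).
Proof.
move=> s0; have s0' : sin t != 0 by rewrite gt_eqF.
elim: j => [|j IH].
  have c2 := cos2Dsin2 t.
  have c1 : 0 < 1 - cos t.
    rewrite subr_gt0 lt_neqAle cos_le1 andbT; apply: contraTneq s0 => ct.
    move: c2; rewrite ct expr1n => /eqP; rewrite -subr_eq0 addrAC subrr add0r sqrf_eq0.
    by move/eqP => ->; rewrite ltxx.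
  have c1' : 0 < 1 + cos t.
    rewrite -[cos t]opprK subr_gt0 lt_neqAle lerNl cos_geN1 andbT.
    apply: contraTneq s0 => ct; move: c2; rewrite -[cos t]opprK ct sqrrN expr1n => /eqP.
    by rewrite -subr_eq0 addrAC subrr add0r sqrf_eq0 => /eqP ->; rewrite ltxx.
  apply: der_eq (derM (derB
    (der_comp (derB (der_cst 1 t) (is_derive_cos t)) (is_derive1_ln c1))
    (der_comp (derD (der_cst 1 t) (is_derive_cos t)) (is_derive1_ln c1')))
    (der_cst 2^-1 t)) _.
  have h2 : sin t ^+ 2 = (1 - cos t) * (1 + cos t).
    by apply: (addrI (cos t ^+ 2)); rewrite c2; ring.
  rewrite muln0 expr1 mulr0 addr0.
  transitivity (sin t * (sin t ^+ 2)^-1); last by field.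
  by rewrite h2; field; rewrite !gt_eqF.
have n0 : sin t ^+ (2 * j).+2 != 0 by rewrite expf_neq0.
apply: der_eq (derM (derB (derZ (2 * j).+1%:R IH)
  (derM (is_derive_cos t)
     (@derV R (fun t : R => sin t ^+ (2 * j).+2) t _ n0 (derX (2 * j).+2 (is_derive_sin t)))))
  (der_cst (2 * j).+2%:R^-1 t)) _.
have cs : cos t * cos t = 1 - sin t * sin t.
  by have := cos2Dsin2 t; rewrite !expr2 => <-; ring.
have -> : (2 * j.+1 = (2 * j).+2)%N by lia.
rewrite mulr0 addr0 /= !exprVn !exprS -!natr1 ?expr0 ?mulr1.
have : sin t ^+ (2 * j) != 0 by rewrite expf_neq0.
have : 0 <= (2 * j)%:R :> R by [].
move: (2 * j)%:R (sin t ^+ _) => n y n_ge y0.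
move: (csc_prim j t) (sin t) (cos t) s0' cs => f u c u0 cs.
(* The cosine is isolated in a single square, which is then replaced by 1 - sin^2. *)
rewrite [LHS](_ : _ = (n + 1) / (n + 1 + 1) / (u * y) + u / (n + 1 + 1) / (u * (u * y)) +
  (c * c) / (u * (u * (u * y)))); last first.
  field; rewrite u0 y0 gt_eqF//; lra.
rewrite cs; field; rewrite u0 y0 gt_eqF//; lra.
Qed.

Let prim (a : nat -> R) N (t : R) := \sum_(j < N) a j * 4^-1 ^+ (2 * j).+1 * csc_prim j t.

Let der_prim a N (t : R) : 0 < sin t -> is_derive t 1 (prim a N) (oddsum a N (4 * sin t)^-1).
Proof.
move=> t0; elim: N => [|N IH].
  rewrite /oddsum big_ord0 (_ : prim _ _ = fun=> 0); first exact: der_cst.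
  by apply/funext => y; rewrite /prim big_ord0.
rewrite (_ : prim a N.+1 =
    fun y => prim a N y + a N * 4^-1 ^+ (2 * N).+1 * csc_prim N y).
  apply: der_eq (derD IH (derZ _ (der_csc_prim N t0))) _.
  by rewrite /oddsum big_ord_recr/= -mulrA -exprMn invfM.
by apply/funext => y; rewrite /prim big_ord_recr.
Qed.

Lemma integral_oddsum_csc a N :
  (\int[mu]_(t in `](pi / 6)%R, (pi / 2)%R]) (oddsum (over_odd a) N (4 * sin t)^-1)%:E =
   (\sum_(j < N) over_odd a j * 4^-1 ^+ (2 * j).+1 * - csc_prim j (pi / 6))%:E)%E.
Proof.
have p0 := pi_gt0 R.
have s0 (t : R) : pi / 6 <= t <= pi / 2 -> 0 < sin t.
  by move=> /andP[t6 t2]; apply: sin_gt0_pi; apply/andP; split; lra.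
have c0 (t : R) : pi / 6 <= t <= pi / 2 ->
    {for t, continuous (fun t => oddsum (over_odd a) N (4 * sin t)^-1)}.
  move=> /s0 t0; exact: cont_oddsum_csc.
have end0 : prim (over_odd a) N (pi / 2) = 0.
  rewrite /prim big1// => j _; rewrite (_ : csc_prim j _ = 0) ?mulr0//.
  elim: {j}(j : nat) => [|j IH] /=; first by rewrite cos_pihalf subr0 addr0 subrr mul0r.
  by rewrite IH cos_pihalf mulr0 mul0r subr0 mul0r.
rewrite integral_itv_obnd_cbnd; last first.
  apply/measurable_EFinP; apply: subspace_continuous_measurable_fun => //.
  apply: continuous_in_subspaceT => t; rewrite inE/= in_itv/= => /andP[qt th].
  by apply: c0; rewrite th ltW.
rewrite (@FTC_is_derive R (prim (over_odd a) N) (fun t => oddsum (over_odd a) N (4 * sin t)^-1)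
  (pi / 6) (pi / 2) _ (fun t h => der_prim (over_odd a) N (s0 t h)) c0); last by lra.
congr _%:E; rewrite end0 sub0r /prim -sumrN.
by apply: eq_bigr => j _; rewrite mulrN.
Qed.

End cosecant.

(** * Two-sided bounds for artanh *)

Section artanh.
Variable R : realType.
Implicit Types x y : R.

Definition artanh x : R := (ln (1 + x) - ln (1 - x)) / 2.

Let der_artanh x : -1 < x < 1 -> is_derive x 1 artanh (1 - x ^+ 2)^-1.
Proof.
move=> /andP[x1 x2].
have h1 : 0 < 1 + x by lra.
have h2 : 0 < 1 - x by lra.
apply: der_eq (derM (derB
  (der_comp (derD (der_cst 1 x) (der_id x)) (is_derive1_ln h1))
  (der_comp (derB (der_cst 1 x) (der_id x)) (is_derive1_ln h2)))
  (der_cst 2^-1 x)) _.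
have -> : 1 - x ^+ 2 = (1 + x) * (1 - x) by ring.
by field; rewrite !gt_eqF.
Qed.

Let geo N x : x ^+ 2 < 1 ->
  (1 - x ^+ 2)^-1 - evensum (fun=> 1) N x = x ^+ (2 * N) / (1 - x ^+ 2).
Proof.
move=> x1; have x0 : 1 - x ^+ 2 != 0 by rewrite gt_eqF// subr_gt0.
elim: N => [|N IH]; first by rewrite /evensum big_ord0 muln0 expr0 subr0 mul1r.
rewrite evensumS mul1r opprD addrA IH (_ : (2 * N.+1 = 2 * N + 2)%N); last by lia.
by rewrite exprD; field.
Qed.

Let sqr_lt1 x : 0 <= x -> x < 1 -> x ^+ 2 < 1.
Proof. by move=> x0 x1; rewrite expr_lt1. Qed.

Let artanh0 : artanh 0 = 0.
Proof. by rewrite /artanh addr0 subr0 subrr mul0r. Qed.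

Let oddsum0 a N : oddsum a N (0 : R) = 0.
Proof. by rewrite /oddsum big1// => i _; rewrite expr0n mulr0. Qed.

Lemma artanh_lower N x : 0 <= x < 1 -> oddsum (over_odd (fun=> 1)) N x <= artanh x.
Proof.
move=> /andP[x0 x1].
have d (y : R) : 0 <= y <= x -> is_derive y 1
    (fun y => artanh y - oddsum (over_odd (fun=> 1)) N y) (y ^+ (2 * N) / (1 - y ^+ 2)).
  move=> /andP[y0 yx]; have y1 := le_lt_trans yx x1.
  have y11 : -1 < y < 1 by apply/andP; split; lra.
  by apply: der_eq (derB (der_artanh y11) (der_oddsum (fun=> 1) N y)) _; rewrite geo// sqr_lt1.
rewrite -subr_ge0 -[leLHS](_ : artanh 0 - oddsum (over_odd (fun=> 1)) N 0 = 0); last first.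
  by rewrite artanh0 oddsum0 subr0.
apply: (@is_derive_ge0_le R (fun y => artanh y - oddsum (over_odd (fun=> 1)) N y)
  (fun y => y ^+ (2 * N) / (1 - y ^+ 2)) 0 x x0).
- by move=> y /andP[y0 yx]; apply: d; rewrite !ltW.
- by move=> y yx; exact: is_derive_continuous (d _ yx).
- move=> y /andP[y0 yx]; rewrite divr_ge0 ?exprn_ge0 ?(ltW y0)// subr_ge0 ltW//.
  by apply: sqr_lt1; lra.
Qed.

(** On [0, x] the geometric tail y^(2N) / (1 - y^2) is at most y^(2N) / (1 - x^2), whose integral is
    the correction term. *)
Lemma artanh_upper N x : 0 <= x < 1 -> artanh x <=
  oddsum (over_odd (fun=> 1)) N x + x ^+ (2 * N).+1 / (2 * N).+1%:R / (1 - x ^+ 2).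
Proof.
move=> /andP[x0 x1]; have x2 := sqr_lt1 x0 x1.
pose k := (2 * N).+1%:R^-1 / (1 - x ^+ 2).
have -> : x ^+ (2 * N).+1 / (2 * N).+1%:R / (1 - x ^+ 2) = k * x ^+ (2 * N).+1.
  by rewrite /k; ring.
have d (y : R) : 0 <= y <= x -> is_derive y 1
    (fun y => oddsum (over_odd (fun=> 1)) N y + k * y ^+ (2 * N).+1 - artanh y)
    (y ^+ (2 * N) / (1 - x ^+ 2) - y ^+ (2 * N) / (1 - y ^+ 2)).
  move=> /andP[y0 yx]; have y1 := le_lt_trans yx x1.
  have y11 : -1 < y < 1 by apply/andP; split; lra.
  apply: der_eq (derB (derD (der_oddsum (fun=> 1) N y)
    (derZ k (derX (2 * N).+1 (der_id y)))) (der_artanh y11)) _.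
  rewrite -(geo N (sqr_lt1 y0 y1)) /k /= mulr1.
  have nx : 1 - x ^+ 2 != 0 by rewrite gt_eqF// subr_gt0.
  have ny : 1 - y ^+ 2 != 0 by rewrite gt_eqF// subr_gt0 sqr_lt1.
  have nN : (2 * N).+1%:R != 0 :> R by rewrite pnatr_eq0.
  move: (evensum _ _ _) ((2 * N).+1%:R) nN => e n nN; field.
  by rewrite nx ny nN.
rewrite -subr_ge0 -[leLHS](_ : oddsum (over_odd (fun=> 1)) N 0 + k * 0 ^+ (2 * N).+1
    - artanh 0 = 0); last by rewrite artanh0 oddsum0 expr0n mulr0 subr0 addr0.
apply: (@is_derive_ge0_le R
  (fun y => oddsum (over_odd (fun=> 1)) N y + k * y ^+ (2 * N).+1 - artanh y)
  (fun y => y ^+ (2 * N) / (1 - x ^+ 2) - y ^+ (2 * N) / (1 - y ^+ 2)) 0 x x0).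
- by move=> y /andP[y0 yx]; apply: d; rewrite !ltW.
- by move=> y yx; exact: is_derive_continuous (d _ yx).
- move=> y /andP[y0 yx]; rewrite -mulrBr mulr_ge0 ?exprn_ge0 ?(ltW y0)// subr_ge0.
  have y2 : y ^+ 2 <= x ^+ 2 by rewrite lerXn2r ?nnegrE// ltW.
  by rewrite lef_pV2 ?posrE; lra.
Qed.

(** Serves to shrink the argument before the series is used. *)
Lemma artanh_double x : 0 <= x < 1 -> artanh (2 * x / (1 + x ^+ 2)) = 2 * artanh x.
Proof.
move=> /andP[x0 x1]; have d0 : 0 < 1 + x ^+ 2 by rewrite ltr_pwDl// sqr_ge0.
have -> : artanh (2 * x / (1 + x ^+ 2)) =
    (ln ((1 + x) ^+ 2 / (1 + x ^+ 2)) - ln ((1 - x) ^+ 2 / (1 + x ^+ 2))) / 2.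
  by rewrite /artanh; congr ((ln _ - ln _) / 2); field; rewrite gt_eqF.
have p1 : 0 < 1 + x by lra.
have p2 : 0 < 1 - x by lra.
rewrite !ln_div ?posrE ?exprn_gt0// !lnXn// /artanh [_ *+ 2]mulr2n [ln (1 - x) *+ 2]mulr2n.
by move: (ln (1 + x)) (ln (1 - x)) (ln (1 + x ^+ 2)) => a b e; field.
Qed.

End artanh.

(** * Decimal bounds *)

Section numerics.
Variable R : realType.
Local Notation mu := (@lebesgue_measure R).
Local Notation c := (cos (pi / 6 : R)).

Let c_bounds : 866 / 10 ^+ 3 + 25 / 10 ^+ 6 + 403 / 10 ^+ 9 <= c <=
   866 / 10 ^+ 3 + 25 / 10 ^+ 6 + 404 / 10 ^+ 9.
Proof.
have p0 := pi_gt0 R.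
have c0 : 0 <= c by apply: cos_ge0_pihalf; apply/andP; split; lra.
have := cos2Dsin2 (pi / 6 : R); rewrite sin_pi6; move: c c0 => x x0 x2.
apply/andP; split; rewrite leNgt; apply/negP => h; nra.
Qed.

Let c2 : c ^+ 2 = 3 / 4.
Proof. by have := cos2Dsin2 (pi / 6 : R); rewrite sin_pi6; lra. Qed.

(** The integral of sin^(-2j-1) over [pi/6, pi/2], since the primitive vanishes at pi/2. *)
Let I j : R := - csc_prim j (pi / 6).

(** I 0 is artanh c with c^2 = 3/4. Doubling passes to 2c/3 = 1/sqrt 3, which improves the ratio of
    the series from 3/4 to 1/3. *)
Let I0E : I 0 = 2 * artanh (2 * c / 3).
Proof.
have /andP[c_lo c_hi] := c_bounds.
rewrite -artanh_double; last by apply/andP; split; lra.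
have -> : 2 * (2 * c / 3) / (1 + (2 * c / 3) ^+ 2) = c.
  by rewrite (_ : 1 + _ = 4 / 3); [field|rewrite !exprMn c2; lra].
by rewrite /I /artanh /= -mulNr opprB.
Qed.

Let I0_bounds : 1 + 316 / 10 ^+ 3 + 957 / 10 ^+ 6 + 486 / 10 ^+ 9 <= I 0 <=
  1 + 316 / 10 ^+ 3 + 957 / 10 ^+ 6 + 914 / 10 ^+ 9.
Proof.
have /andP[c_lo c_hi] := c_bounds.
have x01 : 0 <= 2 * c / 3 < 1 by apply/andP; split; lra.
have := artanh_upper 11 x01; have := artanh_lower 11 x01; rewrite -/(I 0) I0E.
have pow j : (2 * c / 3) ^+ (2 * j).+1 = 2 * c / 3 * 3^-1 ^+ j.
  rewrite exprS exprM; congr (_ * _ ^+ _).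
  by rewrite !exprMn c2; lra.
have -> : (1 - (2 * c / 3) ^+ 2)^-1 = 3 / 2.
  by rewrite (_ : 1 - _ = 2 / 3); [field|rewrite !exprMn c2; lra].
rewrite /oddsum !big_ord_recr big_ord0 /= !pow /over_odd !mul2n !(doubleS, double0).
by move=> lo hi; apply/andP; split; lra.
Qed.

(** The reduction formula at pi/6, where sin = 1/2 makes the boundary term cos (pi/6) 4^(j+1). *)
Let IS j : I j.+1 = ((2 * j).+1%:R * I j + c * 4 ^+ j.+1) / (2 * j).+2%:R.
Proof.
have <- : (2^-1 ^+ (2 * j).+2)^-1 = 4 ^+ j.+1 :> R.
  rewrite (_ : (2 * j).+2 = 2 * j.+1)%N; last by lia.
  by rewrite exprM -exprVn (_ : (2^-1 ^+ 2)^-1 = 4)//; field.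
by rewrite /I /= sin_pi6; ring.
Qed.

(** S estimates the factor [J q] of the near square, Q the far integral. Plain coefficients give
    lower bounds, inflated ones upper bounds. *)
Let S a N : R := oddsum (over_odd (over_odd a)) N 2^-1.
Let Q a N : R := \sum_(j < N) over_odd (over_odd a) j * 4^-1 ^+ (2 * j).+1 * I j.

Let S_lower : 507 / 10 ^+ 3 + 469 / 10 ^+ 6 + 612 / 10 ^+ 9 <= S (binc R) 5.
Proof.
rewrite /S /oddsum !big_ord_recr big_ord0 /= /over_odd /= !mul2n !(doubleS, double0).
lra.
Qed.

Let S_upper : S (binc_up R 7) 8 <= 507 / 10 ^+ 3 + 470 / 10 ^+ 6 + 808 / 10 ^+ 9.
Proof.
rewrite /S /oddsum !big_ord_recr big_ord0 /= /over_odd /binc_up /= !mul2n !(doubleS, double0).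
rewrite (_ : 8 * 7 = 56)%N // (_ : 6 * 7 - 1 = 41)%N //; lra.
Qed.

Let Q_lower : 331 / 10 ^+ 3 + 397 / 10 ^+ 6 + 302 / 10 ^+ 9 <= Q (binc R) 5.
Proof.
have /andP[c_lo c_hi] := c_bounds; have /andP[I_lo I_hi] := I0_bounds.
rewrite /Q !big_ord_recr big_ord0 /= /over_odd /= !IS !mul2n !(doubleS, double0).
lra.
Qed.

Let Q_upper : Q (binc_up R 7) 8 <= 331 / 10 ^+ 3 + 397 / 10 ^+ 6 + 480 / 10 ^+ 9.
Proof.
have /andP[c_lo c_hi] := c_bounds; have /andP[I_lo I_hi] := I0_bounds.
rewrite /Q !big_ord_recr big_ord0 /= /over_odd /binc_up /= !IS !mul2n !(doubleS, double0).
rewrite (_ : 8 * 7 = 56)%N // (_ : 6 * 7 - 1 = 41)%N //; lra.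
Qed.

(** The arcsine bounds at s = pi/6, sin s = 1/2, read as bounds on pi. *)
Let pi_lower : 3 + 141 / 10 ^+ 3 + 592 / 10 ^+ 6 + 622 / 10 ^+ 9 <= pi :> R.
Proof.
have p0 := pi_gt0 R.
have := @arcsine_lower R 9 (pi / 6); rewrite lexx divr_ge0 ?(ltW p0)// sin_pi6 => /(_ isT).
rewrite /oddsum !big_ord_recr big_ord0 /= /over_odd /= !mul2n !(doubleS, double0).
lra.
Qed.

Let pi_upper : pi <= 3 + 141 / 10 ^+ 3 + 592 / 10 ^+ 6 + 918 / 10 ^+ 9 :> R.
Proof.
have p0 := pi_gt0 R.
have := @arcsine_upper R 6 (pi / 6); rewrite lexx divr_ge0 ?(ltW p0)// sin_pi6 => /(_ isT).
rewrite /oddsum !big_ord_recr big_ord0 /= /over_odd /binc_up /= !mul2n !(doubleS, double0).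
rewrite (_ : 8 * 7 = 56)%N // (_ : 6 * 7 - 1 = 41)%N //; lra.
Qed.

Let Cstar_lower : (2 / pi) ^+ 2 * (pi / 3 * S (binc R) 5 + 2 * Q (binc R) 5) <= Cstar R.
Proof.
rewrite -lee_fin Cstar_quarter [X in (X <= _)%E]EFinM.
apply: lee_wpmul2l; first by rewrite lee_fin sqr_ge0.
apply: le_trans (integral_quarter_lower R 4).
rewrite integral_oddsum_csc -/(Q (binc R) 5) -/(S (binc R) 5) -!EFinM -EFinD lee_fin.
by rewrite (_ : 2 * (pi / 6) = pi / 3)//; field.
Qed.

Let Cstar_upper : Cstar R <=
  (2 / pi) ^+ 2 * (pi / 3 * S (binc_up R 7) 8 + 2 * Q (binc_up R 7) 8).
Proof.
rewrite -lee_fin Cstar_quarter [X in (_ <= X)%E]EFinM.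
apply: lee_wpmul2l; first by rewrite lee_fin sqr_ge0.
apply: le_trans (integral_quarter_upper R 6) _.
rewrite integral_oddsum_csc -/(Q (binc_up R 7) 8) -/(S (binc_up R 7) 8) -!EFinM -EFinD lee_fin.
by rewrite (_ : 2 * (pi / 6) = pi / 3)//; field.
Qed.

Lemma Cstar_bounds :
  483 / 10 ^+ 3 + 997 / 10 ^+ 6 <= Cstar R < 483 / 10 ^+ 3 + 998 / 10 ^+ 6.
Proof.
have p0 := pi_gt0 R; have := pi_lower; have := pi_upper.
have := S_lower; have := S_upper; have := Q_lower; have := Q_upper.
(* Multiplication by pi^2 clears the denominators, so that only polynomial inequalities in the
   bounded quantities remain. *)
have sqE (x y : R) : (2 / pi) ^+ 2 * (pi / 3 * x + 2 * y) * pi ^+ 2 = 4 / 3 * x * pi + 8 * y.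
  by move: (pi : R) p0 => p p0; field; rewrite gt_eqF.
have lo := Cstar_lower; rewrite -(ler_pM2r (exprn_gt0 2 p0)) sqE in lo.
have hi := Cstar_upper; rewrite -(ler_pM2r (exprn_gt0 2 p0)) sqE in hi.
move: (pi : R) (Cstar R) (S _ _) (S _ _) (Q _ _) (Q _ _) p0 lo hi
  => p C s8 s5 q8 q5 p0 lo hi q8_hi q5_lo s8_hi s5_lo p_hi p_lo.
apply/andP; split.
  rewrite -(ler_pM2r (exprn_gt0 2 p0)); apply: le_trans lo.
  nra.
rewrite -(ltr_pM2r (exprn_gt0 2 p0)); apply: le_lt_trans hi _.
nra.
Qed.

End numerics.

(** * Laurent polynomials and their values *)

Section laurent_sums.
Variables (A : zmodType) (K : fieldType) (h : A -> K).
Hypothesis h0 : h 0 = 0.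
Implicit Types (P Q : laurent A) (u v : K).

Lemma laurent_eval_sub (S : {fset int * int}) P u v : (finsupp P `<=` S)%fset ->
  laurent_eval h P u v = \sum_(k <- S) h (P k) * u ^ k.1 * v ^ k.2.
Proof.
move=> PS; rewrite /laurent_eval; apply: big_fset_incl => // k kS kP.
by rewrite fsfun_dflt// h0 !mul0r.
Qed.

Lemma laurent_eval_map u v P :
  laurent_eval id (laurent_map h P) u v = laurent_eval h P u v.
Proof.
have sP : (finsupp (laurent_map h P) `<=` finsupp P)%fset.
  by apply/fsubsetP => k; rewrite mem_finsupp /laurent_map fsfunE; case: ifP; rewrite ?eqxx.
rewrite /laurent_eval -[RHS]/(\sum_(k <- finsupp P) _).
rewrite (big_fset_incl _ sP); last first.
  by move=> k kP /= kn; rewrite fsfun_dflt// !mul0r.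
by apply: eq_big_seq => k kP; rewrite /laurent_map fsfunE kP.
Qed.

End laurent_sums.

Section laurent_ring.
Local Notation lf := laurent_frac.

Lemma is_laurentD f g : is_laurent f -> is_laurent g -> is_laurent (f + g).
Proof.
move=> [P <-] [Q <-]; pose S := (finsupp P `|` finsupp Q)%fset.
exists [fsfun k in S => P k + Q k | 0]; rewrite /lf.
rewrite !(@laurent_eval_sub _ _ _ _ S) ?fsubsetUl ?fsubsetUr ?finsupp_sub//.
rewrite -big_split/=; apply: eq_big_seq => k kS.
by rewrite fsfunE kS rmorphD/= !mulrDl.
Qed.

Lemma is_laurent0 : is_laurent 0.
Proof. by exists [fsfun]; rewrite /lf /laurent_eval finsupp0 big_seq_fset0. Qed.

Lemma is_laurent_monomial (a i j : int) : is_laurent (a%:~R * X1 ^ i * X2 ^ j).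
Proof.
exists [fsfun k in [fset (i, j)]%fset => a | 0].
rewrite /lf (@laurent_eval_sub _ _ _ _ [fset (i, j)]%fset) ?finsupp_sub//.
by rewrite big_seq_fset1 fsfunE inE eqxx.
Qed.

Lemma X1_neq0 : X1 != 0. Proof. by rewrite tofrac_eq0 polyC_eq0 polyX_eq0. Qed.
Lemma X2_neq0 : X2 != 0. Proof. by rewrite tofrac_eq0 polyX_eq0. Qed.

Lemma is_laurentM f g : is_laurent f -> is_laurent g -> is_laurent (f * g).
Proof.
move=> [P <-] [Q <-]; rewrite /lf /laurent_eval mulr_suml.
apply: (big_ind is_laurent) => [||k _]; [exact: is_laurent0|exact: is_laurentD|].
rewrite mulr_sumr.
apply: (big_ind is_laurent) => [||l _]; [exact: is_laurent0|exact: is_laurentD|].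
rewrite (_ : _ * _ = (P k * Q l)%:~R * X1 ^ (k.1 + l.1) * X2 ^ (k.2 + l.2)).
  exact: is_laurent_monomial.
by rewrite (expfzDr _ _ X1_neq0) (expfzDr _ _ X2_neq0) rmorphM/=; ring.
Qed.

Lemma is_laurent_int (a : int) : is_laurent a%:~R.
Proof. by have := is_laurent_monomial a 0 0; rewrite !expr0z !mulr1. Qed.

Lemma is_laurentX1 : is_laurent X1.
Proof. by have := is_laurent_monomial 1 1 0; rewrite expr0z expr1z mulr1 mul1r. Qed.

Lemma is_laurentX2 : is_laurent X2.
Proof. by have := is_laurent_monomial 1 0 1; rewrite expr0z expr1z mulr1 mul1r. Qed.

Definition Kx : Qx := X1 / X2 + X2 / X1 + 1 / (X1 * X2).

Lemma is_laurentKx : is_laurent Kx.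
Proof.
have E i j : X1 ^ i * X2 ^ j = 1%:~R * X1 ^ i * X2 ^ j by rewrite mul1r.
rewrite /Kx div1r invfM -[X1 / X2]/(X1 ^ 1 * X2 ^ (-1)) -[X1^-1 * X2^-1]/(X1 ^ (-1) * X2 ^ (-1)).
rewrite [X2 / X1]mulrC -[X1^-1 * X2]/(X1 ^ (-1) * X2 ^ 1) !E.
by do ?apply: is_laurentD; exact: is_laurent_monomial.
Qed.

End laurent_ring.

(** * Values of elements of Q(x1, x2) with monomial denominators *)

Section evaluation.
Variables (L : fieldType) (u v : L).
Hypotheses (u0 : u != 0) (v0 : v != 0).

Let ev : {rmorphism {poly {poly int}} -> L} :=
  horner_eval v \o map_poly (horner_eval u \o map_poly (intr : int -> L)).

Let evX1 : ev 'X%:P = u.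
Proof. by rewrite /= map_polyC/= horner_evalE hornerC horner_evalE map_polyX hornerX. Qed.

Let evX2 : ev 'X = v.
Proof. by rewrite /= map_polyX horner_evalE hornerX. Qed.

Let tf : {rmorphism {poly {poly int}} -> Qx} := @tofrac {poly {poly int}}.

Let tfX1 : tf 'X%:P = X1. Proof. by []. Qed.

Let tfX2 : tf 'X = X2. Proof. by []. Qed.

(* The element f of Z[x1, x2]_(x1 x2) takes the value g at (u, v). *)
Definition evaluates (f : Qx) (g : L) := exists p : {poly {poly int}}, exists a b : nat,
  f * X1 ^+ a * X2 ^+ b = tf p /\ g * u ^+ a * v ^+ b = ev p.

(** Cross-multiplying by the monomials gives an identity of polynomials. Uniqueness of the value
    allows any expression of f to replace the Laurent polynomial selected by choice in [mahlerQ]. *)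
Lemma evaluates_fun f g g' : evaluates f g -> evaluates f g' -> g = g'.
Proof.
move=> [p [a [b [fp gp]]]] [p' [a' [b' [fp' gp']]]].
have e : p * 'X%:P ^+ a' * 'X ^+ b' = p' * 'X%:P ^+ a * 'X ^+ b.
  apply/eqP; rewrite -tofrac_eq -!/(tf _); apply/eqP.
  rewrite !(rmorphM tf) !(rmorphXn tf) tfX1 tfX2 -fp -fp'; ring.
have := congr1 ev e; rewrite !(rmorphM ev) !(rmorphXn ev) evX1 evX2 -gp -gp' => h.
have n0 : u ^+ (a + a') * v ^+ (b + b') != 0 by rewrite mulf_neq0// expf_neq0.
apply: (mulIf n0); rewrite !exprD.
transitivity (g * u ^+ a * v ^+ b * u ^+ a' * v ^+ b'); first by ring.
by rewrite h; ring.
Qed.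

Lemma evaluatesD f f' g g' : evaluates f g -> evaluates f' g' -> evaluates (f + f') (g + g').
Proof.
move=> [p [a [b [fp gp]]]] [p' [a' [b' [fp' gp']]]].
exists (p * 'X%:P ^+ a' * 'X ^+ b' + p' * 'X%:P ^+ a * 'X ^+ b), (a + a')%N, (b + b')%N.
rewrite (rmorphD tf) !(rmorphM tf) !(rmorphXn tf) tfX1 tfX2 -fp -fp'.
rewrite (rmorphD ev) !(rmorphM ev) !(rmorphXn ev) evX1 evX2 -gp -gp' !exprD; split; ring.
Qed.

Lemma evaluatesM f f' g g' : evaluates f g -> evaluates f' g' -> evaluates (f * f') (g * g').
Proof.
move=> [p [a [b [fp gp]]]] [p' [a' [b' [fp' gp']]]].
exists (p * p'), (a + a')%N, (b + b')%N.
rewrite (rmorphM tf) (rmorphM ev) -fp -fp' -gp -gp' !exprD; split; ring.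
Qed.

Lemma evaluates_int (a : int) : evaluates a%:~R a%:~R.
Proof. by exists a%:~R, 0%N, 0%N; rewrite !expr0 !mulr1 !rmorph_int. Qed.

Lemma evaluatesX1 : evaluates X1 u.
Proof. by exists 'X%:P, 0%N, 0%N; rewrite !expr0 !mulr1 evX1. Qed.

Lemma evaluatesX2 : evaluates X2 v.
Proof. by exists 'X, 0%N, 0%N; rewrite !expr0 !mulr1 evX2. Qed.

Lemma evaluatesX1V : evaluates X1^-1 u^-1.
Proof.
by exists 1, 1%N, 0%N; rewrite !expr0 !mulr1 (mulVf X1_neq0) (mulVf u0) (rmorph1 tf) (rmorph1 ev).
Qed.

Lemma evaluatesX2V : evaluates X2^-1 v^-1.
Proof.
by exists 1, 0%N, 1%N; rewrite !expr0 !mulr1 (mulVf X2_neq0) (mulVf v0) (rmorph1 tf) (rmorph1 ev).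
Qed.

Lemma evaluatesX f g n : evaluates f g -> evaluates (f ^+ n) (g ^+ n).
Proof.
move=> fg; elim: n => [|n IH]; first exact: (evaluates_int 1).
by rewrite !exprS; exact: evaluatesM.
Qed.

Lemma evaluatesB f f' g g' : evaluates f g -> evaluates f' g' -> evaluates (f - f') (g - g').
Proof.
move=> fg fg'; apply: evaluatesD => //; rewrite -mulN1r -[- g']mulN1r.
by apply: evaluatesM => //; exact: (evaluates_int (-1)).
Qed.

Lemma evaluatesK : evaluates Kx (u / v + v / u + 1 / (u * v)).
Proof.
rewrite /Kx !div1r !invfM.
by do ?apply: evaluatesD; apply: evaluatesM;
  (exact: evaluatesX1 || exact: evaluatesX2 || exact: evaluatesX1V || exact: evaluatesX2V).
Qed.

Lemma evaluates_laurent (P : laurent int) :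
  evaluates (laurent_frac P) (laurent_eval intr P u v).
Proof.
rewrite /laurent_frac /laurent_eval.
have evz f g : evaluates f g -> evaluates f^-1 g^-1 ->
    forall i : int, evaluates (f ^ i) (g ^ i).
  move=> fg fgV [n|n]; first exact: evaluatesX.
  by rewrite !NegzE -!exprnN -!exprVn; exact: evaluatesX.
apply: (big_ind2 evaluates) => [||k _]; [exact: (evaluates_int 0)|by move=> *; apply: evaluatesD|].
apply: evaluatesM; first apply: evaluatesM; first exact: evaluates_int.
- by apply: evz; [exact: evaluatesX1|exact: evaluatesX1V].
- by apply: evz; [exact: evaluatesX2|exact: evaluatesX2V].
Qed.

End evaluation.

(** Integrability is not assumed: an integral equal to -oo becomes 0 under [fine], which is still at
    most c since c >= 0. *)
Lemma Rintegral_le_cst d (T : measurableType d) (R : realType) (P : probability T R)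
    (F : T -> R) (c : R) :
  measurable_fun setT F -> 0 <= c -> (forall x, F x <= c) -> \int[P]_x F x <= c.
Proof.
move=> mF c0 Fc; rewrite /Rintegral.
have mE : measurable_fun setT (fun x => (F x)%:E) by exact/measurable_EFinP.
have pos : (\int[P]_x ((fun x => (F x)%:E)^\+ x) <= c%:E)%E.
  apply: (@le_trans _ _ (\int[P]_x c%:E)%E).
    apply: ge0_le_integral => //.
    - by apply: measurable_funepos.
    - by move=> x _; rewrite funeposE -EFin_max lee_fin ge_max Fc c0.
  by rewrite integral_cst//= probability_setT mule1.
have le : (\int[P]_x (F x)%:E <= c%:E)%E.
  rewrite integralE; apply: le_trans pos; rewrite -[leRHS]sube0.
  by apply: leeD => //; rewrite leeN2; exact: integral_ge0.
by move: le; case: integral => [r| |].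
Qed.

Section mahler_evaluation.
Variable R : realType.
Implicit Types (f : Qx) (g : R[i] -> R[i] -> R[i]).

Definition torus_values f g :=
  forall s t : R, evaluates (cis s) (cis t) f (g (cis s) (cis t)).

Lemma mahlerQE f g : is_laurent f -> torus_values f g ->
  mahlerQ R f = torus_integral (fun u v => ln (normc (g u v))).
Proof.
move=> fL fg; rewrite /mahlerQ; have := @xgetPex _ [fsfun] _ fL.
move: (xget _ _) => /= P Pf; rewrite /mahler /torus_integral; congr (_ * _).
apply: eq_Rintegral => x _; congr (ln (normc _)).
rewrite laurent_eval_map.
apply: (evaluates_fun (cis_neq0 x.1) (cis_neq0 x.2) _ (fg x.1 x.2)).
by rewrite -Pf; apply: evaluates_laurent; exact: cis_neq0.
Qed.

(** The data needed for m(f) <= n log 4. The base 4 is stable under the recurrence because |K| + 1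
    <= 4 on the torus. *)
Definition tame n f := exists2 g, torus_values f g &
  cmeasurable (fun x : R * R => g (cis x.1) (cis x.2)) /\
  forall s t : R, normc (g (cis s) (cis t)) <= 4 ^+ n.

Lemma tame_mahlerQ n f : is_laurent f -> tame n f -> mahlerQ R f <= n%:R * ln 4.
Proof.
move=> fL [g fg [mg g4]]; rewrite (mahlerQE fL fg).
have mlg := measurable_ln_normc mg.
rewrite (torus_integralE mlg).
have l4 : 0 <= ln 4 :> R by rewrite ln_ge0//; lra.
have nl4 : 0 <= n%:R * ln 4 :> R by rewrite mulr_ge0.
apply: Rintegral_le_cst => // x.
have [->|gx0] := eqVneq (g (cis x.1) (cis x.2)) 0; first by rewrite normc0 ln0.
have -> : n%:R * ln 4 = ln (4 ^+ n) :> R by rewrite lnXn// mulr_natl.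
by rewrite ler_ln ?posrE ?exprn_gt0// normc_gt0.
Qed.

Lemma tameS n f : tame n f -> tame n.+1 f.
Proof.
move=> [g fg [mg g4]]; exists g => //; split => // s t.
by apply: le_trans (g4 s t) _; rewrite ler_eXn2l//; lra.
Qed.

Lemma torus_values_Kx : torus_values Kx (@Kfun R).
Proof. by move=> s t; exact: evaluatesK (cis_neq0 s) (cis_neq0 t). Qed.

Lemma tame_step n f f' : tame n f -> tame n f' -> tame n.+1 (Kx * f' - f).
Proof.
move=> [g fg [mg g4]] [g' fg' [mg' g4']].
exists (fun u v => Kfun u v * g' u v - g u v).
  move=> s t; apply: evaluatesB; last exact: fg.
  by apply: evaluatesM; [exact: torus_values_Kx|exact: fg'].
split.
  apply: cmeasurableB => //; apply: cmeasurableM => //.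
  exact: cmeasurable_Kcis.
move=> s t; apply: le_trans (le_normcD _ _) _; rewrite normcN normcM exprS.
have k3 : normc (Kfun (cis s) (cis t)) <= 3 := @normc_Kcis R (s, t).
have := ler_pM (normc_ge0 _) (normc_ge0 _) k3 (g4' s t); have := g4 s t; lra.
Qed.

Lemma torus_values_yseq n : torus_values (yseq Kx X1 X2 n.+1)
  (fun u v => yseq (Kfun u v) u v n.+1).
Proof.
suff : torus_values (yseq Kx X1 X2 n.+1) (fun u v => yseq (Kfun u v) u v n.+1) /\
    torus_values (yseq Kx X1 X2 n.+2) (fun u v => yseq (Kfun u v) u v n.+2) by case.
elim: n => [|n [IH1 IH2]].
  by split => s t; [exact: evaluatesX1|exact: evaluatesX2].
split => // s t; rewrite !yseqSS; apply: evaluatesB; last exact: IH1.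
by apply: evaluatesM; [exact: torus_values_Kx|exact: IH2].
Qed.

End mahler_evaluation.

(** * Cluster variables *)

Section exchange_pairs.
Variable R : realType.
Implicit Types f h : Qx.

(* Positivity at (1, 1) passes from f and h to (h^2 + 1) / f, and it shows that these
   elements are nonzero. *)
Definition positive_at1 f := exists2 a : rat, 0 < a & evaluates (1 : rat) (1 : rat) f a.

Lemma positive_at1_neq0 f : positive_at1 f -> f != 0.
Proof.
move=> [a a0 fa]; apply: contraTneq a0 => f0; rewrite f0 in fa.
have := @evaluates_int _ (1 : rat) (1 : rat) 0 => e0.
by rewrite (evaluates_fun (oner_neq0 _) (oner_neq0 _) fa e0) ltxx.
Qed.

(** The invariant shared by consecutive x_n and by clusters. Its quadratic relation is the conserved
    quantity; it is symmetric in f and h, so mutation in either direction is covered by one step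
    lemma and a swap. *)
Definition exchange_pair n f h :=
  [/\ is_laurent f /\ is_laurent h, positive_at1 f, positive_at1 h,
      f ^+ 2 + h ^+ 2 + 1 = Kx * f * h & tame R n f /\ tame R n h].

Lemma exchange_pairC n f h : exchange_pair n f h -> exchange_pair n h f.
Proof.
by move=> [[lf lh] pf ph e [tf th]]; split => //; rewrite [h ^+ 2 + _]addrC e; ring.
Qed.

(** f and (h^2 + 1) / f are the two roots of X^2 - K h X + h^2 + 1, whose sum is K h. *)
Lemma exchange_pairE n f h : exchange_pair n f h -> (h ^+ 2 + 1) / f = Kx * h - f.
Proof.
move=> [_ /positive_at1_neq0 f0 _ e _]; apply: (mulIf f0); rewrite mulfVK//.
apply: (addrI (f ^+ 2)); rewrite addrA e; ring.
Qed.

Lemma exchange_pairS n f h : exchange_pair n f h ->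
  exchange_pair n.+1 h ((h ^+ 2 + 1) / f).
Proof.
move=> fh; have E := exchange_pairE fh; move: fh => [[lf lh] pf ph e [tf th]].
have f0 := positive_at1_neq0 pf.
split.
- split => //; rewrite E; apply: is_laurentD.
    by apply: is_laurentM => //; exact: is_laurentKx.
  by rewrite -mulN1r; apply: is_laurentM => //; exact: (is_laurent_int (-1)).
- by [].
- move: pf ph => [a a0 fa] [b b0 hb].
  exists ((b ^+ 2 + 1) / a).
    by rewrite divr_gt0// ltr_wpDl// sqr_ge0.
  have v : evaluates (1 : rat) (1 : rat) (Kx * h - f) (3 * b - a).
    apply: evaluatesB => //; apply: evaluatesM => //.
    have -> : 3 = 1 / 1 + 1 / 1 + 1 / (1 * 1) :> rat by [].
    exact: evaluatesK (oner_neq0 rat) (oner_neq0 rat).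
  (* The value 3b - a of the linear form is not visibly positive. Uniqueness of values identifies it
     with the quotient (b^2 + 1) / a, which is. *)
  rewrite E (_ : (b ^+ 2 + 1) / a = 3 * b - a)//.
  apply: (mulIf (lt0r_neq0 a0)); rewrite mulfVK ?lt0r_neq0//.
  apply: (evaluates_fun (oner_neq0 rat) (oner_neq0 rat) (f := h ^+ 2 + 1)).
    apply: evaluatesD; first exact: evaluatesX.
    exact: (evaluates_int _ _ 1).
  rewrite -[h ^+ 2 + 1](divfK f0) E; exact: evaluatesM.
- rewrite E -[LHS]/(h ^+ 2 + (Kx * h - f) ^+ 2 + 1).
  have -> : h ^+ 2 + (Kx * h - f) ^+ 2 + 1 =
    (f ^+ 2 + h ^+ 2 + 1) - 2 * (Kx * f * h) + (Kx * h) ^+ 2 by ring.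
  by rewrite e; ring.
- by rewrite E; split; [exact: tameS|exact: tame_step].
Qed.

Lemma exchange_pair0 : exchange_pair 0 X1 X2.
Proof.
split.
- by split; [exact: is_laurentX1|exact: is_laurentX2].
- by exists 1 => //; exact: evaluatesX1.
- by exists 1 => //; exact: evaluatesX2.
- have gen (F : fieldType) (x y : F) : x != 0 -> y != 0 ->
      x ^+ 2 + y ^+ 2 + 1 = (x / y + y / x + 1 / (x * y)) * x * y.
    by move=> x0 y0; field; rewrite x0 y0.
  exact: gen X1_neq0 X2_neq0.
- split; [exists (fun u _ => u)|exists (fun _ v => v)].
  + by move=> s t; exact: evaluatesX1.
  + by split; [exact: cmeasurable_cis|move=> s t; rewrite cis_norm expr0].
  + by move=> s t; exact: evaluatesX2.
  + by split; [exact: cmeasurable_cis|move=> s t; rewrite cis_norm expr0].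
Qed.

Lemma iter_phi n : iter n phi (X1, X2) = (xseq n.+1, xseq n.+2).
Proof. by rewrite /xseq/=; case: (iter n phi _). Qed.

Lemma exchange_pair_xseq n : exchange_pair n (xseq n.+1) (xseq n.+2).
Proof.
elim: n => [|n IH]; first exact: exchange_pair0.
have -> : xseq n.+3 = (xseq n.+2 ^+ 2 + 1) / xseq n.+1.
  by rewrite {1}/xseq -[n.+3.-1]/(n.+2) iterS iter_phi.
exact: exchange_pairS.
Qed.

Lemma xseqSS n : xseq n.+3 = (xseq n.+2 ^+ 2 + 1) / xseq n.+1.
Proof. by rewrite {1}/xseq -[n.+3.-1]/(n.+2) iterS iter_phi. Qed.

Lemma xseq_yseq n : xseq n.+1 = yseq Kx X1 X2 n.+1.
Proof.
suff [] : xseq n.+1 = yseq Kx X1 X2 n.+1 /\ xseq n.+2 = yseq Kx X1 X2 n.+2 by [].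
elim: n => [//|n [IH1 IH2]]; split => //.
by rewrite xseqSS (exchange_pairE (exchange_pair_xseq n)) yseqSS IH1 IH2.
Qed.

Section seeds.
Local Notation i0 := (ord0 : 'I_2).
Local Notation i1 := (ord_max : 'I_2).

Lemma ord2 (i : 'I_2) : i = i0 \/ i = i1.
Proof.
by case: i => -[|[|//]] lt; [left|right]; apply: val_inj.
Qed.

Lemma mutate_exchange2 k (B : 'M[int]_2) : B = exchange2 \/ B = - exchange2 ->
  mutate_exchange k B = - B.
Proof.
move=> [->|->]; apply/matrixP => i j; rewrite !mxE;
  by case: (ord2 k) => ->; case: (ord2 i) => ->; case: (ord2 j) => ->.
Qed.

(** Changing the sign of B only exchanges the two monomials of the exchange relation. *)
Lemma mutate_cluster2 (F : fieldType) k (B : 'M[int]_2) (x : 'I_2 -> F) : B = exchange2 \/ B = - exchange2 ->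
  mutate_cluster k B x =
  fun j => if j == k then (x (if k == i0 then i1 else i0) ^+ 2 + 1) / x k else x j.
Proof.
move=> hB; apply/funext => j; rewrite /mutate_cluster; case: ifP => // _.
rewrite mulrC; congr (_ / _).
rewrite !big_ord_recl !big_ord0.
have -> : lift ord0 (ord0 : 'I_1) = i1 by apply: val_inj.
case: hB => ->; case: (ord2 k) => -> /=; rewrite !mxE/= /pos_part.
- by rewrite -[LHS]/(1 * (x i1 ^+ 2 * 1) + 1 * (1 * 1)) !mul1r mulr1.
- by rewrite -[LHS]/(1 * (1 * 1) + x i0 ^+ 2 * (1 * 1)) !mulr1 addrC.
- by rewrite -[LHS]/(1 * (1 * 1) + 1 * (x i1 ^+ 2 * 1)) !mul1r mulr1 addrC.
- by rewrite -[LHS]/(x i0 ^+ 2 * (1 * 1) + 1 * (1 * 1)) !mulr1.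
Qed.

Definition exchange_seed n (s : seed Qx 2) :=
  (seed_matrix s = exchange2 \/ seed_matrix s = - exchange2) /\
  exchange_pair n (seed_cluster s i0) (seed_cluster s i1).

Lemma exchange_seedS n s k : exchange_seed n s -> exchange_seed n.+1 (mutate s k).
Proof.
move=> [hB hp]; split.
  by rewrite /= (mutate_exchange2 k hB); case: hB => ->; [right|left; rewrite opprK].
rewrite /= (mutate_cluster2 _ _ hB); case: (ord2 k) => -> /=.
  exact/exchange_pairC/exchange_pairS.
exact/exchange_pairS/exchange_pairC.
Qed.

Lemma exchange_seed_word n s (w : seq 'I_2) :
  exchange_seed n s -> exchange_seed (n + size w) (mutate_seq s w).
Proof.
elim: w n s => [|k w IH] n s hs; first by rewrite addn0.
by rewrite /= addnS -addSn; exact/IH/exchange_seedS.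
Qed.

Lemma exchange_seed0 : exchange_seed 0 seed2.
Proof. by split; [left|exact: exchange_pair0]. Qed.

(** Each letter replaces the older of the two cluster variables, which makes the mutations follow
    the recurrence. *)
Definition alternating_word n : seq 'I_2 := mkseq (fun i => inord (odd i)) n.

Lemma mutate_seq_alternating n :
  let s := mutate_seq seed2 (alternating_word n) in
  seed_cluster s (inord (odd n)) = xseq n.+1 /\
  seed_cluster s (inord (~~ odd n)) = xseq n.+2.
Proof.
have e0 : inord 0 = i0 by apply: val_inj; rewrite /= inordK.
have e1 : inord 1 = i1 by apply: val_inj; rewrite /= inordK.
elim: n => [|n IH s']; first by rewrite /= e0 e1.
rewrite {}/s' /alternating_word mkseqS /mutate_seq foldl_rcons.
rewrite -/(mutate_seq _ _) -/(alternating_word n) oddS.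
move: IH; set s := mutate_seq _ _ => /= -[IH1 IH2].
have [hB _] : exchange_seed (0 + size (alternating_word n)) s.
  exact: exchange_seed_word exchange_seed0.
rewrite (mutate_cluster2 _ _ hB) negbK xseqSS.
by move: IH1 IH2; case: (odd n); rewrite /= ?e0 ?e1 => -> ->.
Qed.

End seeds.
End exchange_pairs.

(** * Asymptotics of m(x_n) and vanishing of the entropies *)

Section entropy.
Variable R : realType.

Lemma mahlerQ_xseq : exists C : R, forall n, `|mahlerQ R (xseq n.+2) - Cstar R * n%:R| <= C.
Proof.
have [C hC] := mahler_ycis_asymptotics R; exists C => n.
rewrite (@mahlerQE _ _ (fun u v => yseq (Kfun u v) u v n.+2))//.
  by have [[]] := exchange_pair_xseq R n.
by rewrite (xseq_yseq R n.+1); exact: (@torus_values_yseq R n.+1).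
Qed.

Lemma mahlerQ_xseq_bigO :
  (fun n : nat => mahlerQ R (xseq n) - Cstar R * n%:R : R^o) =O_\oo (fun=> 1 : R^o).
Proof.
have [C hC] := mahlerQ_xseq.
apply/eqOP; near=> k; near=> n.
rewrite normr1 mulr1.
have n2 : (2 <= n)%N by near: n; exists 2%N.
have -> : n = (n - 2).+2 by lia.
have := hC (n - 2)%N; set m := (n - 2)%N => hm.
(* The index shift by two costs the constant 2 C*. *)
have -> : mahlerQ R (xseq m.+2) - Cstar R * m.+2%:R =
    mahlerQ R (xseq m.+2) - Cstar R * m%:R - 2 * Cstar R by rewrite -addn2 natrD; ring.
apply: le_trans (ler_normB _ _) _.
apply: (@le_trans _ _ (C + `|2 * Cstar R|)); first by rewrite lerD2r.
by near: k; apply: nbhs_pinfty_ge; rewrite num_real.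
Unshelve. all: by end_near. Qed.

(** The positivity of C* is read off the numerical bounds. A measure of at least 1 makes log m
    nonnegative, which is the lower side of both squeezes. *)
Lemma mahlerQ_xseq_ge1 : \forall n \near \oo, 1 <= mahlerQ R (xseq n.+2).
Proof.
have [C hC] := mahlerQ_xseq; have /andP[c0 _] := Cstar_bounds R.
have {}c0 : 0 < Cstar R by lra.
near=> n; have := hC n; rewrite ler_norml => /andP[lo _].
have : (C + 1) / Cstar R <= n%:R by near: n; exact: nbhs_infty_ger.
by rewrite ler_pdivrMr// mulrC; lra.
Unshelve. all: by end_near. Qed.

Let bound (n : nat) : R := ln (n%:R * ln 4) / n%:R.

Let ln4 : 0 < ln 4 :> R. Proof. by rewrite ln_gt0//; lra. Qed.

(** With e = 1 / (n ln 4), the bound is - ln 4 times e ln e, so the limit of x ln x at 0 applies. *)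
Let bound_cvg0 : bound n @[n --> \oo] --> 0.
Proof.
pose e (n : nat) : R := (n.+1%:R * ln 4)^-1.
have e0 n : 0 < e n by rewrite invr_gt0 mulr_gt0.
have ecv : e n @[n --> \oo] --> (0 : R).
  have -> : e = fun n => (ln 4)^-1 * harmonic n by apply/funext => n; rewrite /e invfM mulrC.
  rewrite -[X in _ --> X](mulr0 (ln 4)^-1); apply: cvgMr; exact: cvg_harmonic.
have h := (cvg_at_rightP _ _ _).1 (@xlnx_cvg0 R) e (conj e0 ecv).
rewrite -cvg_shiftS.
have E : (fun n => bound n.+1) = fun n => - ln 4 * (e n * ln (e n)).
  apply/funext => n; rewrite /bound /e lnV ?posrE ?mulr_gt0//.
  have gen (l a b : R) : a != 0 -> b != 0 -> l / b = - a * ((b * a)^-1 * - l).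
    by move=> a0 b0; field; rewrite a0 b0.
  by apply: gen; [rewrite gt_eqF|rewrite pnatr_eq0].
have : (fun n => - ln 4 * (e n * ln (e n))) @ \oo --> - ln 4 * 0 by apply: cvgMr.
by rewrite E mulr0.
Qed.

Let lne_le (M : \bar R) (n : nat) : (0 < n)%N -> (M <= (n%:R * ln 4)%:E)%E ->
  (lne M * (n%:R^-1)%:E <= (bound n)%:E)%E.
Proof.
move=> n0 Ma; have a0 : 0 < n%:R * ln 4 :> R by rewrite mulr_gt0// ltr0n.
rewrite EFinM; apply: lee_wpmul2r; first by rewrite lee_fin invr_ge0.
rewrite -lne_EFin//; have [M0|M0] := leP M 0%E; first by rewrite le0_lneNy// leNye.
by rewrite lee_lne// in_itv/= leey ?lee_fin ?ltW.
Qed.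

Let lne_ge (M : \bar R) (n : nat) : (1 <= M)%E -> (0 <= lne M * (n%:R^-1)%:E)%E.
Proof. by move=> M1; rewrite mule_ge0 ?lne_ge0// lee_fin invr_ge0. Qed.

Let squeeze (f : nat -> \bar R) :
  (forall n, (0 < n)%N -> (f n <= (bound n)%:E)%E) ->
  (\forall n \near \oo, (0 <= f n)%E) -> f @ \oo --> 0%E.
Proof.
move=> fb f0.
have h : (bound n)%:E @[n --> \oo] --> 0%:E.
  exact: (@cvg_comp _ _ _ _ EFin _ _ _ bound_cvg0).
apply: (@squeeze_cvge _ _ _ _ (fun=> 0%E) f (fun n => (bound n)%:E)) => //; last exact: cvg_cst.
near=> n; apply/andP; split; first by near: n.
by apply: fb; near: n; exists 1%N.
Unshelve. all: by end_near. Qed.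

Let map_entropy_seqE n : map_entropy_seq R phi n =
  (lne (Num.max (mahlerQ R (xseq n.+1)) (mahlerQ R (xseq n.+2)))%:E * (n%:R^-1)%:E)%E.
Proof. by rewrite /map_entropy_seq iter_phi. Qed.

Lemma map_entropy0 : map_entropy_seq R phi @ \oo --> 0%E.
Proof.
apply: squeeze => [n n0|].
  have [[l1 l2] _ _ _ [t1 t2]] := exchange_pair_xseq R n.
  rewrite map_entropy_seqE; apply: lne_le => //; rewrite lee_fin ge_max.
  by apply/andP; split; exact: tame_mahlerQ.
near=> n; rewrite map_entropy_seqE; apply: lne_ge; rewrite lee_fin le_max; apply/orP; right.
by near: n; exact: mahlerQ_xseq_ge1.
Unshelve. all: by end_near. Qed.

Lemma cluster_entropy0 : cluster_entropy_seq R seed2 @ \oo --> 0%E.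
Proof.
apply: squeeze => [n n0|].
  apply: ge_ereal_sup => _ [w _ <-]; apply: lne_le => //.
  have [_ [[l1 l2] _ _ _ [t1 t2]]] := exchange_seed_word w (exchange_seed0 R).
  rewrite add0n size_tuple in t1 t2.
  apply: bigmax_le => [|i _]; first by rewrite leNye.
  by rewrite lee_fin; case: (ord2 i) => ->; rewrite tame_mahlerQ.
near=> n.
have sz : size (alternating_word n) == n by rewrite size_mkseq.
apply: le_trans (ereal_sup_ubound _); last by exists (Tuple sz).
apply: lne_ge => /=; rewrite /cluster_mahler.
have [_ E] := mutate_seq_alternating R n.
apply: le_trans (le_bigmax _ _ (inord (~~ odd n))); rewrite E lee_fin.
by near: n; exact: mahlerQ_xseq_ge1.
Unshelve. all: by end_near. Qed.

End entropy.

Theorem theorem2p2 (R : realType) :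
  [/\ (* x_n solves the recurrence and consists of integer Laurent polynomials *)
      (forall n : nat, (0 < n)%N -> xseq n.+2 * xseq n = xseq n.+1 ^+ 2 + 1) /\
      (forall n : nat, (0 < n)%N -> is_laurent (xseq n)),
      (forall (w : seq 'I_2) (i : 'I_2),
         is_laurent (seed_cluster (mutate_seq seed2 w) i)),
      (map_entropy_seq R phi @ \oo --> 0%E) /\
      (cluster_entropy_seq R seed2 @ \oo --> 0%E),
      (fun n : nat => mahlerQ R (xseq n) - Cstar R * n%:R : R^o)
        =O_\oo (fun=> 1 : R^o)
    & 483 / 10 ^+ 3 + 997 / 10 ^+ 6 <= Cstar R < 483 / 10 ^+ 3 + 998 / 10 ^+ 6].
Proof.
split.
- split=> -[//|n] _; have [[l1 _] p1 _ _ _] := exchange_pair_xseq R n => //.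
  by rewrite (xseqSS) mulfVK// positive_at1_neq0.
- move=> w i; have [_ [[l1 l2] _ _ _ _]] := exchange_seed_word w (exchange_seed0 R).
  by case: (ord2 i) => ->.
- by split; [exact: map_entropy0|exact: cluster_entropy0].
- exact: mahlerQ_xseq_bigO.
- exact: Cstar_bounds.
Qed.
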